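(* Let $a,b\in\mathbb{R}$ be such that $ab\ge 1$ and $ab$ is rational, and let $g\in L^2(\mathbb{R})$. Suppose that the functions $x\mapsto e^{2\pi i b n x}g(x-am)$, $(am,bn)\in a\mathbb{Z}\times b\mathbb{Z}$ (that is, $m,n\in\mathbb{Z}$), form an orthonormal system in $L^2(\mathbb{R})$, and that the closed linear span of this system contains the function $x\mapsto e^{2\pi i\eta x}g(x-u)$ for some $(u,\eta)\in\mathbb{R}^2$ with $(u,\eta)\notin a\mathbb{Z}\times b\mathbb{Z}$. Then $$\Big(\int_{\mathbb{R}} |x-\alpha|^2 |g(x)|^2\,dx\Big)\cdot\Big(\int_{\mathbb{R}} |\omega-\beta|^2|\widehat g(\omega)|^2\,d\omega\Big)=\infty\qquad\text{for all }\alpha,\beta\in\mathbb{R}.$$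
   Context: $L^2(\mathbb{R})$ consists of complex-valued functions. $\widehat g$ denotes the Fourier transform, the unitary extension to $L^2(\mathbb{R})$ of $\widehat f(\omega)=\int_{\mathbb{R}}f(x)e^{-2\pi i x\omega}\,dx$, $f\in L^1(\mathbb{R})\cap L^2(\mathbb{R})$. *)

(* Defs.v *)
From HB Require Import structures.
From mathcomp Require Import all_boot all_order all_algebra.
From mathcomp Require Import all_classical all_reals all_analysis.
From mathcomp.real_closed Require Export complex.

Set Implicit Arguments.
Unset Strict Implicit.
Unset Printing Implicit Defensive.

Import Order.TTheory GRing.Theory Num.Theory.
Import numFieldNormedType.Exports.

Local Open Scope classical_set_scope.
Local Open Scope ring_scope.
Local Open Scope complex_scope.

(* An element of L^2(R) is represented by a function R -> R[i] that is        *)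
(* measurable for the Borel sigma-algebra of R, the one carried by R in the   *)
(* library; every almost-everywhere class has such a representative.          *)

Section ComplexL2.
Context {R : realType}.
Local Notation mu := (@lebesgue_measure R).
Implicit Types f g h : R -> R[i].

Definition cmeasurable f :=
  measurable_fun [set: R] (fun x => complex.Re (f x)) /\
  measurable_fun [set: R] (fun x => complex.Im (f x)).

Definition cLnorm (p : R) f : \bar R :=
  Lnorm mu p%:E (fun x => (Normc.normc (f x))%:E).

Definition inL (p : R) f := cmeasurable f /\ (cLnorm p f < +oo)%E.

Definition cintegral f : R[i] :=
  (\int[mu]_x complex.Re (f x)) +i* (\int[mu]_x complex.Im (f x)).

Definition inner f g : R[i] := cintegral (fun x => f x * (g x)^*).

Definition orthonormal_system (I : eqType) (e : I -> R -> R[i]) :=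
  (forall i, inL 2 (e i)) /\
  (forall i j, inner (e i) (e j) = (i == j)%:R).

(* Repetitions in [s] are harmless: they only rescale coefficients. *)
Definition linear_span (I : Type) (e : I -> R -> R[i]) : set (R -> R[i]) :=
  [set f | exists (s : seq I) (c : I -> R[i]),
     f = fun x => \sum_(i <- s) c i * e i x].

Definition closed_linear_span (I : Type) (e : I -> R -> R[i]) :
    set (R -> R[i]) :=
  [set h | inL 2 h /\
     forall eps : R, 0 < eps ->
       exists2 f, linear_span e f & (cLnorm 2 (h \- f)%R < eps%:E)%E].

Definition expi (t : R) : R[i] := cos t +i* sin t.

Definition tfshift (u eta : R) g : R -> R[i] :=
  fun x => expi (2 * pi * eta * x) * g (x - u).

Definition gabor_system (a b : R) g (mn : int * int) : R -> R[i] :=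
  tfshift (a * mn.1%:~R) (b * mn.2%:~R) g.

Definition fourier_integral f (w : R) : R[i] :=
  cintegral (fun x => f x * expi (- (2 * pi * x * w))).

(* [gh] represents the value at [g] of the continuous extension to L^2(R) of   *)
(* the Fourier integral on the dense subspace L^1 /\ L^2; since that operator  *)
(* is isometric, [gh] is determined up to a.e. equality and does not depend on *)
(* the approximating sequence.                                                 *)
Definition is_fourier_transform g gh :=
  inL 2 gh /\
  exists f : nat -> R -> R[i],
    [/\ forall n, inL 1 (f n) /\ inL 2 (f n),
        (fun n => cLnorm 2 (f n \- g)) @ \oo --> (0 : \bar R)%E
      & (fun n => cLnorm 2 (fourier_integral (f n) \- gh)) @ \oo
          --> (0 : \bar R)%E].

End ComplexL2.

(* Main.v *)
From HB Require Import structures.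
Require Import Defs.
From mathcomp Require Import all_boot all_order all_algebra.
From mathcomp Require Import all_classical all_reals all_analysis.
From mathcomp Require Import ring lra zify.
From mathcomp Require Import measurable_realfun.

Set Implicit Arguments.
Unset Strict Implicit.
Unset Printing Implicit Defensive.

Import Order.TTheory GRing.Theory Num.Theory.
Import numFieldNormedType.Exports.

Local Open Scope classical_set_scope.
Local Open Scope ring_scope.
Local Open Scope complex_scope.

(** If both second moments are finite, then u is in a Z and eta is in b Z; this
    contradicts the choice of (u, eta), so that one of the integrals is infinite,
    and neither of them vanishes because g is not zero.

    Both memberships come from one statement about the first coordinate
    ([lattice_coordinate]), applied to g with the lattice a Z x b Z and to its
    Fourier transform with the lattice b Z x (-a) Z.  Only two consequences of
    the finite moments enter it: the integral of (x - alpha)^2 |g|^2 is finite,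
    and translations move g by at most O(|t|) in norm up to a phase, because the
    second moment of the Fourier transform is finite ([shift_close]).

    Let h be the shift of g by (u, eta), P = 1/|b| and a q = p P with integers
    p and q; such q and p exist because a b is rational.  On almost every coset
    x + P Z the hypotheses on the system become statements about the sequences
    k |-> f (x + k P): the restrictions of the translates of g by a Z are
    orthonormal for the inner product P sum_k, so are those of h, and the latter
    lie in the closed span of the former.  This uses only that an integrable
    function on a circle is determined by its Fourier coefficients
    ([periodize_const]).

    Translation by a q maps the coset x + P Z to itself, so that the two
    orthonormal families, cut into blocks of q consecutive translates, have
    block Toeplitz overlaps.  The sum over r < q of the differences between the
    mean positions of the r-th translates of h and of g is then the
    trace of the commutator of the position with a projection.  As in the proof
    that the index of a pair of projections is an integer, this trace is a q
    times an integer ([position_trace_integrality]): it is the limit of the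
    traces of finite sections of a projection, and these sections are nearly
    projections, because finiteness of the moments makes the overlaps decay.
    Writing center(x) for the first moment of |g|^2 on x + P Z and
      D(x) = sum_(r < q) (center(x - a r - u) - center(x - a r)),
    one obtains P D(x) + q u in a q Z for almost every x ([ae_index]).

    Finally D = 0 almost everywhere ([D_eq0]).  The values of D differ by integers,
    while the O(|t|) bound makes the increments of the function center over a small
    step t less than any fixed size outside a set of measure o(t).  Composing n
    steps of length s / n shows that D is invariant under translation by every
    s.  Then n D is the sum of the D(x - j u) for j < n, which telescopes to a
    difference of two values of one integrable periodic function, and D = 0.
    Hence q u is in a q Z, that is, u is in a Z. *)

(** * Squared modulus, pre-Hilbert spaces and almost-projections *)

Section nsq.
Context {R : realType}.
Implicit Types z w : R[i].

(** The squared modulus with values in R, where [`|z| ^+ 2] would have values in R[i]. *)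
Definition nsq z : R := complex.Re z ^+ 2 + complex.Im z ^+ 2.

Lemma nsqE z : (nsq z)%:C = z * (conjc z).
Proof. by case: z => x y; rewrite /nsq /=; simpc; congr (_ +i* _); ring. Qed.

Lemma nsq_ge0 z : 0 <= nsq z. Proof. by rewrite addr_ge0// sqr_ge0. Qed.

Lemma nsqM z w : nsq (z * w) = nsq z * nsq w.
Proof. by case: z w => x y [u v]; rewrite /nsq/=; ring. Qed.

Lemma nsqJ z : nsq (conjc z) = nsq z.
Proof. by case: z => x y; rewrite /nsq/=; ring. Qed.

Lemma nsqD z w : nsq (z + w) <= 2 * nsq z + 2 * nsq w.
Proof.
case: z w => x y [u v]; rewrite /nsq/=.
by have := sqr_ge0 (x - u); have := sqr_ge0 (y - v); lra.
Qed.

Lemma nsqN z : nsq (- z) = nsq z.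
Proof. by case: z => x y; rewrite /nsq/=; ring. Qed.

Lemma nsqB z w : nsq (z - w) <= 2 * nsq z + 2 * nsq w.
Proof. by rewrite -(nsqN w) nsqD. Qed.

Lemma nsqR (x : R) : nsq x%:C = x ^+ 2.
Proof. by rewrite /nsq/=; ring. Qed.

Lemma nsq_eq0 z : nsq z = 0 -> z = 0.
Proof.
by case: z => x y; rewrite /nsq/= => /eqP;
rewrite paddr_eq0 ?sqr_ge0// !sqrf_eq0 => /andP[/eqP-> /eqP->]. Qed.

Lemma cReD z w : complex.Re (z + w) = complex.Re z + complex.Re w.
Proof. by case: z w => x y [u v]. Qed.
Lemma cImD z w : complex.Im (z + w) = complex.Im z + complex.Im w.
Proof. by case: z w => x y [u v]. Qed.
Lemma cReN z : complex.Re (- z) = - complex.Re z. Proof. by case: z. Qed.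
Lemma cImN z : complex.Im (- z) = - complex.Im z. Proof. by case: z. Qed.
Lemma cReM z w : complex.Re (z * w) =
  complex.Re z * complex.Re w - complex.Im z * complex.Im w.
Proof. by case: z w => x y [u v]. Qed.
Lemma cImM z w : complex.Im (z * w) =
  complex.Re z * complex.Im w + complex.Im z * complex.Re w.
Proof. by case: z w => x y [u v]. Qed.
Lemma cReJ z : complex.Re (conjc z) = complex.Re z. Proof. by case: z. Qed.
Lemma cImJ z : complex.Im (conjc z) = - complex.Im z. Proof. by case: z. Qed.
Lemma cRe_sum (I : Type) (s : seq I) (P : pred I) (F : I -> R[i]) :
  complex.Re (\sum_(i <- s | P i) F i) = \sum_(i <- s | P i) complex.Re (F i).
Proof. by elim/big_rec2: _ => // i y1 y2 _ <-; rewrite cReD. Qed.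
Lemma conj_sum (I : Type) (s : seq I) (P : pred I) (F : I -> R[i]) :
  (conjc (\sum_(i <- s | P i) F i)) = \sum_(i <- s | P i) (conjc (F i)).
Proof. by rewrite (raddf_sum (@conjc R)). Qed.
Lemma realC_sum (I : Type) (s : seq I) (P : pred I) (F : I -> R) :
  (\sum_(i <- s | P i) F i)%:C = \sum_(i <- s | P i) (F i)%:C.
Proof. exact: (raddf_sum (real_complex R)). Qed.
Lemma conjM z w : (conjc (z * w)) = (conjc z) * (conjc w).
Proof. exact: (rmorphM (@conjc R)). Qed.
Lemma conjD z w : (conjc (z + w)) = (conjc z) + (conjc w).
Proof. exact: (rmorphD (@conjc R)). Qed.
Lemma conjN z : (conjc (- z)) = - (conjc z). Proof. exact: (raddfN (@conjc R)). Qed.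
Lemma cRe_norm z : complex.Re z ^+ 2 <= nsq z.
Proof. by rewrite /nsq ?lerDl ?lerDr sqr_ge0. Qed.
Lemma cIm_norm z : complex.Im z ^+ 2 <= nsq z.
Proof. by rewrite /nsq ?lerDl ?lerDr sqr_ge0. Qed.
End nsq.

(** A positive semidefinite form on the subspace [dom] of V.  Neither definiteness
    nor completeness is required, so that square-integrable functions form an
    instance without passing to classes modulo equality almost everywhere. *)
Record prehilbert (R : realType) (V : lmodType R[i]) := Prehilbert {
  dom : V -> Prop;
  ip : V -> V -> R[i];
  dom0 : dom 0;
  domZD : forall a u v, dom u -> dom v -> dom (a *: u + v);
  ipZD : forall a u v w, dom u -> dom v -> dom w ->
           ip (a *: u + v) w = a * ip u w + ip v w;
  ipJ : forall u v, dom u -> dom v -> ip v u = (conjc (ip u v));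
  ip_ge0 : forall u, dom u -> 0 <= ip u u }.
Arguments dom {R V}.
Arguments ip {R V}.

Section prehilbert.
Context {R : realType} {V : lmodType R[i]} (E : prehilbert V).
Local Notation "<< u , v >>" := (ip E u v) (at level 0).
Local Notation dom := (dom E).
Implicit Types (u v w : V) (a : R[i]).

Definition nrm2 u : R := complex.Re <<u, u>>.

Lemma nrm2E u : dom u -> <<u, u>> = (nrm2 u)%:C.
Proof.
by move=> /(ip_ge0); rewrite lecE /nrm2; case: (<<u,u>>) => x y /= /andP[/eqP-> _].
Qed.

Lemma nrm2_ge0 u : dom u -> 0 <= nrm2 u.
Proof. by move=> du; rewrite -lecR -nrm2E//; exact: ip_ge0. Qed.

Lemma domD u v : dom u -> dom v -> dom (u + v).
Proof. by move=> du dv; rewrite -[u]scale1r; apply: domZD. Qed.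
Lemma domZ a u : dom u -> dom (a *: u).
Proof. by move=> du; rewrite -[_ *: _]addr0; apply: domZD => //; exact: dom0. Qed.
Lemma domN u : dom u -> dom (- u).
Proof. by move=> du; rewrite -scaleN1r; exact: domZ. Qed.
Lemma domB u v : dom u -> dom v -> dom (u - v).
Proof. by move=> du /domN; exact: domD. Qed.
Lemma dom_sum (I : Type) (s : seq I) (P : pred I) (F : I -> V) :
  (forall i, dom (F i)) -> dom (\sum_(i <- s | P i) F i).
Proof. by move=> dF; elim/big_rec: _ => [|i x _ dx]; [exact: dom0|exact: domD]. Qed.

Lemma ipDl u v w : dom u -> dom v -> dom w -> <<u + v, w>> = <<u, w>> + <<v, w>>.
Proof. by move=> *; rewrite -[u]scale1r ipZD// mul1r scale1r. Qed.
Lemma ip0l w : dom w -> <<0, w>> = 0.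
Proof.
move=> dw; have := @ipDl 0 0 w (dom0 _) (dom0 _) dw.
by rewrite addr0 => /eqP; rewrite -subr_eq0 opprD addNKr oppr_eq0 => /eqP.
Qed.
Lemma ipZl a u w : dom u -> dom w -> <<a *: u, w>> = a * <<u, w>>.
Proof. by move=> *; rewrite -[_ *: _]addr0 ipZD ?ip0l ?addr0//; exact: dom0. Qed.
Lemma ipNl u w : dom u -> dom w -> <<- u, w>> = - <<u, w>>.
Proof. by move=> *; rewrite -scaleN1r ipZl// mulN1r. Qed.
Lemma ipBl u v w : dom u -> dom v -> dom w -> <<u - v, w>> = <<u, w>> - <<v, w>>.
Proof. by move=> du dv dw; rewrite ipDl ?ipNl//; exact: domN. Qed.
Lemma ip_suml (I : Type) (s : seq I) (P : pred I) (F : I -> V) w :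
  (forall i, dom (F i)) -> dom w ->
  <<\sum_(i <- s | P i) F i, w>> = \sum_(i <- s | P i) <<F i, w>>.
Proof.
move=> dF dw; elim: s => [|i s IH]; first by rewrite !big_nil ip0l.
by rewrite !big_cons; case: ifP => // Pi; rewrite ipDl ?IH//; exact: dom_sum.
Qed.
Lemma conj_ip u v : dom u -> dom v -> (conjc <<u, v>>) = <<v, u>>.
Proof. by move=> du dv; rewrite -(ipJ du dv). Qed.
Lemma ipDr u v w : dom u -> dom v -> dom w -> <<w, u + v>> = <<w, u>> + <<w, v>>.
Proof.
move=> du dv dw; have duv := domD du dv.
by rewrite -conj_ip// ipDl// conjD !conj_ip.
Qed.
Lemma ipZr a u w : dom u -> dom w -> <<w, a *: u>> = (conjc a) * <<w, u>>.
Proof.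
move=> du dw; have dau := domZ a du.
by rewrite -conj_ip// ipZl// conjM conj_ip.
Qed.
Lemma ipNr u w : dom u -> dom w -> <<w, - u>> = - <<w, u>>.
Proof.
move=> du dw; have dnu := domN du.
by rewrite -conj_ip// ipNl// conjN conj_ip.
Qed.
Lemma ipBr u v w : dom u -> dom v -> dom w -> <<w, u - v>> = <<w, u>> - <<w, v>>.
Proof. by move=> du dv dw; rewrite ipDr ?ipNr//; exact: domN. Qed.
Lemma ip_sumr (I : Type) (s : seq I) (P : pred I) (F : I -> V) w :
  (forall i, dom (F i)) -> dom w ->
  <<w, \sum_(i <- s | P i) F i>> = \sum_(i <- s | P i) <<w, F i>>.
Proof.
move=> dF dw; have dS := dom_sum s P dF.
rewrite -conj_ip// ip_suml// conj_sum.
by apply: eq_bigr => i _; rewrite conj_ip.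
Qed.

Lemma nsq_ipC u v : dom u -> dom v -> nsq <<u, v>> = nsq <<v, u>>.
Proof. by move=> du dv; rewrite -(conj_ip dv du) nsqJ. Qed.

Lemma nrm2D u v : dom u -> dom v -> nrm2 (u + v) <= 2 * nrm2 u + 2 * nrm2 v.
Proof.
move=> du dv; have duv := domD du dv; have duv' := domB du dv.
suff : nrm2 (u + v) + nrm2 (u - v) = 2 * nrm2 u + 2 * nrm2 v.
  by move=> <-; rewrite lerDl nrm2_ge0.
have -> : nrm2 (u - v) = nrm2 u + nrm2 v - complex.Re <<u, v>> - complex.Re <<v, u>>.
  by rewrite /nrm2 ipBl// !ipBr// !(cReD, cReN); ring.
by rewrite /nrm2 ipDl// !ipDr// !cReD; ring.
Qed.

Lemma nrm2N u : dom u -> nrm2 (- u) = nrm2 u.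
Proof. by move=> du; have := domN du => dn; rewrite /nrm2 ipNl// ipNr// opprK. Qed.

Lemma nrm2Z a u : dom u -> nrm2 (a *: u) = nsq a * nrm2 u.
Proof.
move=> du; apply: complexI; rewrite -nrm2E; last exact: domZ.
rewrite ipZl ?ipZr//; last exact: domZ.
by rewrite mulrA -nsqE nrm2E// (rmorphM (real_complex R)).
Qed.

Definition orthonormal (I : eqType) (e : I -> V) :=
  (forall i, dom (e i)) /\ (forall i j, <<e i, e j>> = (i == j)%:R).

Section finite_family.
Context {I : eqType} (e : I -> V) (one : orthonormal e).
Implicit Types (s : seq I).

Lemma ip_comb s (c : I -> R[i]) i : uniq s ->
  <<\sum_(j <- s) c j *: e j, e i>> = if i \in s then c i else 0.
Proof.
move=> us; have [de oe] := one.
rewrite ip_suml => [||//]; last by move=> j; apply: domZ.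
under eq_bigr => j _ do rewrite ipZl ?de// oe.
case: ifP => [si|/negbT si].
  rewrite (bigD1_seq i)//= eqxx mulr1 big1 ?addr0// => j /negbTE ->.
  by rewrite mulr0.
rewrite big1_seq// => j /= sj; case: eqP => [ji|_]; last by rewrite mulr0.
by rewrite -ji sj in si.
Qed.

Lemma nrm2_comb s (c : I -> R[i]) : uniq s ->
  nrm2 (\sum_(j <- s) c j *: e j) = \sum_(j <- s) nsq (c j).
Proof.
move=> us; have [de oe] := one; have dc i : dom (c i *: e i) by apply: domZ.
rewrite /nrm2 ip_sumr//; last exact: dom_sum.
rewrite cRe_sum; apply: eq_big_seq => i si.
rewrite ipZr//; last exact: dom_sum.
by rewrite ip_comb// si mulrC -nsqE.
Qed.

(** Completing the square in the coefficients [c j]. *)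
Lemma nrm2_sub_comb s (c : I -> R[i]) v : uniq s -> dom v ->
  nrm2 (v - \sum_(j <- s) c j *: e j) =
  nrm2 v - \sum_(j <- s) nsq <<v, e j>> + \sum_(j <- s) nsq (c j - <<v, e j>>).
Proof.
move=> us dv; have [de oe] := one; have dc i : dom (c i *: e i) by apply: domZ.
set p := \sum_(j <- s) _; have dp : dom p by exact: dom_sum.
have -> : nrm2 (v - p) = nrm2 v + nrm2 p - 2 * complex.Re <<v, p>>.
  have dvp := domB dv dp.
  rewrite /nrm2 ipBl// !ipBr// -(conj_ip dv dp) !(cReD, cReN, cReJ); lra.
rewrite /p nrm2_comb// ip_sumr// cRe_sum mulr_sumr.
rewrite -!addrA; congr (_ + _); rewrite -!sumrN -!big_split/=.
apply: eq_bigr => i _; rewrite ipZr//.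
by case: (c i) (<<v, e i>>) => x y [x' y']; rewrite /nsq/=; ring.
Qed.

(** The coefficients [<<v, e j>>] annihilate the square in [nrm2_sub_comb]. *)
Lemma nrm2_residual s v : uniq s -> dom v ->
  nrm2 (v - \sum_(j <- s) <<v, e j>> *: e j) =
  nrm2 v - \sum_(j <- s) nsq <<v, e j>>.
Proof.
move=> us dv; rewrite nrm2_sub_comb// [X in _ + X]big1 ?addr0// => i _.
by rewrite subrr /nsq/=; ring.
Qed.

Lemma bessel s v : uniq s -> dom v -> \sum_(j <- s) nsq <<v, e j>> <= nrm2 v.
Proof.
move=> us dv; rewrite -subr_ge0 -nrm2_residual//; apply: nrm2_ge0.
by apply: domB => //; apply: dom_sum => i; apply: domZ; apply: one.1.
Qed.

Lemma best_approx s (c : I -> R[i]) v : uniq s -> dom v ->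
  nrm2 v - \sum_(j <- s) nsq <<v, e j>> <= nrm2 (v - \sum_(j <- s) c j *: e j).
Proof.
by move=> us dv; rewrite nrm2_sub_comb// lerDl sumr_ge0// => i _; exact: nsq_ge0.
Qed.

End finite_family.

Lemma cauchy_schwarz u v : dom u -> dom v -> nsq <<u, v>> <= nrm2 u * nrm2 v.
Proof.
move=> du dv.
pose k := <<u, v>>; have key (t : R) :
    0 <= nrm2 u - 2 * t * nsq k + t ^+ 2 * nsq k * nrm2 v.
  have dz : dom ((t%:C * k) *: v) by exact: domZ.
  have := nrm2_ge0 (domB du dz).
  have -> // : nrm2 (u - (t%:C * k) *: v) =
      nrm2 u - 2 * t * nsq k + t ^+ 2 * nsq k * nrm2 v.
  have -> : nrm2 (u - (t%:C * k) *: v) =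
      nrm2 u + nrm2 ((t%:C * k) *: v) - 2 * complex.Re <<u, (t%:C * k) *: v>>.
    have dvp := domB du dz.
    rewrite /nrm2 ipBl// !ipBr// -(conj_ip du dz) !(cReD, cReN, cReJ); lra.
  rewrite nrm2Z// nsqM nsqR ipZr// -/k.
  by case: (k) => x y; rewrite /nsq/=; ring.
have k0 := nsq_ge0 k; have v0 := nrm2_ge0 dv.
rewrite -/k; have [vz|vz] := eqVneq (nrm2 v) 0.
  have [->|kz] := eqVneq (nsq k) 0; first by rewrite vz mulr0.
  have kp : 0 < nsq k by rewrite lt_neqAle eq_sym kz.
  (* For v of norm 0 the polynomial of [key] is affine in t, and this t gives it the value -1. *)
  have := key ((nrm2 u + 1) / (2 * nsq k)).
  rewrite vz mulr0 addr0.
  have -> : 2 * ((nrm2 u + 1) / (2 * nsq k)) * nsq k = nrm2 u + 1 by field.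
  by lra.
have vp : 0 < nrm2 v by rewrite lt_neqAle eq_sym vz.
have := key (nrm2 v)^-1.
have -> : nrm2 u - 2 * (nrm2 v)^-1 * nsq k + (nrm2 v)^-1 ^+ 2 * nsq k * nrm2 v =
  (nrm2 u * nrm2 v - nsq k) / nrm2 v by field.
by rewrite pmulr_lge0 ?invr_gt0// subr_ge0.
Qed.

(** Parseval fails for a family that is not total, by an amount that the missing
    mass of h controls: Cauchy-Schwarz for w and the residual of h. *)
Lemma parseval_defect (I : eqType) (e : I -> V) s w h :
  orthonormal e -> uniq s -> dom w -> dom h ->
  nsq (<<w, h>> - \sum_(i <- s) <<w, e i>> * <<e i, h>>) <=
  nrm2 w * (nrm2 h - \sum_(i <- s) nsq <<h, e i>>).
Proof.
move=> oe us dw dh; have de := oe.1.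
have dp : dom (\sum_(i <- s) <<h, e i>> *: e i) by apply: dom_sum => i; exact: domZ.
rewrite -(nrm2_residual oe us dh).
have <- : <<w, h - \sum_(j <- s) <<h, e j>> *: e j>> =
    <<w, h>> - \sum_(i <- s) <<w, e i>> * <<e i, h>>.
  rewrite ipBr// ip_sumr//; last by move=> i; exact: domZ.
  congr (_ - _); apply: eq_bigr => i _.
  by rewrite ipZr// conj_ip// mulrC.
by apply: cauchy_schwarz => //; exact: domB.
Qed.

(** The triangle inequality followed by Cauchy-Schwarz for the coefficients; it is
    expanded as a double sum because [nrm2] is a squared norm. *)
Lemma nrm2_lincomb (I : Type) (s : seq I) (c : I -> R[i]) (v : I -> V) :
  (forall i, dom (v i)) ->
  nrm2 (\sum_(i <- s) c i *: v i) <=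
  (\sum_(i <- s) nsq (c i)) * (\sum_(i <- s) nrm2 (v i)).
Proof.
move=> dv; have dc i : dom (c i *: v i) by exact: domZ.
have dS : dom (\sum_(i <- s) c i *: v i) by exact: dom_sum.
have -> : nrm2 (\sum_(i <- s) c i *: v i) =
    \sum_(i <- s) \sum_(j <- s) complex.Re (c i * (conjc (c j)) * <<v i, v j>>).
  rewrite /nrm2 ip_suml// cRe_sum; apply: eq_bigr => i _.
  rewrite ip_sumr// cRe_sum; apply: eq_bigr => j _.
  by rewrite ipZl// ipZr// mulrA.
have -> : (\sum_(i <- s) nsq (c i)) * (\sum_(i <- s) nrm2 (v i)) =
   \sum_(i <- s) \sum_(j <- s)
     (nsq (c i) * nrm2 (v j) + nsq (c j) * nrm2 (v i)) / 2.
  have -> : \sum_(i <- s) \sum_(j <- s) (nsq (c i) * nrm2 (v j) + nsq (c j) * nrm2 (v i)) / 2 =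
     (\sum_(i <- s) \sum_(j <- s) nsq (c i) * nrm2 (v j)) / 2 +
     (\sum_(i <- s) \sum_(j <- s) nsq (c j) * nrm2 (v i)) / 2.
    rewrite !mulr_suml -big_split; apply: eq_bigr => i _ /=.
    by rewrite !mulr_suml -big_split; apply: eq_bigr => j _; rewrite /= -mulrDl.
  rewrite [X in _ + X / 2]exchange_big /= -mulrDl -mulr2n -[X in X / 2]mulr_natr mulfK//.
  by rewrite mulr_suml; apply: eq_bigr => i _; rewrite mulr_sumr.
apply: ler_sum => i _; apply: ler_sum => j _.
have cs := cauchy_schwarz (dv i) (dv j).
set z := c i * _ * _.
set A := nsq (c i) * _; set B := nsq (c j) * _.
have A0 : 0 <= A by rewrite mulr_ge0 ?nsq_ge0 ?nrm2_ge0.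
have B0 : 0 <= B by rewrite mulr_ge0 ?nsq_ge0 ?nrm2_ge0.
have zAB : complex.Re z ^+ 2 <= A * B.
  apply: le_trans (cRe_norm _) _.
  rewrite /z !nsqM nsqJ /A /B.
  have -> : nsq (c i) * nrm2 (v j) * (nsq (c j) * nrm2 (v i)) =
     nsq (c i) * nsq (c j) * (nrm2 (v i) * nrm2 (v j)) by ring.
  by rewrite ler_wpM2l// mulr_ge0// nsq_ge0.
rewrite leNgt; apply/negP => AB; have := sqr_ge0 (A - B).
have : ((A + B) / 2) ^+ 2 < complex.Re z ^+ 2.
  by rewrite ltrXn2r// divr_ge0// addr_ge0.
by move: zAB; rewrite !expr2; nra.
Qed.

End prehilbert.

Section near_projection.
Context {R : realType}.
Local Notation C := R[i].
Local Open Scope sesquilinear_scope.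

(** An eigenvalue x in [0, 1] lies within 2 (x - x^2) of 0 or 1, so that the
    trace of an almost-projection is close to the number of eigenvalues near 1. *)
Lemma near_projection_trace n (Q : 'M[C]_n) :
  Q ^t* = Q ->
  (forall v : 'rV[C]_n, 0 <= (v *m Q *m v ^t*) 0 0 <= (v *m v ^t*) 0 0) ->
  exists k : nat, `|\tr Q - k%:R| <= 2 * (\tr Q - \tr (Q *m Q)).
Proof.
move=> Qh Qv.
have Qn : Q \is normalmx by apply/normalmxP; rewrite Qh.
have [P [sp [uP QE]]] : exists (P : 'M[C]_n) (sp : 'rV[C]_n),
    P \is unitarymx /\ Q = invmx P *m diag_mx sp *m P.
  exists (spectralmx Q), (spectral_diag Q); split; first exact: spectral_unitarymx.
  exact/orthomx_spectralP.
have Pu : P \in unitmx by exact: unitarymx_unit.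
have PQ : P *m Q *m P ^t* = diag_mx sp.
  by rewrite QE -invmx_unitary// !mulmxA mulmxV// mul1mx -mulmxA mulmxV// mulmx1.
have dE i : sp 0 i = (row i P *m Q *m (row i P) ^t*) 0 0.
  have := congr1 (fun M : 'M[C]_n => M i i) PQ.
  rewrite !mxE eqxx mulr1n => <-.
  by apply: eq_bigr => j _; rewrite -row_mul !mxE.
have d1 i : (row i P *m (row i P) ^t*) 0 0 = 1.
  have /unitarymxP/(congr1 (fun M : 'M[C]_n => M i i)) := uP.
  rewrite [X in _ = X -> _]mxE eqxx /= mulr1n => <-; rewrite !mxE.
  by apply: eq_bigr => j _; rewrite !mxE.
have dlu i : 0 <= sp 0 i <= 1 by have := Qv (row i P); rewrite -dE d1.
have trE : \tr Q = \sum_i sp 0 i.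
  by rewrite QE mxtrace_mulC mulmxA mulmxV// mul1mx mxtrace_diag.
have trE2 : \tr (Q *m Q) = \sum_i sp 0 i ^+ 2.
  have -> : Q *m Q = invmx P *m (diag_mx sp *m diag_mx sp) *m P.
    transitivity ((invmx P *m diag_mx sp *m P) *m (invmx P *m diag_mx sp *m P)).
      by rewrite -QE.
    by rewrite !mulmxA mulmxK.
  rewrite mxtrace_mulC (mulmxA P (invmx P)) mulmxV// mul1mx mulmx_diag mxtrace_diag.
  by apply: eq_bigr => i _; rewrite mxE expr2.
(* The number of eigenvalues above 1/2. *)
exists (\sum_i (2^-1 < sp 0 i)%R)%N.
rewrite trE trE2 natr_sum -!sumrB mulr_sumr.
apply: le_trans (ler_norm_sum _ _ _) _.
apply: ler_sum => i _.
have /andP[x0 x1] := dlu i; move: (sp 0 i) x0 x1 => x x0 x1.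
have xE : x = (complex.Re x)%:C by rewrite RRe_real// ger0_real.
move: x0 x1; rewrite xE; move: (complex.Re x) => r.
have -> : (2^-1 : C) = (2^-1)%:C by rewrite fmorphV rmorph_nat.
have -> : r%:C - (2^-1%:C < r%:C)%R%:R = (r - (2^-1 < r)%R%:R)%:C.
  by rewrite rmorphB/= ltcR rmorph_nat.
have -> : 2 * (r%:C - r%:C ^+ 2) = (2 * (r - r ^+ 2))%:C.
  by rewrite rmorphM rmorphB rmorphXn rmorph_nat.
rewrite !(lecR (0 : R)) (lecR _ (1 : R)) => r0 r1.
rewrite normc_def/= expr0n addr0 sqrtr_sqr lecR.
by case: ltP => h /=; rewrite ?subr0 ?(ger0_norm r0) ?ler0_norm ?subr_le0//; nra.
Qed.
End near_projection.

Section near_projection_families.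
Context {R : realType} {V : lmodType R[i]} (E : prehilbert V).
Local Notation "<< u , v >>" := (ip E u v) (at level 0).
Local Open Scope sesquilinear_scope.

Lemma sum_enum_val (I : finType) (W : nmodType) (F : I -> W) :
  \sum_(i < #|I|) F (enum_val i) = \sum_i F i.
Proof.
rewrite (reindex (@enum_rank I)) /=; last by exists enum_val => i _; rewrite ?enum_rankK ?enum_valK.
by apply: eq_bigr => i _; rewrite enum_rankK.
Qed.

(** [near_projection_trace] for the matrix of the projection onto the span of f in
    the orthonormal family e.  The defect [tr Q - tr Q^2] is then the total squared
    distance from the vectors [Ee i] to the span of e. *)
Lemma near_integer_overlap (I J : finType) (e : I -> V) (f : J -> V) :
  orthonormal E e -> orthonormal E f ->
  let Ee i := \sum_j <<e i, f j>> *: f j in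
  exists k : nat, `|\sum_i \sum_j nsq <<e i, f j>> - k%:R| <=
    2 * \sum_i (nrm2 E (Ee i) - \sum_i' nsq <<Ee i, e i'>>).
Proof.
move=> oe of_ Ee; have [de ee] := oe; have [df ff] := of_.
have dZ (a : R[i]) j : dom E (a *: f j) by exact: domZ.
have dEe i : dom E (Ee i) by exact: dom_sum.
pose q i i' := <<Ee i, e i'>>.
have qE i i' : q i i' = \sum_j <<e i, f j>> * <<f j, e i'>>.
  by rewrite /q ip_suml//; apply: eq_bigr => j _; rewrite ipZl.
have qC i i' : conjc (q i i') = q i' i.
  rewrite !qE conj_sum; apply: eq_bigr => j _.
  by rewrite conjM !conj_ip// mulrC.
have qii i : q i i = (\sum_j nsq <<e i, f j>>)%:C.
  rewrite qE realC_sum; apply: eq_bigr => j _.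
  by rewrite nsqE conj_ip.
have nEe i : nrm2 E (Ee i) = \sum_j nsq <<e i, f j>>.
  by rewrite (nrm2_comb of_)// index_enum_uniq.
pose Q : 'M[R[i]]_#|I| := \matrix_(i, j) q (enum_val i) (enum_val j).
have trQ : \tr Q = (\sum_i \sum_j nsq <<e i, f j>>)%:C.
  rewrite realC_sum -[RHS]sum_enum_val; apply: eq_bigr => i _.
  by rewrite mxE qii.
have trQQ : \tr (Q *m Q) = (\sum_i \sum_i' nsq <<Ee i, e i'>>)%:C.
  rewrite realC_sum -[RHS]sum_enum_val; apply: eq_bigr => i _.
  rewrite mxE realC_sum -[RHS]sum_enum_val; apply: eq_bigr => j _.
  by rewrite !mxE nsqE -/(q _ _) qC.
have [|v|k hk] := @near_projection_trace R _ Q.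
- by apply/matrixP => i j; rewrite !mxE; exact: qC.
- pose w := \sum_i v 0 (enum_rank i) *: e i.
  have dw : dom E w by apply: dom_sum => i; exact: domZ.
  have wf j : <<w, f j>> = \sum_i v 0 (enum_rank i) * <<e i, f j>>.
    by rewrite ip_suml => [|i|//]; [apply: eq_bigr => i _; rewrite ipZl|exact: domZ].
  have -> : (v *m v ^t*) 0 0 = (nrm2 E w)%:C.
    rewrite (nrm2_comb oe) ?index_enum_uniq// realC_sum.
    rewrite mxE -[RHS]sum_enum_val; apply: eq_bigr => i _.
    by rewrite !mxE enum_valK nsqE.
  have -> : (v *m Q *m v ^t*) 0 0 = (\sum_j nsq <<w, f j>>)%:C.
    rewrite realC_sum mxE.
    under eq_bigr => i _ do rewrite !mxE mulr_suml.
    under [RHS]eq_bigr => j _ do rewrite nsqE wf conj_sum mulr_suml.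
    rewrite exchange_big/= [RHS]exchange_big/= -[RHS]sum_enum_val; apply: eq_bigr => i _.
    under [RHS]eq_bigr => j _ do rewrite mulr_sumr.
    rewrite [RHS]exchange_big/= -[RHS]sum_enum_val; apply: eq_bigr => i' _.
    rewrite !mxE !enum_valK qE mulr_sumr mulr_suml; apply: eq_bigr => j _.
    by rewrite conjM conj_ip//; ring.
  rewrite ler0c lecR sumr_ge0/=; last by move=> j _; exact: nsq_ge0.
  by apply: bessel => //; rewrite index_enum_uniq.
exists k; move: hk; rewrite trQ trQQ -!rmorphB/= -(rmorph_nat (real_complex R)) -rmorphB.
rewrite normc_def/= expr0n addr0 sqrtr_sqr.
rewrite -(rmorph_nat (real_complex R) 2) -rmorphM lecR.
by under [X in _ -> _ <= 2 * X]eq_bigr => i _ do rewrite nEe; rewrite sumrB.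
Qed.

End near_projection_families.

(** * Overlaps of two orthonormal families with a block Toeplitz structure *)

Section sums.
Context {R : realType}.

Lemma ler_sum_sub (I : eqType) (s s' : seq I) (F : I -> R) :
  uniq s -> uniq s' -> {subset s <= s'} -> (forall i, 0 <= F i) ->
  \sum_(i <- s) F i <= \sum_(i <- s') F i.
Proof.
move=> us us' ss' F0; rewrite (bigID (fun i => i \in s) _ _ (r := s'))/=.
rewrite -[X in _ <= X + _]big_filter [X in _ <= X + _](perm_big (s : seq I))/=; last first.
  apply: uniq_perm => //; first by rewrite filter_uniq.
  by move=> i; rewrite mem_filter; apply: andb_idr; exact: ss'.
by rewrite lerDl sumr_ge0.
Qed.

Definition zwin (a : int) (n : nat) : seq int := [seq a + i%:Z | i <- iota 0 n].

Lemma zwin_uniq a n : uniq (zwin a n).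
Proof. by rewrite map_inj_uniq ?iota_uniq// => i j /addrI []. Qed.

Lemma mem_zwin a n t : (t \in zwin a n) = (a <= t < a + n%:Z).
Proof.
apply/mapP/idP => [[j + ->] | /andP[h1 h2]].
  by rewrite mem_iota => /andP[_ h]; lia.
by exists `|t - a|%N; rewrite ?mem_iota; lia.
Qed.

Lemma big_zwin (W : nmodType) a n (F : int -> W) :
  \sum_(t <- zwin a n) F t = \sum_(i < n) F (a + i%:Z).
Proof. by rewrite big_map -{1}(subn0 n) -/(index_iota 0 n) big_mkord. Qed.

Lemma big_iota (W : nmodType) n (F : nat -> W) :
  \sum_(i <- iota 0 n) F i = \sum_(i < n) F i.
Proof. by rewrite -{1}(subn0 n) -/(index_iota 0 n) big_mkord. Qed.

(** Sums over windows reduce to counting positions, here in an interval of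
    indices that may overlap the ends of the range. *)
Lemma card_ord_itv n a b : (b <= n)%N ->
  #|(fun i : 'I_n => a <= i < b)%N| = (b - a)%N.
Proof.
move=> bn; rewrite -[RHS](size_iota a) cardE -(size_map val).
apply/perm_size/uniq_perm; rewrite ?iota_uniq//.
  by rewrite map_inj_uniq ?enum_uniq//; exact: val_inj.
move=> x; rewrite mem_iota; apply/mapP/idP => [[k + ->]|h].
  by rewrite mem_enum unfold_in => /andP[h1 h2]; rewrite h1/= subnKC// (leq_trans h1 (ltnW h2)).
have xb : (x < b)%N by lia.
by exists (Ordinal (leq_trans xb bn)); rewrite // mem_enum unfold_in /=; lia.
Qed.

Definition cwin (N : nat) := zwin (- N%:Z) N.*2.

Lemma cwin_uniq N : uniq (cwin N). Proof. exact: zwin_uniq. Qed.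

Lemma mem_cwin N t : (t \in cwin N) = (- N%:Z <= t < N%:Z).
Proof. by rewrite mem_zwin; congr andb; lia. Qed.

Lemma cwin_sub M N : (M <= N)%N -> (forall t : int, t \in cwin M -> t \in cwin N).
Proof. by move=> MN t; rewrite !mem_cwin; lia. Qed.

Lemma near_int (x : R) :
  (forall e, 0 < e -> exists z : int, `|x - z%:~R| <= e) -> exists z : int, x = z%:~R.
Proof.
move=> h; exists (Num.floor x).
have := floor_itv x; set f := Num.floor x => /andP[fx xf].
apply/eqP/negPn/negP => xne.
have fx' : 0 < x - f%:~R by rewrite subr_gt0 lt_neqAle fx eq_sym xne.
have xf' : 0 < (f + 1)%:~R - x by rewrite subr_gt0.
pose e := Num.min (x - f%:~R) ((f + 1)%:~R - x) / 2.
have e0 : 0 < e by rewrite divr_gt0// lt_min fx' xf'.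
have e1 : 2 * e <= x - f%:~R by rewrite /e mulrC divfK// ge_min lexx.
have e2 : 2 * e <= (f + 1)%:~R - x by rewrite /e mulrC divfK// ge_min lexx orbT.
have [z zx] := h _ e0; move: zx; rewrite ler_distl => /andP[z1 z2].
have [zf|zf] := lerP z f.
  have : z%:~R <= f%:~R :> R by rewrite ler_int.
  by lra.
have : (f + 1)%:~R <= z%:~R :> R by rewrite ler_int; lia.
by lra.
Qed.

End sums.

Section index.
Context {R : realType} {V : lmodType R[i]} (E : prehilbert V) (q : nat).
Local Notation "<< u , v >>" := (ip E u v) (at level 0).
Local Notation dom := (dom E).
Variables (G H : int -> 'I_q -> V).
Hypothesis oG : orthonormal E (fun p : int * 'I_q => G p.1 p.2).
Hypothesis oH : orthonormal E (fun p : int * 'I_q => H p.1 p.2).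
Hypothesis shiftHG : forall s r t r', <<H (s + 1) r, G (t + 1) r'>> = <<H s r, G t r'>>.

Let dG t r : dom (G t r). Proof. exact: (oG.1 (t, r)). Qed.
Let dH t r : dom (H t r). Proof. exact: (oH.1 (t, r)). Qed.

(** By the shift hypothesis the overlaps of H s r and G t r' depend on t - s only;
    these are the q x q blocks of a Toeplitz operator. *)
Definition overlap r r' t := <<H 0 r, G t r'>>.
Local Notation M := overlap.

Lemma overlapE s r t r' : <<H s r, G t r'>> = M r r' (t - s).
Proof.
rewrite /overlap.
have key (k : nat) s1 t1 : <<H (s1 + k%:Z) r, G (t1 + k%:Z) r'>> = <<H s1 r, G t1 r'>>.
  elim: k => [|k <-]; first by rewrite !addr0.
  by rewrite -[RHS]shiftHG -!addrA -PoszD addn1.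
have [s0|s0] := lerP 0 s.
  rewrite -(key `|s|%N 0); congr (<<H _ _, G _ _>>); lia.
rewrite -(key `|s|%N s); congr (<<H _ _, G _ _>>); lia.
Qed.

(** The squared Hilbert-Schmidt norm of the t-th block. *)
Definition mass t : R := \sum_r \sum_r' nsq (M r r' t).
Local Notation mu := mass.

Lemma mass_ge0 t : 0 <= mu t.
Proof. by apply: sumr_ge0 => r _; apply: sumr_ge0 => r' _; exact: nsq_ge0. Qed.

Definition pairs (s : seq int) := [seq (t, r) | t <- s, r <- enum 'I_q].

Lemma pairs_uniq s : uniq s -> uniq (pairs s).
Proof. by move=> us; apply: allpairs_uniq => //; [exact: enum_uniq|move=> [? ?] []]. Qed.

Lemma big_pairs (W : nmodType) s (F : int * 'I_q -> W) :
  \sum_(p <- pairs s) F p = \sum_(t <- s) \sum_r F (t, r).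
Proof. by rewrite big_allpairs; apply: eq_bigr => t _; rewrite big_enum. Qed.

Let nH t r : nrm2 E (H t r) = 1.
Proof. by rewrite /nrm2 (oH.2 (t, r) (t, r)) eqxx. Qed.
Let nG t r : nrm2 E (G t r) = 1.
Proof. by rewrite /nrm2 (oG.2 (t, r) (t, r)) eqxx. Qed.

Lemma bessel_row s r : uniq s -> \sum_(t <- s) \sum_r' nsq (M r r' t) <= 1.
Proof.
move=> us; rewrite -(nH 0 r) -(big_pairs _ (fun p => nsq (M r p.2 p.1))).
exact: (bessel oG (pairs_uniq us) (dH 0 r)).
Qed.

(** Reversing the order of H turns the overlaps with a fixed G into a row, so that
    Bessel also bounds the columns of the Toeplitz operator. *)
Lemma orthonormal_opp : orthonormal E (fun p : int * 'I_q => H (- p.1) p.2).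
Proof.
split=> [p|p p']; first exact: dH.
rewrite (oH.2 (- p.1, p.2) (- p'.1, p'.2)); congr (_%:R); congr nat_of_bool.
by case: p p' => [t r] [t' r']; rewrite !xpair_eqE eqr_opp.
Qed.

Lemma bessel_col s r' : uniq s -> \sum_(t <- s) \sum_r nsq (M r r' t) <= 1.
Proof.
move=> us; rewrite -(nG 0 r').
have := bessel orthonormal_opp (pairs_uniq us) (dG 0 r'); apply: le_trans.
rewrite big_pairs; apply: ler_sum => t _; apply: ler_sum => r _ /=.
by rewrite nsq_ipC// overlapE opprK add0r.
Qed.

Lemma sum_mass s : uniq s -> \sum_(t <- s) mu t <= q%:R.
Proof.
move=> us; rewrite exchange_big/= -[q in leRHS]card_ord -sumr_const.
by apply: ler_sum => r _; exact: bessel_row.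
Qed.

(** The mass outside the window [-N, N).  It is nonnegative by Bessel, and tends to
    0 when the family G is total for H. *)
Definition defect (N : nat) : R := q%:R - \sum_(t <- cwin N) mu t.
Local Notation T0 := defect.

Lemma defect_ge0 N : 0 <= T0 N.
Proof. by rewrite subr_ge0 sum_mass// cwin_uniq. Qed.

Lemma defect_cover N s : uniq s -> (forall t : int, t \in cwin N -> t \in s) ->
  q%:R - \sum_(t <- s) mu t <= T0 N.
Proof.
move=> us sub; rewrite lerD2l lerN2; apply: ler_sum_sub => //; first exact: cwin_uniq.
by move=> t; exact: mass_ge0.
Qed.

Lemma defect_out N s : uniq s -> (forall t : int, t \in s -> t \notin cwin N) ->
  \sum_(t <- s) mu t <= T0 N.
Proof.
move=> us dis; rewrite lerBrDr -big_cat sum_mass// cat_uniq us cwin_uniq andbT/=.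
by apply/hasPn => t; apply: contraL; exact: dis.
Qed.

Lemma mem_subwin (x t : int) n :
  (t \in [seq x - i%:Z | i <- iota 0 n]) = (x - n%:Z < t <= x).
Proof.
apply/mapP/idP => [[j + ->]|/andP[h1 h2]]; first by rewrite mem_iota; lia.
by exists (absz (x - t)); rewrite ?mem_iota; lia.
Qed.

Lemma uniq_sub (t : int) n : uniq [seq t - i%:Z | i <- iota 0 n].
Proof. by rewrite map_inj_uniq ?iota_uniq// => i j; lia. Qed.

(** Compare the blocks -L, ..., L - 1 of G, with L = 4 N, to the blocks 0, ...,
    2 L - 1 of H, and let E be the projection onto the span of the latter.  Up to
    the mass outside [-N, N), E kills the blocks of G with index i < 3 N, fixes
    those with 5 N <= i, and mixes only the 2 N blocks in between.  The compression
    of E to the blocks of G is therefore an almost-projection whose trace is an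
    integer minus [moment N].  The shift by L keeps the indices natural. *)
Section section_estimate.
Variables (N L : nat).
Hypothesis LN : L = (4 * N)%N.
Let I : finType := ('I_(L.*2) * 'I_q)%type.
Let e (i : I) := G (i.1%:Z - L%:Z) i.2.
Let f (j : I) := H j.1%:Z j.2.

Let oe : orthonormal E e.
Proof.
split=> [i|i j]; first exact: dG.
rewrite (oG.2 (_, _) (_, _)); congr (_%:R); congr nat_of_bool.
case: i j => [i r] [j r'].
by rewrite xpair_eqE (inj_eq (addIr (- L%:Z))) xpair_eqE.
Qed.

Let of_ : orthonormal E f.
Proof.
split=> [i|i j]; first exact: dH.
by rewrite (oH.2 (_, _) (_, _)); case: i j => [i r] [j r'].
Qed.

Let fe i j : <<f j, e i>> = M j.2 i.2 (i.1%:Z - L%:Z - j.1%:Z).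
Proof. exact: overlapE. Qed.

Let ef i j : nsq <<e i, f j>> = nsq (M j.2 i.2 (i.1%:Z - L%:Z - j.1%:Z)).
Proof. by rewrite nsq_ipC ?fe//; [exact: dG|exact: dH]. Qed.

Let Ee i := \sum_j <<e i, f j>> *: f j.
Let dis i := nrm2 E (Ee i) - \sum_i' nsq <<Ee i, e i'>>.

Let dEe i : dom (Ee i).
Proof. by apply: dom_sum => j; apply: domZ; exact: dH. Qed.

Let uI : uniq (index_enum I). Proof. exact: index_enum_uniq. Qed.

Let sumf (i : 'I_(L.*2)) :
  \sum_r' \sum_j nsq <<e (i, r'), f j>> =
  \sum_(t <- [seq i%:Z - L%:Z - j%:Z | j <- iota 0 L.*2]) mu t.
Proof.
under eq_bigr => r' _ do under eq_bigr => j _ do rewrite ef/=.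
rewrite exchange_big/= big_map big_iota.
rewrite -(pair_bigA _ (fun (j : 'I_(L.*2)) (r : 'I_q) => \sum_r' nsq (M r r' (i%:Z - L%:Z - j%:Z))))/=.
by [].
Qed.

Let dis_best i c : dis i <= nrm2 E (Ee i - \sum_i' c i' *: e i').
Proof. exact: (best_approx oe c uI). Qed.

(** The choice of the i-th vector itself as approximation of its projection. *)
Let dis_right (i : 'I_(L.*2)) : (5 * N <= i)%N -> \sum_r' dis (i, r') <= T0 N.
Proof.
move=> Ni.
apply: (@le_trans _ _ (\sum_r' (1 - \sum_j nsq <<e (i, r'), f j>>))).
  apply: ler_sum => r' _.
  apply: le_trans (dis_best _ (fun i' => (i' == (i, r'))%:R)) _.
  rewrite (bigD1 (i, r'))//= eqxx scale1r big1 ?addr0; last first.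
    by move=> i' /negbTE ->; rewrite scale0r.
  have de : dom (e (i, r')) by exact: dG.
  rewrite -nrm2N; last by apply: domB => //.
  by rewrite opprB (nrm2_residual of_ uI)//= /e/= nG.
rewrite sumrB sumf sumr_const card_ord.
apply: defect_cover; first exact: uniq_sub.
move=> t; rewrite mem_cwin => h; rewrite mem_subwin.
by have := ltn_ord i; lia.
Qed.

(** The choice of 0 as approximation. *)
Let dis_left (i : 'I_(L.*2)) : (i < 3 * N)%N -> \sum_r' dis (i, r') <= T0 N.
Proof.
move=> Ni.
apply: (@le_trans _ _ (\sum_r' (\sum_j nsq <<e (i, r'), f j>>))).
  apply: ler_sum => r' _; rewrite -(nrm2_comb of_ _ uI) lerBlDr lerDl.
  by apply: sumr_ge0 => ? _; exact: nsq_ge0.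
rewrite sumf; apply: defect_out; first exact: uniq_sub.
by move=> t; rewrite mem_subwin mem_cwin; lia.
Qed.

Let nearR (j : I) := (j.1 < 2 * N)%N.

Let res j := f j - \sum_i' <<f j, e i'>> *: e i'.

Let dres j : dom (res j).
Proof. by apply: domB; [exact: dH|apply: dom_sum => i; apply: domZ; exact: dG]. Qed.

Let sum_res : \sum_(j | nearR j) nrm2 E (res j) <= (2 * N)%:R * T0 N.
Proof.
have -> : \sum_(j | nearR j) nrm2 E (res j) =
    \sum_(j < L.*2 | (j < 2 * N)%N) \sum_r nrm2 E (res (j, r)).
  rewrite pair_big; apply: eq_big => [j|[]//]; by rewrite andbT.
apply: (@le_trans _ _ (\sum_(j < L.*2 | (j < 2 * N)%N) T0 N)); last first.
  rewrite sumr_const mulr_natl (@card_ord_itv _ 0) ?subn0//; lia.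
apply: ler_sum => j Nj.
have -> : \sum_r nrm2 E (res (j, r)) =
    q%:R - \sum_(t <- [seq (- L%:Z - j%:Z) + i%:Z | i <- iota 0 L.*2]) mu t.
  rewrite big_map big_iota.
  rewrite -[q in q%:R]card_ord -sumr_const exchange_big -sumrB/=.
  apply: eq_bigr => r _; rewrite (nrm2_residual oe uI (dH _ _)) nH; congr (_ - _).
  rewrite -(pair_bigA _ (fun i r' => nsq <<f (j, r), e (i, r')>>))/=.
  by apply: eq_bigr => i _; apply: eq_bigr => r' _; rewrite fe/=; congr (nsq (M _ _ _)); ring.
apply: defect_cover; first exact: zwin_uniq.
by move=> t; rewrite mem_cwin -/(zwin _ _) mem_zwin; lia.
Qed.

(** The part of E (e i) along the first 2 N blocks of H is approximated through
    the residuals of these blocks, which lie well inside the window of G; the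
    other blocks of H are far from i and contribute only tail mass. *)
Let dis_mid (i : 'I_(L.*2)) : (3 * N <= i < 5 * N)%N ->
  \sum_r' dis (i, r') <= q%:R * (4 * N)%:R * T0 N + 2 * T0 N.
Proof.
move=> Ni.
apply: (@le_trans _ _ (\sum_(r' < q) (2 * ((2 * N)%:R * T0 N) +
     2 * \sum_(j | ~~ nearR j) nsq <<e (i, r'), f j>>))).
  apply: ler_sum => r' _.
  pose u1 := \sum_(j | nearR j) <<e (i, r'), f j>> *: f j.
  pose u2 := \sum_(j | ~~ nearR j) <<e (i, r'), f j>> *: f j.
  have Eeu : Ee (i, r') = u1 + u2 by rewrite /Ee (bigID nearR).
  (* The coefficients of the projection of u1 onto the span of e. *)
  pose c i' := \sum_(j | nearR j) <<e (i, r'), f j>> * <<f j, e i'>>.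
  have dZf a j : dom (a *: f j) by apply: domZ; exact: dH.
  have dZr a j : dom (a *: res j) by apply: domZ.
  have u1c : u1 - \sum_i' c i' *: e i' = \sum_(j | nearR j) <<e (i, r'), f j>> *: res j.
    rewrite /u1 /c; under [X in _ - X]eq_bigr => i' _ do rewrite scaler_suml.
    rewrite exchange_big -sumrB; apply: eq_bigr => j _ /=.
    rewrite /res scalerBr; congr (_ - _).
    by rewrite scaler_sumr; apply: eq_bigr => i' _; rewrite scalerA.
  apply: le_trans (dis_best _ c) _.
  have du1c : dom (u1 - \sum_i' c i' *: e i') by rewrite u1c; exact: dom_sum.
  have du2 : dom u2 by exact: dom_sum.
  rewrite Eeu addrAC; apply: le_trans (nrm2D du1c du2) _.
  rewrite lerD// ler_wpM2l//.
    rewrite u1c -big_filter; apply: le_trans (nrm2_lincomb _ _ dres) _.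
    rewrite !big_filter -[leRHS]mul1r; apply: ler_pM => //.
    - by apply: sumr_ge0 => j _; exact: nsq_ge0.
    - by apply: sumr_ge0 => j _; exact: nrm2_ge0.
    - rewrite -big_filter -(nG (i%:Z - L%:Z) r').
      by apply: (bessel of_ _ (dG _ _)); rewrite filter_uniq.
  rewrite /u2 -big_filter -[X in _ <= X]big_filter.
  by rewrite (nrm2_comb of_) ?filter_uniq.
rewrite big_split/= sumr_const card_ord -[_ *+ q]mulr_natl.
have -> : (q%:R * (2 * ((2 * N)%:R * T0 N)) : R) = q%:R * (4 * N)%:R * T0 N.
  by rewrite !natrM; ring.
rewrite lerD2l -mulr_sumr ler_wpM2l//.
have -> : \sum_r' \sum_(j | ~~ nearR j) nsq <<e (i, r'), f j>> =
  \sum_(t <- [seq i%:Z - L%:Z - j%:Z | j <- [seq j <- iota 0 L.*2 | ~~ (j < 2 * N)%N]]) mu t.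
  under eq_bigr => r' _ do under eq_bigr => j _ do rewrite ef/=.
  rewrite exchange_big/= big_map big_filter [in RHS]big_mkcond big_iota -big_mkcond/=.
  rewrite [RHS](pair_big _ xpredT (fun (j : 'I_(L.*2)) (r : 'I_q) => \sum_r' nsq (M r r' (i%:Z - L%:Z - j%:Z))))/=.
  by apply: eq_bigl => j; rewrite andbT.
apply: defect_out.
  by rewrite map_inj_uniq ?filter_uniq ?iota_uniq// => x y; lia.
by move=> t /mapP[j + ->]; rewrite mem_filter => /andP[jN _]; rewrite mem_cwin; lia.
Qed.

Let sum_dis : \sum_i dis i <= (8 * N)%:R * T0 N + (2 * N)%:R * (q%:R * (4 * N)%:R * T0 N + 2 * T0 N).
Proof.
set B := q%:R * _ * _ + _.
have B0 : 0 <= B by rewrite addr_ge0 ?mulr_ge0 ?ler0n ?defect_ge0.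
rewrite -(pair_bigA _ (fun i r => dis (i, r)))/=.
apply: (@le_trans _ _ (\sum_(i < L.*2) (T0 N + if (3 * N <= i < 5 * N)%N then B else 0))).
  apply: ler_sum => i _; case: ifPn => [h|].
    by apply: (le_trans (dis_mid h)); rewrite lerDr defect_ge0.
  by rewrite addr0 negb_and -!ltnNge => /orP[|]; [exact: dis_left|rewrite ltnS; exact: dis_right].
rewrite big_split/= sumr_const card_ord !mulr_natl lerD//.
  by rewrite ler_wpMn2l ?defect_ge0//; lia.
rewrite -big_mkcond/= sumr_const ler_wpMn2l//.
by rewrite card_ord_itv; lia.
Qed.

(** The quantity whose limit is the trace of the commutator with the position. *)
Definition moment N : R := \sum_(t <- cwin N) t%:~R * mu t.

(** The i-th row of the compression has total mass close to the cumulative mass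
    [g i] of the overlaps of index at most i - 4 N, which is 0 on the left and q on
    the right.
    Summing by parts turns the cumulative masses into the first moment. *)
Let trace_approx :
  `|\sum_i \sum_j nsq <<e i, f j>> - ((4 * N * q)%:R - moment N)| <= (9 * N)%:R * T0 N.
Proof.
pose F (i : nat) : R := \sum_(t <- [seq i%:Z - L%:Z - j%:Z | j <- iota 0 L.*2]) mu t.
(* The expected mass of row i: the blocks of M with index at most i - 4 N, inside [-N, N). *)
pose g (i : nat) : R := if (i < 3 * N)%N then 0 else
  if (i < 5 * N)%N then \sum_(l < (i - 3 * N).+1) mu (l%:Z - N%:Z) else q%:R.
have Fg (i : nat) : (i < 8 * N)%N -> `|F i - g i| <= T0 N.
  move=> iN; rewrite /g; case: ifPn => [h|].
    rewrite subr0 ger0_norm; last by apply: sumr_ge0 => *; exact: mass_ge0.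
    apply: defect_out; first exact: uniq_sub.
    by move=> t; rewrite mem_subwin mem_cwin; lia.
  rewrite -leqNgt => h1; case: ifPn => [h2|].
    have -> : \sum_(l < (i - 3 * N).+1) mu (l%:Z - N%:Z) = \sum_(t <- zwin (- N%:Z) (i - 3 * N).+1) mu t.
      by rewrite big_zwin; apply: eq_bigr => l _; rewrite addrC.
    rewrite ger0_norm; last first.
      rewrite subr_ge0; apply: ler_sum_sub; [exact: zwin_uniq|exact: uniq_sub| |by move=> *; exact: mass_ge0].
      move=> t; rewrite mem_zwin => ht.
      by rewrite mem_subwin; lia.
    rewrite /F (bigID (fun t => t \in zwin (- N%:Z) (i - 3 * N).+1))/= -[X in X + _ - _]big_filter -[X in _ + X - _]big_filter.
    rewrite [X in X + _ - _](perm_big (zwin (- N%:Z) (i - 3 * N).+1))/=; last first.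
      apply: uniq_perm; [by rewrite filter_uniq// uniq_sub|exact: zwin_uniq|].
      move=> t; rewrite mem_filter andb_idr// mem_zwin => ht.
      by rewrite mem_subwin; lia.
    rewrite addrAC subrr add0r; apply: defect_out; first by rewrite filter_uniq// uniq_sub.
    move=> t; rewrite mem_filter mem_zwin mem_cwin mem_subwin; lia.
  rewrite -leqNgt => h2; rewrite ler0_norm; last by rewrite subr_le0 sum_mass// uniq_sub.
  rewrite opprB; apply: defect_cover; first exact: uniq_sub.
  move=> t; rewrite mem_cwin => h.
  by rewrite mem_subwin; lia.
have -> : \sum_i \sum_j nsq <<e i, f j>> = \sum_(i < 8 * N) F i.
  rewrite -(pair_bigA _ (fun i r => \sum_j nsq <<e (i, r), f j>>))/=.
  have -> : (8 * N = L.*2)%N by lia.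
  by apply: eq_bigr => i _; rewrite sumf.
have gE : \sum_(i < 8 * N) g i = (4 * N * q)%:R - moment N - N%:R * T0 N.
  have -> : \sum_(i < 8 * N) g i = \sum_(0 <= i < 8 * N) g i by rewrite big_mkord.
  rewrite (@big_cat_nat _ _ _ (3 * N))/=; [|lia|lia].
  rewrite [X in _ + X](@big_cat_nat _ _ _ (5 * N))/=; [|lia|lia].
  rewrite big_nat big1 ?add0r; last by move=> i /andP[_ h]; rewrite /g h.
  have -> : \sum_(5 * N <= i < 8 * N) g i = (3 * N * q)%:R.
    rewrite big_nat (eq_bigr (fun=> q%:R)); last first.
      by move=> i /andP[h _]; rewrite /g !ltnNge (leq_trans _ h) ?h//=; lia.
    by rewrite -big_nat sumr_const_nat -mulrnA; congr (_ *+ _); nia.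
  have -> : \sum_(3 * N <= i < 5 * N) g i =
      \sum_(i < 2 * N) \sum_(l < 2 * N | (l <= i)%N) mu (l%:Z - N%:Z).
    rewrite -{1}[(3 * N)%N]add0n big_addn (_ : (5 * N - 3 * N = 2 * N)%N); last lia.
    rewrite big_mkord; apply: eq_bigr => i _; rewrite /g.
    have := ltn_ord i => iN.
    rewrite ifF; last lia.
    rewrite ifT; last lia.
    rewrite addnK (big_ord_widen_cond (2 * N) xpredT (fun l => mu (l%:Z - N%:Z)))//.
  rewrite (exchange_big_dep xpredT)//=.
  have -> : \sum_(l < 2 * N) \sum_(i < 2 * N | (l <= i)%N) mu (l%:Z - N%:Z) =
      \sum_(l < 2 * N) (2 * N - l)%:R * mu (l%:Z - N%:Z).
    apply: eq_bigr => l _; rewrite sumr_const -[_ *+ _]mulr_natl; congr (_%:R * _).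
    rewrite -(@card_ord_itv (2 * N) l (2 * N))//; apply: eq_card => k.
    by rewrite !unfold_in ltn_ord andbT.
  rewrite /moment /defect /cwin !big_zwin -!mul2n.
  have -> : \sum_(l < 2 * N) (2 * N - l)%:R * mu (l%:Z - N%:Z) =
     N%:R * (\sum_(i < 2 * N) mu (- N%:Z + i%:Z)) - \sum_(i < 2 * N) (- N%:Z + i%:Z)%:~R * mu (- N%:Z + i%:Z).
    rewrite mulr_sumr -sumrB; apply: eq_bigr => l _; rewrite (addrC (- N%:Z)) -mulrBl.
    congr (_ * _); rewrite natrB; last by have := ltn_ord l; lia.
    by rewrite natrM rmorphB/= -!pmulrn; ring.
  by rewrite !natrM; ring.
have -> : (9 * N)%:R * T0 N = (8 * N)%:R * T0 N + N%:R * T0 N by rewrite !natrM; ring.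
have -> : \sum_(i < 8 * N) F i - ((4 * N * q)%:R - moment N) =
   (\sum_(i < 8 * N) F i - \sum_(i < 8 * N) g i) - N%:R * T0 N by rewrite gE; ring.
apply: le_trans (ler_normB _ _) _; apply: lerD; last first.
  by rewrite ger0_norm// mulr_ge0// ?ler0n ?defect_ge0.
rewrite -sumrB; apply: le_trans (ler_norm_sum _ _ _) _.
apply: (@le_trans _ _ (\sum_(i < 8 * N) T0 N)); first by apply: ler_sum => i _; exact: Fg.
by rewrite sumr_const card_ord mulr_natl.
Qed.

(** The factor N^2 in the error comes from the 2 N middle rows, each of which loses
    O(N) times the tail mass. *)
Lemma moment_near_int : exists z : int,
  `|moment N - z%:~R| <= (16 * q + 33)%:R * (N%:R ^+ 2 * T0 N).
Proof.
have [k hk] := near_integer_overlap oe of_.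
exists ((4 * N * q)%:Z - k%:Z).
have T := trace_approx; have D := sum_dis.
move: hk; rewrite -/Ee; set S := \sum_i \sum_j _ => hk; rewrite -/S in T.
have -> : moment N - (((4 * N * q)%:Z - k%:Z)%:~R) =
   (S - ((4 * N * q)%:R - moment N)) - (S - k%:R).
  by rewrite rmorphB/= -!pmulrn; ring.
apply: le_trans (ler_normB _ _) _.
apply: le_trans (lerD T hk) _.
have hk2 : \sum_i (nrm2 E (Ee i) - \sum_i' nsq <<Ee i, e i'>>) <= _ := D.
apply: (@le_trans _ _ ((9 * N)%:R * T0 N + 2 * ((8 * N)%:R * T0 N + (2 * N)%:R * (q%:R * (4 * N)%:R * T0 N + 2 * T0 N)))).
  by rewrite lerD2l ler_wpM2l.
have t0 := defect_ge0 N.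
have n2 : N%:R <= N%:R ^+ 2 :> R by rewrite -natrX ler_nat; case: (N) => // m; rewrite expnS expn1; lia.
rewrite (natrM _ 9 N) (natrM _ 8 N) (natrM _ 2 N) (natrM _ 4 N) (natrD _ (16 * q) 33) (natrM _ 16 q).
have -> : 9 * N%:R * T0 N + 2 * (8 * N%:R * T0 N + 2 * N%:R * (q%:R * (4 * N%:R) * T0 N + 2 * T0 N)) =
   16 * q%:R * (N%:R ^+ 2 * T0 N) + 33 * (N%:R * T0 N) by ring.
by rewrite [leRHS]mulrDl lerD2l ler_wpM2l// ler_wpM2r.
Qed.

End section_estimate.

Hypothesis completeHG : forall r (eps : R), 0 < eps ->
  exists N, 1 - eps <= \sum_(t <- cwin N) \sum_r' nsq (M r r' t).

Lemma defect_sum_row N : T0 N = \sum_r (1 - \sum_(t <- cwin N) \sum_r' nsq (M r r' t)).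
Proof. by rewrite sumrB sumr_const card_ord exchange_big. Qed.

Lemma defect_sum_col N : T0 N = \sum_r' (1 - \sum_(t <- cwin N) \sum_r nsq (M r r' t)).
Proof.
rewrite sumrB sumr_const card_ord exchange_big; congr (_ - _).
by apply: eq_bigr => t _; exact: exchange_big.
Qed.

Lemma defect_row N r : 1 - \sum_(t <- cwin N) \sum_r' nsq (M r r' t) <= T0 N.
Proof.
rewrite defect_sum_row (bigD1 r)//= lerDl; apply: sumr_ge0 => i _.
by rewrite subr_ge0 bessel_row// cwin_uniq.
Qed.

Lemma defect_col N r' : 1 - \sum_(t <- cwin N) \sum_r nsq (M r r' t) <= T0 N.
Proof.
rewrite defect_sum_col (bigD1 r')//= lerDl; apply: sumr_ge0 => i _.
by rewrite subr_ge0 bessel_col// cwin_uniq.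
Qed.

Lemma defect_to0 (eps : R) : 0 < eps -> exists N0, forall N, (N0 <= N)%N -> T0 N <= eps.
Proof.
move=> e0; have e1 : 0 < eps / q.+1%:R by rewrite divr_gt0.
have /fin_all_exists[f hf] := fun r => completeHG r e1.
exists (\max_r f r)%N => N fN; rewrite defect_sum_row.
apply: (@le_trans _ _ (\sum_(r < q) eps / q.+1%:R)).
  apply: ler_sum => r _; rewrite lerBlDl addrC -lerBlDl; apply: le_trans (hf r) _.
  apply: ler_sum_sub; [exact: cwin_uniq|exact: cwin_uniq| |].
    by move=> t; apply: cwin_sub; apply: leq_trans fN; exact: leq_bigmax.
  by move=> t; apply: sumr_ge0 => *; exact: nsq_ge0.
rewrite sumr_const card_ord -[_ *+ q]mulr_natr mulrAC ler_pdivrMr//.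
by apply: ler_wpM2l; [exact: ltW|rewrite ler_nat].
Qed.

Variables (A B : 'I_q -> V) (c : R).
Hypotheses (dA : forall r, dom (A r)) (dB : forall r, dom (B r)) (c0 : c != 0).
Hypothesis position : forall t r r',
  <<A r, G t r'>> - <<H (- t) r, B r'>> = (c * t%:~R)%:C * M r r' t.

Definition moment2 N : R := \sum_(t <- cwin N) t%:~R ^+ 2 * mu t.

(** The hypothesis [position] says that t M(t) is, up to the factor c, a difference
    of overlaps with the fixed vectors A and B, hence square-summable by Bessel. *)
Lemma moment2_bounded : exists K, forall N, moment2 N <= K.
Proof.
have c2 : 0 < c ^+ 2 by rewrite lt_neqAle sqr_ge0 andbT eq_sym sqrf_eq0.
exists ((2 * \sum_r nrm2 E (A r) + 2 * \sum_r nrm2 E (B r)) / c ^+ 2) => N.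
rewrite ler_pdivlMr// mulrC /moment2 mulr_sumr.
have mE t : c ^+ 2 * (t%:~R ^+ 2 * mu t) =
    \sum_r \sum_r' nsq ((c * t%:~R)%:C * M r r' t).
  rewrite mulrA -exprMn /mass mulr_sumr; apply: eq_bigr => r _.
  by rewrite mulr_sumr; apply: eq_bigr => r' _; rewrite nsqM nsqR.
under eq_bigr => t _ do rewrite mE.
apply: (@le_trans _ _ (\sum_(t <- cwin N) \sum_r \sum_r'
   (2 * nsq <<A r, G t r'>> + 2 * nsq <<H (- t) r, B r'>>))).
  apply: ler_sum => t _; apply: ler_sum => r _; apply: ler_sum => r' _.
  by rewrite -position nsqB.
under eq_bigr => t _ do under eq_bigr => r _ do rewrite big_split/= -!mulr_sumr.
under eq_bigr => t _ do rewrite big_split/= -!mulr_sumr.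
rewrite big_split/= -!mulr_sumr lerD// ler_wpM2l//.
  rewrite exchange_big/=; apply: ler_sum => r _.
  rewrite -(big_pairs _ (fun p => nsq <<A r, G p.1 p.2>>)).
  exact: (bessel oG (pairs_uniq (cwin_uniq N)) (dA r)).
rewrite (eq_bigr (fun t => \sum_r' \sum_r nsq <<H (- t) r, B r'>>)); last first.
  by move=> t _; exact: exchange_big.
rewrite exchange_big/=; apply: ler_sum => r' _.
have := bessel orthonormal_opp (pairs_uniq (cwin_uniq N)) (dB r'); apply: le_trans.
rewrite big_pairs; apply: ler_sum => t _; apply: ler_sum => r _ /=.
by rewrite nsq_ipC.
Qed.

Lemma moment2_tail N N' : (N <= N')%N ->
  N%:R ^+ 2 * (T0 N - T0 N') <= moment2 N' - moment2 N.
Proof.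
move=> NN.
have -> : T0 N - T0 N' = \sum_(t <- cwin N') mu t - \sum_(t <- cwin N) mu t.
  by rewrite /defect; ring.
have split_ (F : int -> R) : \sum_(t <- cwin N') F t =
    \sum_(t <- cwin N) F t + \sum_(t <- cwin N' | t \notin cwin N) F t.
  rewrite (bigID (fun t => t \in cwin N))/= -[X in X + _ = _]big_filter.
  congr (_ + _); apply: perm_big; apply: uniq_perm; rewrite ?filter_uniq ?cwin_uniq//.
  by move=> t; rewrite mem_filter; apply: andb_idr; exact: cwin_sub.
rewrite /moment2 !split_.
have : \sum_(t <- cwin N' | t \notin cwin N) N%:R ^+ 2 * mu t <=
       \sum_(t <- cwin N' | t \notin cwin N) t%:~R ^+ 2 * mu t.
  apply: ler_sum => t; rewrite mem_cwin => tN; rewrite ler_wpM2r ?mass_ge0//.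
  have : (N%:Z ^+ 2 <= t ^+ 2) by rewrite !expr2; nia.
  by rewrite -(ler_int R) !rmorphXn/= -pmulrn.
by rewrite -mulr_sumr; lra.
Qed.

(** A bounded second moment makes N^2 times the tail mass tend to 0: the partial
    second moments are nondecreasing, and past an index that nearly attains their
    supremum the remaining tail is small. *)
Lemma sqr_defect_to0 (eps : R) : 0 < eps ->
  exists N0, forall N, (N0 <= N)%N -> N%:R ^+ 2 * T0 N <= eps.
Proof.
move=> e0; have [K hK] := moment2_bounded.
(* Past N0 the second moment grows by at most eps / 2, and N' is so large that its own defect is negligible. *)
pose S := [set x | exists N, x = moment2 N].
have hS : has_sup S.
  by split; [exists (moment2 0), 0%N|exists K => _ [N ->]].
have e2 : 0 < eps / 2 by rewrite divr_gt0.
have [_ [N0 ->] hN0] := sup_adherent e2 hS.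
exists N0 => N N0N.
have n0 : 0 < eps / 2 / (N%:R ^+ 2 + 1) by rewrite divr_gt0// ltr_wpDl// sqr_ge0.
have [N1 hN1] := defect_to0 n0.
pose N' := maxn N N1.
have h1 : T0 N' <= eps / 2 / (N%:R ^+ 2 + 1) by apply: hN1; rewrite leq_maxr.
have h2 := moment2_tail (leq_maxl N N1); rewrite -/N' in h2.
have h3 : moment2 N' <= sup S by apply: ub_le_sup; [case: hS|exists N'].
have h4 : moment2 N0 <= moment2 N.
  apply: ler_sum_sub; [exact: cwin_uniq|exact: cwin_uniq|by move=> t; exact: cwin_sub|].
  by move=> t; rewrite mulr_ge0 ?sqr_ge0 ?mass_ge0.
have h5 : N%:R ^+ 2 * T0 N' <= eps / 2.
  apply: (@le_trans _ _ ((N%:R ^+ 2 + 1) * T0 N')).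
    by rewrite ler_wpM2r ?defect_ge0// lerDl.
  by rewrite mulrC -ler_pdivlMr// ltr_wpDl// sqr_ge0.
move: h2; rewrite mulrBr; lra.
Qed.

Lemma nsq_sum_le (I : Type) (s : seq I) (F : I -> R[i]) :
  nsq (\sum_(i <- s) F i) <= 2 ^+ size s * \sum_(i <- s) nsq (F i).
Proof.
elim: s => [|i s IH]; first by rewrite !big_nil mulr0 /nsq/= !expr0n/= addr0.
rewrite !big_cons/= exprS; apply: le_trans (nsqD _ _) _.
have p1 : 1 <= 2 ^+ size s :> R by rewrite exprn_ege1// ler1n.
by have := ler_peMl (nsq_ge0 (F i)) p1; lra.
Qed.

(** Expanding [<<A r, H 0 r>>] along G and [<<G 0 r, B r>>] along H with Parseval, the
    products combine through [position] into c t |M(t)|^2. *)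
Lemma position_trace_defect N :
  nsq (\sum_r (<<A r, H 0 r>> - <<G 0 r, B r>>) - (c * moment N)%:C) <=
  2 ^+ q * (\sum_r (2 * nrm2 E (A r) + 2 * nrm2 E (B r))) * T0 N.
Proof.
pose Z1 r := \sum_(p <- pairs (cwin N)) <<A r, G p.1 p.2>> * <<G p.1 p.2, H 0 r>>.
pose Z2 r := \sum_(p <- pairs (cwin N)) <<B r, H (- p.1) p.2>> * <<H (- p.1) p.2, G 0 r>>.
have h1 r : nsq (<<A r, H 0 r>> - Z1 r) <= nrm2 E (A r) * T0 N.
  apply: le_trans (parseval_defect oG (pairs_uniq (cwin_uniq N)) (dA r) (dH 0 r)) _.
  rewrite ler_wpM2l ?nrm2_ge0// nH big_pairs; exact: defect_row.
have h2 r : nsq (<<B r, G 0 r>> - Z2 r) <= nrm2 E (B r) * T0 N.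
  apply: le_trans (parseval_defect orthonormal_opp (pairs_uniq (cwin_uniq N)) (dB r) (dG 0 r)) _.
  rewrite ler_wpM2l ?nrm2_ge0// nG big_pairs; apply: le_trans (defect_col N r).
  rewrite lerD2l lerN2; apply: ler_sum => t _; apply: ler_sum => r1 _ /=.
  by rewrite (nsq_ipC (dG _ _) (dH _ _)) overlapE opprK add0r.
have -> : (c * moment N)%:C = \sum_r (Z1 r - conjc (Z2 r)).
  have -> : \sum_r (Z1 r - conjc (Z2 r)) = \sum_(t <- cwin N) \sum_r \sum_r'
     (<<A r, G t r'>> - <<H (- t) r, B r'>>) * conjc (M r r' t).
    rewrite sumrB.
    under eq_bigr => r _ do rewrite /Z1 big_pairs.
    under [X in _ - X]eq_bigr => r _ do rewrite /Z2 conj_sum big_pairs.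
    rewrite exchange_big [X in _ - X]exchange_big/= -sumrB; apply: eq_bigr => t _.
    rewrite [X in _ - X]exchange_big/= -sumrB; apply: eq_bigr => r _.
    rewrite -sumrB; apply: eq_bigr => r' _ /=.
    rewrite mulrBl; congr (_ - _); first by rewrite /overlap conj_ip.
    by rewrite conjM conj_ip// overlapE opprK add0r.
  rewrite /moment mulr_sumr realC_sum; apply: eq_bigr => t _.
  rewrite mulrA mulr_sumr realC_sum; apply: eq_bigr => r _.
  rewrite mulr_sumr realC_sum; apply: eq_bigr => r' _.
  by rewrite position -[RHS]mulrA rmorphM; congr (_ * _); exact: nsqE.
rewrite -sumrB; apply: le_trans (nsq_sum_le _ _) _.
have -> : size (index_enum 'I_q) = q by rewrite -[RHS]card_ord -sum1_card sum1_size.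
rewrite -mulrA ler_wpM2l ?exprn_ge0// mulr_suml; apply: ler_sum => r _.
have -> : <<A r, H 0 r>> - <<G 0 r, B r>> - (Z1 r - conjc (Z2 r)) =
  (<<A r, H 0 r>> - Z1 r) - conjc (<<B r, G 0 r>> - Z2 r).
  by rewrite conjD conjN conj_ip//; ring.
apply: le_trans (nsqB _ _) _; rewrite nsqJ.
by have := h1 r; have := h2 r; lra.
Qed.

(** The left-hand side is c times the limit of [moment N], and the distance from
    [moment N] to the integers tends to 0. *)
Theorem position_trace_integrality : exists z : int,
  \sum_r (<<A r, H 0 r>> - <<G 0 r, B r>>) = (c * z%:~R)%:C.
Proof.
set Z := \sum_r _; pose K := 2 ^+ q * \sum_r (2 * nrm2 E (A r) + 2 * nrm2 E (B r)).
have K0 : 0 <= K.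
  rewrite mulr_ge0// ?exprn_ge0//; apply: sumr_ge0 => r _.
  by rewrite addr_ge0// mulr_ge0// nrm2_ge0.
have hZ N : nsq (Z - (c * moment N)%:C) <= K * T0 N.
  exact: position_trace_defect.
have KT eps : 0 < eps -> exists N0, forall N, (N0 <= N)%N -> K * T0 N <= eps.
  move=> e0; have e1 : 0 < eps / (K + 1) by rewrite divr_gt0// ltr_wpDl.
  have [N0 hN0] := defect_to0 e1; exists N0 => N /hN0 h.
  apply: (@le_trans _ _ ((K + 1) * T0 N)); first by rewrite ler_wpM2r ?defect_ge0// lerDl.
  by rewrite mulrC -ler_pdivlMr// ltr_wpDl.
have ImZ : complex.Im Z = 0.
  apply/eqP; rewrite -sqrf_eq0 eq_le sqr_ge0 andbT leNgt; apply/negP => h.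
  have h2 : 0 < complex.Im Z ^+ 2 / 2 by rewrite divr_gt0.
  have [N0 /(_ N0 (leqnn _)) hN0] := KT _ h2.
  have := le_trans (cIm_norm _) (le_trans (hZ N0) hN0).
  by rewrite cImD cImN/= subr0; lra.
suff [z hz] : exists z : int, complex.Re Z / c = z%:~R.
  exists z; rewrite -hz mulrCA mulfV// mulr1; move: ImZ; case: (Z) => x y /= ->.
  by [].
apply: near_int => e e0.
have e2 : 0 < (c * (e / 2)) ^+ 2 by rewrite exprn_even_gt0//= mulf_neq0// gt_eqF// divr_gt0.
have [N0 hN0] := KT _ e2.
have e3 : 0 < e / 2 / (16 * q + 33)%:R by rewrite !divr_gt0// ltr0n; lia.
have [N1 hN1] := sqr_defect_to0 e3.
pose N := maxn N0 N1.
have [z hz] := moment_near_int (erefl (4 * N)%N).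
exists z.
have h1 : `|complex.Re Z / c - moment N| <= e / 2.
  have := le_trans (cRe_norm _) (le_trans (hZ N) (hN0 N (leq_maxl _ _))).
  rewrite cReD cReN/= -(ler_sqrt _ (sqr_ge0 _)) ?sqr_ge0// !sqrtr_sqr normrM.
  rewrite (ger0_norm (ltW _ : 0 <= e / 2)) ?divr_gt0// => h.
  have -> : complex.Re Z / c - moment N = (complex.Re Z - c * moment N) / c.
    by rewrite mulrBl mulrAC mulfV// mul1r.
  by rewrite normrM normfV ler_pdivrMr ?normr_gt0// [_ / 2 * _]mulrC.
have h2 : `|moment N - z%:~R| <= e / 2.
  apply: le_trans hz _; rewrite mulrC -ler_pdivlMr ?ltr0n; last lia.
  by apply: hN1; rewrite leq_maxr.
have -> : complex.Re Z / c - z%:~R = (complex.Re Z / c - moment N) + (moment N - z%:~R) by ring.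
by apply: le_trans (ler_normD _ _) _; lra.
Qed.

End index.

(** * Square-integrable complex functions on a measure space *)

Section cint.
Context d (T : measurableType d) (R : realType) (mu : {measure set T -> \bar R}).
Implicit Types (f g h : T -> R[i]) (a : R[i]).

Definition cmeas f := measurable_fun setT (fun x => complex.Re (f x)) /\
                      measurable_fun setT (fun x => complex.Im (f x)).

Lemma cmeasD f g : cmeas f -> cmeas g -> cmeas (fun x => f x + g x).
Proof.
move=> [f1 f2] [g1 g2]; split.
  by under eq_fun do rewrite cReD; exact: measurable_funD.
by under eq_fun do rewrite cImD; exact: measurable_funD.
Qed.

Lemma cmeasM f g : cmeas f -> cmeas g -> cmeas (fun x => f x * g x).
Proof.
move=> [f1 f2] [g1 g2]; split.
  by under eq_fun do rewrite cReM; apply: measurable_funB; exact: measurable_funM.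
by under eq_fun do rewrite cImM; apply: measurable_funD; exact: measurable_funM.
Qed.

Lemma cmeas_cst a : cmeas (fun=> a).
Proof. by split; exact: measurable_cst. Qed.

Lemma cmeasJ f : cmeas f -> cmeas (fun x => conjc (f x)).
Proof.
move=> [f1 f2]; split; first by under eq_fun do rewrite cReJ.
by under eq_fun do rewrite cImJ; exact: measurable_funN.
Qed.

Lemma cmeasN f : cmeas f -> cmeas (fun x => - f x).
Proof.
move=> mf; under eq_fun do rewrite -mulN1r.
by apply: cmeasM => //; exact: cmeas_cst.
Qed.

Lemma cmeasB f g : cmeas f -> cmeas g -> cmeas (fun x => f x - g x).
Proof. by move=> mf mg; apply: cmeasD => //; exact: cmeasN. Qed.

Lemma cmeasR (u : T -> R) : measurable_fun setT u -> cmeas (fun x => (u x)%:C).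
Proof. by move=> mu_; split => //; exact: measurable_cst. Qed.

Lemma measurable_nsq f : cmeas f -> measurable_fun setT (fun x => nsq (f x)).
Proof.
by move=> [f1 f2]; rewrite /nsq; apply: measurable_funD; exact: measurable_funX.
Qed.

Definition cintegrable f := mu.-integrable setT (fun x => (complex.Re (f x))%:E) /\
                            mu.-integrable setT (fun x => (complex.Im (f x))%:E).

(** The integral of a complex function on any measure space, taken coordinatewise.
    It serves for the line and for the cosets of a lattice alike. *)
Definition cint f : R[i] :=
  (\int[mu]_x complex.Re (f x)) +i* (\int[mu]_x complex.Im (f x)).

Lemma cintegrable_meas f : cintegrable f -> cmeas f.
Proof.
by move=> [/measurable_int/measurable_EFinP ? /measurable_int/measurable_EFinP].
Qed.

Lemma cintegrable_le f (u : T -> R) : cmeas f -> mu.-integrable setT (EFin \o u) ->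
  (forall x, nsq (f x) <= u x ^+ 2) -> cintegrable f.
Proof.
move=> [f1 f2] iu fu; split.
  apply: (le_integrable measurableT _ _ iu); first exact/measurable_EFinP.
  move=> x _; rewrite /= lee_fin -sqrtr_sqr -[leRHS]sqrtr_sqr ler_wsqrtr//.
  exact: le_trans (cRe_norm _) (fu x).
apply: (le_integrable measurableT _ _ iu); first exact/measurable_EFinP.
move=> x _; rewrite /= lee_fin -sqrtr_sqr -[leRHS]sqrtr_sqr ler_wsqrtr//.
exact: le_trans (cIm_norm _) (fu x).
Qed.

Lemma integrableRD (u v : T -> R) : mu.-integrable setT (EFin \o u) ->
  mu.-integrable setT (EFin \o v) -> mu.-integrable setT (fun x => (u x + v x)%:E).
Proof. by move=> iu iv; under eq_fun do rewrite EFinD; exact: integrableD. Qed.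

Lemma integrableRZ k (u : T -> R) : mu.-integrable setT (EFin \o u) ->
  mu.-integrable setT (fun x => (k * u x)%:E).
Proof. by move=> iu; under eq_fun do rewrite EFinM; exact: integrableZl. Qed.

Lemma cintegrableD f g : cintegrable f -> cintegrable g -> cintegrable (fun x => f x + g x).
Proof.
move=> [f1 f2] [g1 g2]; split.
  by under eq_fun do rewrite cReD; exact: integrableRD.
by under eq_fun do rewrite cImD; exact: integrableRD.
Qed.

Lemma cintegrableZ a f : cintegrable f -> cintegrable (fun x => a * f x).
Proof.
move=> [f1 f2]; split.
  under eq_fun do rewrite cReM -mulNr.
  by apply: integrableRD; exact: integrableRZ.
under eq_fun do rewrite cImM.
by apply: integrableRD; exact: integrableRZ.
Qed.

Lemma cintegrableJ f : cintegrable f -> cintegrable (fun x => conjc (f x)).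
Proof.
move=> [f1 f2]; split; first by under eq_fun do rewrite cReJ.
by under eq_fun do rewrite cImJ -mulN1r; exact: integrableRZ.
Qed.

Lemma cintD f g : cintegrable f -> cintegrable g ->
  cint (fun x => f x + g x) = cint f + cint g.
Proof.
move=> [f1 f2] [g1 g2]; apply/eqP; rewrite eq_complex /=; apply/andP; split; apply/eqP.
  by under eq_Rintegral do rewrite cReD; rewrite RintegralD.
by under eq_Rintegral do rewrite cImD; rewrite RintegralD.
Qed.

Lemma cintZ a f : cintegrable f -> cint (fun x => a * f x) = a * cint f.
Proof.
move=> [f1 f2]; apply/eqP; rewrite eq_complex; apply/andP; split; apply/eqP.
  rewrite [in RHS]cReM /=; under eq_Rintegral do rewrite cReM.
  by rewrite RintegralB ?RintegralZl//; exact: integrableRZ.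
rewrite [in RHS]cImM /=; under eq_Rintegral do rewrite cImM.
by rewrite RintegralD ?RintegralZl//; exact: integrableRZ.
Qed.

Lemma cintJ f : cintegrable f -> cint (fun x => conjc (f x)) = conjc (cint f).
Proof.
move=> [f1 f2]; apply/eqP; rewrite eq_complex /=; apply/andP; split; apply/eqP.
  by under eq_Rintegral do rewrite cReJ.
by under eq_Rintegral do rewrite cImJ -mulN1r; rewrite RintegralZl// mulN1r.
Qed.

Lemma cint_sum (I : Type) (s : seq I) (F : I -> T -> R[i]) :
  (forall i, cintegrable (F i)) ->
  cintegrable (fun x => \sum_(i <- s) F i x) /\
  cint (fun x => \sum_(i <- s) F i x) = \sum_(i <- s) cint (F i).
Proof.
move=> iF; elim: s => [|i s [IH1 IH2]].
  under eq_fun do rewrite big_nil.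
  split; first by split; exact: integrable0.
  by rewrite big_nil /cint /= !Rintegral_cst// !mul0r.
under eq_fun do rewrite big_cons; split; first exact: cintegrableD.
by rewrite big_cons cintD// IH2.
Qed.

Lemma eq_cint f g : f =1 g -> cint f = cint g.
Proof. by move=> fg; congr cint; exact/funext. Qed.

Definition sqint f := cmeas f /\ (\int[mu]_x (nsq (f x))%:E < +oo)%E.

Lemma sqint_integrable f : sqint f -> mu.-integrable setT (fun x => (nsq (f x))%:E).
Proof.
move=> [mf fi]; apply/integrableP; split; first exact/measurable_EFinP/measurable_nsq.
by under eq_integral do rewrite gee0_abs ?lee_fin ?nsq_ge0//.
Qed.

Lemma integrable_sqint f : cmeas f -> mu.-integrable setT (fun x => (nsq (f x))%:E) -> sqint f.
Proof.
move=> mf /integrableP[_ fi]; split => //.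
by under eq_integral do rewrite -[X in X%:E]ger0_norm ?nsq_ge0//.
Qed.

Lemma sqint_le f (u : T -> R) : cmeas f -> mu.-integrable setT (EFin \o u) ->
  (forall x, nsq (f x) <= u x) -> sqint f.
Proof.
move=> mf iu fu; apply: integrable_sqint => //.
apply: (le_integrable measurableT _ _ iu); first exact/measurable_EFinP/measurable_nsq.
by move=> x _; rewrite /= lee_fin !ger0_norm ?nsq_ge0// (le_trans (nsq_ge0 (f x)))//.
Qed.

Lemma sqintZD a f g : sqint f -> sqint g -> sqint (fun x => a * f x + g x).
Proof.
move=> lf lg; apply: (@sqint_le _ (fun x => 2 * nsq a * nsq (f x) + 2 * nsq (g x))).
- by apply: cmeasD; [apply: cmeasM; [exact: cmeas_cst|exact: lf.1]|exact: lg.1].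
- by apply: integrableRD; apply: integrableRZ; exact: sqint_integrable.
- by move=> x; apply: le_trans (nsqD _ _) _; rewrite nsqM mulrA.
Qed.

Lemma sqint0 : sqint (fun=> 0).
Proof.
split; first exact: cmeas_cst.
by under eq_integral do rewrite -[0]/(0%:C) nsqR expr0n/=; rewrite integral0.
Qed.

Lemma sqintZ a f : sqint f -> sqint (fun x => a * f x).
Proof. by move=> lf; under eq_fun do rewrite -[_ * _]addr0; apply: sqintZD => //; exact: sqint0. Qed.

Lemma sqintM_bounded f g : cmeas g -> (forall x, nsq (g x) <= 1) -> sqint f ->
  sqint (fun x => g x * f x).
Proof.
move=> mg g1 lf; apply: (@sqint_le _ (fun x => nsq (f x))).
- by apply: cmeasM => //; exact: lf.1.
- exact: sqint_integrable.
- by move=> x; rewrite nsqM ler_piMl ?nsq_ge0.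
Qed.

Lemma sqintJM f g : sqint f -> sqint g -> cintegrable (fun x => f x * conjc (g x)).
Proof.
move=> lf lg; apply: (@cintegrable_le _ (fun x => nsq (f x) + nsq (g x))).
- by apply: cmeasM; [exact: lf.1|apply: cmeasJ; exact: lg.1].
- by apply: integrableRD; exact: sqint_integrable.
- move=> x; rewrite nsqM nsqJ; have := nsq_ge0 (f x); have := nsq_ge0 (g x).
  by rewrite expr2; nra.
Qed.

Definition cip f g : R[i] := cint (fun x => f x * conjc (g x)).

Lemma cipZD a f g h : sqint f -> sqint g -> sqint h ->
  cip (fun x => a * f x + g x) h = a * cip f h + cip g h.
Proof.
move=> lf lg lh; have ifh := sqintJM lf lh; have igh := sqintJM lg lh.
rewrite /cip -cintZ// -cintD//; last exact: cintegrableZ.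
by apply: eq_cint => x; rewrite mulrDl mulrA.
Qed.

Lemma cipJ f g : sqint f -> sqint g -> cip g f = conjc (cip f g).
Proof.
move=> lf lg; rewrite /cip -cintJ; last exact: sqintJM.
by apply: eq_cint => x; rewrite conjM conjcK mulrC.
Qed.

Lemma cipE f : cip f f = (\int[mu]_x nsq (f x))%:C.
Proof.
rewrite /cip /cint; under eq_Rintegral do rewrite -nsqE/=.
by under [X in _ +i* X]eq_Rintegral do rewrite -nsqE/=; rewrite Rintegral_cst// mul0r.
Qed.

Lemma cip_ge0 f : 0 <= cip f f.
Proof. by rewrite cipE ler0c Rintegral_ge0// => x _; exact: nsq_ge0. Qed.

(** Square-integrable functions form a pre-Hilbert space; the functions take values
    in R[i]^o to make them a module over R[i]. *)
Program Definition L2space : @prehilbert R (T -> R[i]^o) :=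
  @Prehilbert R (T -> R[i]^o) sqint cip sqint0 _ _ cipJ (fun f _ => cip_ge0 f).
Next Obligation. by move=> a f g; exact: sqintZD. Qed.
Next Obligation. by move=> a f g h; exact: cipZD. Qed.

Lemma L2_nrm2 f : nrm2 L2space f = \int[mu]_x nsq (f x).
Proof. by rewrite /nrm2 -[ip _ _ _]/(cip f f) cipE. Qed.

Lemma L2_nrm2E f : sqint f -> ((nrm2 L2space f)%:E = \int[mu]_x (nsq (f x))%:E)%E.
Proof.
by move=> [_ lf]; rewrite L2_nrm2 /Rintegral fineK// ge0_fin_numE// integral_ge0// => x _; rewrite lee_fin nsq_ge0.
Qed.

End cint.

Section Lnorm2.
Context {R : realType}.
Local Notation mu := (@lebesgue_measure R).
Implicit Types f : R -> R[i].

Lemma normc_sqr (z : R[i]) : Normc.normc z ^+ 2 = nsq z.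
Proof. by case: z => x y; rewrite /nsq /= sqr_sqrtr// addr_ge0// sqr_ge0. Qed.

Lemma cLnorm_sqr f : (cLnorm 2 f `^ 2 = \int[mu]_x (nsq (f x))%:E)%E.
Proof.
rewrite /cLnorm powR_Lnorm//; apply: eq_integral => x _.
rewrite abse_EFin poweR_EFin powR_mulrn ?normr_ge0// -normrX.
by rewrite normc_sqr ger0_norm// nsq_ge0.
Qed.

Lemma inL2P f : inL 2 f <-> sqint mu f.
Proof.
split=> -[mf fi]; split => //.
  by rewrite -cLnorm_sqr poweR_lty.
move: fi; rewrite -cLnorm_sqr; have := Lnorm_ge0 mu 2%:E (fun x => (Normc.normc (f x))%:E).
rewrite -/(cLnorm 2 f); case: (cLnorm 2 f) => [r| |]//.
  by move=> _ _; exact: ltry.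
by move=> _; rewrite poweRyr//.
Qed.

Lemma cLnorm_lt f (eps : R) : (cLnorm 2 f < eps%:E)%E ->
  (\int[mu]_x (nsq (f x))%:E < (eps ^+ 2)%:E)%E.
Proof.
have := Lnorm_ge0 mu 2%:E (fun x => (Normc.normc (f x))%:E).
rewrite -cLnorm_sqr -/(cLnorm 2 f); case: (cLnorm 2 f) => [r| |]//.
rewrite lee_fin lte_fin => r0 re; rewrite poweR_EFin lte_fin powR_mulrn//.
by rewrite ltrXn2r.
Qed.

End Lnorm2.

(** * Translations and exponentials *)

Section pushforward_measurable.
Context d1 d2 (X : measurableType d1) (Y : measurableType d2) (R : realType).
Variables (phi : X -> Y) (mphi : measurable_fun setT phi) (mu : {measure set X -> \bar R}).

Lemma integral_pushforward_measurable (f : Y -> \bar R) : measurable_fun setT f ->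
  (\int[pushforward mu phi]_y f y = \int[mu]_x f (phi x))%E.
Proof.
move=> mf; rewrite [LHS]integralE [RHS]integralE; congr (_ - _)%E.
  rewrite ge0_integral_pushforward//; last exact: measurable_funepos.
  by rewrite preimage_setT; apply: eq_integral => x _; rewrite /= !funeposE.
rewrite ge0_integral_pushforward//; last exact: measurable_funeneg.
by rewrite preimage_setT; apply: eq_integral => x _; rewrite /= !funenegE.
Qed.

End pushforward_measurable.

Section translation.
Context {R : realType}.
Local Notation mu := (@lebesgue_measure R).
Implicit Types (f : R -> R[i]) (c : R).

Local Notation TR := (measurableTypeR R).

Lemma measurable_shift c : measurable_fun [set: TR] ((fun x : TR => x + c) : TR -> TR).
Proof. by apply: measurable_funD. Qed.

(** A measure that gives half-open intervals their length is Lebesgue measure. *)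
Lemma lebesgue_measure_shift c (A : set R) : measurable A ->
  pushforward mu ((fun x : R => x + c) : TR -> TR) A = mu A.
Proof.
move=> mA; apply/esym.
pose phi : {mfun TR >-> TR} := HB.pack (fun x : R => x + c) (isMeasurableFun.Build _ _ _ _ _ (measurable_shift c)).
apply: (@lebesgue_measure_unique R (pushforward mu phi)) => // _ [[a b]] _ <-.
transitivity (mu `]a - c, b - c]%classic).
  by rewrite !lebesgue_measure_itv/= !lte_fin ltrD2r -!EFinD opprB addrA subrK.
congr (mu _); apply/seteqP; split=> x /=; by rewrite !in_itv/= ltrBlDr lerBrDr.
Qed.

Lemma integral_shift c (f : R -> \bar R) : measurable_fun [set: TR] f ->
  (\int[mu]_x f (x + c)%R = \int[mu]_x f x)%E.
Proof.
move=> mf.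
rewrite -(@integral_pushforward_measurable _ _ TR TR R _ (measurable_shift c) mu _ mf).
apply: eq_measure_integral => //=; first exact: measurable_shift.
by move=> mphi A mA _; exact: lebesgue_measure_shift.
Qed.

Lemma cmeas_shift f c : @cmeas _ TR R f -> @cmeas _ TR R (fun x => f (x + c)).
Proof. move=> [f1 f2]; split. exact: (measurableT_comp f1 (measurable_shift c)). exact: (measurableT_comp f2 (measurable_shift c)). Qed.

Lemma cint_shift f c : @cmeas _ TR R f -> cint mu (fun x => f (x + c)) = cint mu f.
Proof.
move=> [f1 f2]; rewrite /cint /Rintegral; congr (fine _ +i* fine _).
  by rewrite (@integral_shift c (fun x => (complex.Re (f x))%:E))//; exact/measurable_EFinP.
by rewrite (@integral_shift c (fun x => (complex.Im (f x))%:E))//; exact/measurable_EFinP.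
Qed.

Lemma integrable_shift (u : R -> R) c : mu.-integrable setT (EFin \o u) ->
  mu.-integrable setT (fun x => (u (x + c))%:E).
Proof.
move=> /integrableP[mu_ iu]; apply/integrableP; split.
  by move/measurable_EFinP : mu_ => mu_; apply/measurable_EFinP; exact: (measurableT_comp _ (measurable_shift c)).
rewrite (@integral_shift c (fun x => `|(u x)%:E|)%E)//.
exact: measurableT_comp.
Qed.

Lemma cintegrable_shift f c : cintegrable mu f -> cintegrable mu (fun x => f (x + c)).
Proof. by move=> [f1 f2]; split; [exact: (integrable_shift c f1)|exact: (integrable_shift c f2)]. Qed.

Lemma sqint_shift f c : sqint mu f -> sqint mu (fun x => f (x + c)).
Proof.
move=> [mf fi]; split; first exact: cmeas_shift.
by rewrite (@integral_shift c (fun x => (nsq (f x))%:E))//; exact/measurable_EFinP/measurable_nsq.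
Qed.

End translation.

Section expi.
Context {R : realType}.
Implicit Types t s : R.

Lemma expiD t s : expi (t + s) = expi t * expi s.
Proof. by rewrite /expi cosD sinD; apply/eqP; rewrite eq_complex /=; apply/andP; split; apply/eqP; ring. Qed.

Lemma expi0 : expi 0 = 1 :> R[i].
Proof. by rewrite /expi cos0 sin0. Qed.

Lemma expiN t : expi (- t) = conjc (expi t).
Proof. by rewrite /expi cosN sinN. Qed.

Lemma nsq_expi t : nsq (expi t) = 1.
Proof. by rewrite /nsq /= cos2Dsin2. Qed.

Lemma expi_conj t : expi t * conjc (expi t) = 1.
Proof. by rewrite -expiN -expiD subrr expi0. Qed.

Lemma measurable_expi d (T : measurableType d) (u : T -> R) :
  measurable_fun setT u -> cmeas (fun x => expi (u x)).
Proof.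
move=> mu_; split => /=; apply: (measurableT_comp _ mu_).
  apply: continuous_measurable_fun. exact: continuous_cos.
by apply: continuous_measurable_fun; exact: continuous_sin.
Qed.

Lemma sin_le_norm t : `|sin t| <= `|t|.
Proof.
have key (x : R) : 0 < x -> `|sin x| <= x.
  move=> x0.
  have d (y : R) : y \in `]0, x[ -> is_derive y 1 sin (cos y) by move=> _; exact: is_derive_sin.
  have c : {within `[0, x], continuous (@sin R)} by apply: continuous_subspaceT => y; exact: continuous_sin.
  have [y _] := MVT x0 d c; rewrite sin0 !subr0 => ->.
  by rewrite normrM (gtr0_norm x0) ler_piMl ?cos_max// ltW.
have [t0|t0|->] := ltrgt0P t; first exact: key.
  by rewrite -[X in sin X]opprK sinN normrN; apply: key; rewrite oppr_gt0.
by rewrite sin0 normr0.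
Qed.

(** 2 (1 - cos t) is the square of 2 sin (t / 2). *)
Lemma cos_lipschitz t : 2 * (1 - cos t) <= t ^+ 2.
Proof.
have -> : 2 * (1 - cos t) = (2 * sin (t / 2)) ^+ 2.
  have {1}-> : t = t / 2 + t / 2 by rewrite -splitr.
  by rewrite cosD; have := cos2Dsin2 (t / 2); rewrite !expr2; lra.
have := sin_le_norm (t / 2); set s := sin _ => st.
have : `|2 * s| <= `|t|.
  by rewrite normrM ger0_norm// mulrC -ler_pdivlMr// -[2 in leRHS]gtr0_norm// -normfV -normrM.
by rewrite -(ler_pXn2r (ltn0Sn 1)) ?nnegrE// !real_normK// num_real.
Qed.

(** The squared chord 2 (1 - cos t) is at most the squared arc. *)
Lemma nsq_expi_sub1 t : nsq (expi t - 1) <= t ^+ 2.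
Proof.
have -> : nsq (expi t - 1) = 2 * (1 - cos t).
  by have := cos2Dsin2 t; rewrite /nsq /=; nra.
exact: cos_lipschitz.
Qed.

End expi.

(** * Interchanging integrals under a product bound *)

(** The integrands met here are bounded by products of integrable functions of
    the two variables.  Such a bound makes every section integrable, without an
    exceptional set, so that the iterated integrals are literally defined. *)
Section dominated_fubini.
Context d1 d2 (T1 : measurableType d1) (T2 : measurableType d2) (R : realType).
Variables (m1 : {sigma_finite_measure set T1 -> \bar R}).
Variables (m2 : {sigma_finite_measure set T2 -> \bar R}).
Variables (phi : T1 -> R) (psi : T2 -> R).
Hypotheses (iphi : m1.-integrable setT (EFin \o phi)) (ipsi : m2.-integrable setT (EFin \o psi)).

Section real.
Variable f : T1 * T2 -> R.
Hypotheses (mf : measurable_fun setT f) (fle : forall x y, `|f (x, y)| <= `|phi x| * `|psi y|).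

Lemma integrable_section1 x : m2.-integrable setT (fun y => (f (x, y))%:E).
Proof.
have := integrableRZ `|phi x| (integrable_abse ipsi).
apply: le_integrable => //; first exact/measurable_EFinP/measurableT_comp.
by move=> y _; rewrite /= lee_fin normrM !normr_id.
Qed.

Lemma integrable_section2 y : m1.-integrable setT (fun x => (f (x, y))%:E).
Proof.
have := integrableRZ `|psi y| (integrable_abse iphi).
apply: le_integrable => //; first exact/measurable_EFinP/measurableT_comp.
by move=> x _; rewrite /= lee_fin normrM !normr_id mulrC.
Qed.

Lemma integrable_dominated_prod : (m1 \x m2)%E.-integrable setT (fun z => (f z)%:E).
Proof.
apply/integrable12ltyP; first exact/measurable_EFinP.
apply: (@le_lt_trans _ _ (\int[m1]_x (`|phi x|%:E * \int[m2]_y `|psi y|%:E))%E).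
  apply: ge0_le_integral => //.
  - by move=> x _; exact: integral_ge0.
  - apply: (measurable_fun_fubini_tonelli_F (fun z => `|(f z)%:E|)%E) => //.
    by apply: measurableT_comp => //; exact/measurable_EFinP.
  - apply: emeasurable_funM; last exact: measurable_cst.
    by have /measurable_int := integrable_abse iphi.
  - move=> x _; rewrite -ge0_integralZl//; last by have /measurable_int := integrable_abse ipsi.
    apply: ge0_le_integral => //.
    + by apply: measurableT_comp => //; apply/measurable_EFinP; apply: measurableT_comp.
    + by apply: emeasurable_funM => //; have /measurable_int := integrable_abse ipsi.
    + by move=> y _; rewrite -EFinM lee_fin.
have [_ i1] := integrableP _ _ _ iphi; have [_ i2] := integrableP _ _ _ ipsi.
have i2f : (\int[m2]_y `|psi y|%:E)%E \is a fin_num.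
  by rewrite ge0_fin_numE ?integral_ge0.
rewrite -(fineK i2f) ge0_integralZr//; first by rewrite muleC lte_mul_pinfty// lee_fin fine_ge0// integral_ge0.
  by have /measurable_int := integrable_abse iphi.
by rewrite lee_fin fine_ge0// integral_ge0.
Qed.

Lemma integrable_Rintegral2 : m2.-integrable setT (fun y => (\int[m1]_x f (x, y))%:E).
Proof.
have E : (fun y => (\int[m1]_x f (x, y))%:E) = fubini_G m1 (fun z => (f z)%:E).
  apply/funext => y; rewrite /fubini_G /Rintegral fineK//.
  exact/integrable_fin_num/integrable_section2.
have := integrableRZ (\int[m1]_x `|phi x|) (integrable_abse ipsi).
apply: le_integrable => //; first by rewrite E; exact: measurable_fubini_G integrable_dominated_prod.
move=> y _ /=; rewrite lee_fin; apply: le_trans (le_normr_Rintegral _ _) _ => //.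
  exact: integrable_section2.
rewrite -[leRHS]ger0_norm// normr_id -RintegralZr//; last exact: integrable_abse iphi.
rewrite ger0_norm; last by apply: Rintegral_ge0 => x _; rewrite mulr_ge0.
apply: le_Rintegral => //; first exact: integrable_abse (integrable_section2 y).
by under eq_fun do rewrite mulrC; exact: integrableRZ (integrable_abse iphi).
Qed.

Lemma Rintegral_swap :
  \int[m1]_x \int[m2]_y f (x, y) = \int[m2]_y \int[m1]_x f (x, y).
Proof.
have := Fubini integrable_dominated_prod => h.
rewrite /Rintegral; congr fine.
transitivity (\int[m1]_x \int[m2]_y (f (x, y))%:E)%E.
  apply: eq_integral => x _; rewrite /Rintegral fineK//.
  exact/integrable_fin_num/integrable_section1.
rewrite h; apply: eq_integral => x _; rewrite /Rintegral fineK//.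
exact/integrable_fin_num/integrable_section2.
Qed.

End real.

Variable F : T1 * T2 -> R[i].
Hypotheses (mF : cmeas F) (Fle : forall x y, nsq (F (x, y)) <= (phi x * psi y) ^+ 2).

Let leRe x y : `|complex.Re (F (x, y))| <= `|phi x| * `|psi y|.
Proof.
rewrite -normrM -sqrtr_sqr -[leRHS]sqrtr_sqr ler_wsqrtr//.
exact: le_trans (cRe_norm _) (Fle x y).
Qed.

Let leIm x y : `|complex.Im (F (x, y))| <= `|phi x| * `|psi y|.
Proof.
rewrite -normrM -sqrtr_sqr -[leRHS]sqrtr_sqr ler_wsqrtr//.
exact: le_trans (cIm_norm _) (Fle x y).
Qed.

Lemma cintegrable_cint2 : cintegrable m2 (fun y => cint m1 (fun x => F (x, y))).
Proof.
by split; [exact: (integrable_Rintegral2 mF.1 leRe)|exact: (integrable_Rintegral2 mF.2 leIm)].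
Qed.

Lemma cint_swap : cint m1 (fun x => cint m2 (fun y => F (x, y))) =
  cint m2 (fun y => cint m1 (fun x => F (x, y))).
Proof.
by rewrite /cint /= (Rintegral_swap mF.1 leRe) (Rintegral_swap mF.2 leIm).
Qed.

End dominated_fubini.

(** * Functions detected by intervals, and the Poisson kernel *)

Section interval_tests.
Context {R : realType}.
Local Notation mu := (@lebesgue_measure R).

Lemma ae_mono (P Q : R -> Prop) : (forall x, P x -> Q x) ->
  {ae mu, forall x, P x} -> {ae mu, forall x, Q x}.
Proof. by move=> PQ; apply: filterS => //; exact: (ae_filter_ringOfSetsType mu). Qed.

Lemma ae_and (P Q : R -> Prop) : {ae mu, forall x, P x} ->
  {ae mu, forall x, Q x} -> {ae mu, forall x, P x /\ Q x}.
Proof. by move=> aP aQ; apply: filterI => //; exact: (ae_filter_ringOfSetsType mu). Qed.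

(** The primitive vanishes, hence so does its derivative, by the fundamental theorem. *)
Lemma null_on_intervals (u : R -> R) : mu.-integrable setT (EFin \o u) ->
  (forall c d, c < d -> \int[mu]_(x in `[c, d]) u x = 0) -> {ae mu, forall x, u x = 0}.
Proof.
move=> iu u0.
have lu : locally_integrable setT u by apply: open_integrable_locally => //; exact: openT.
have F0 (c x : R) : \int[mu]_(t in `[c, x]) u t = 0.
  have [cx|xc|<-] := ltgtP c x; first exact: u0.
    by rewrite set_itv_ge ?Rintegral_set0// bnd_simp -ltNge.
  by rewrite set_itv1 Rintegral_set1.
have H (k : nat) : {ae mu, forall x : R, - k%:R < x -> u x = 0}.
  have iuk (y : R) : mu.-integrable [set` Interval (BLeft (- k%:R)) (BRight y)] (EFin \o u).
    exact: integrableS iu.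
  have := FTC1 iuk lu.
  apply: ae_mono => x /= + kx.
  rewrite lte_fin => /(_ kx) [_ <-].
  by under eq_fun do rewrite F0; rewrite derive1_cst.
have /ae_foralln := H; apply: ae_mono => x Hx.
apply: (Hx (Num.truncn (- x)).+1); rewrite ltrNl.
have [x0|x0] := leP 0 (- x); first by have /andP[] := truncn_itv x0.
by apply: lt_le_trans x0 _; rewrite ler0n.
Qed.

End interval_tests.

Section abel.
Context {R : realType}.
Local Notation mu := (@lebesgue_measure R).
Implicit Types (e s t : R).

(** The summability factor of the proof of Fourier inversion; unlike for a
    Gaussian factor, both its transform and the primitive of its transform are
    elementary. *)
Definition abel e : R -> R := fun w => expR (- (e * `|w|)).

Lemma abel_ge0 e w : 0 <= abel e w. Proof. exact: expR_ge0. Qed.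

Lemma abel_le1 e w : 0 <= e -> abel e w <= 1.
Proof. by move=> e0; rewrite -expR0 ler_expR oppr_le0 mulr_ge0. Qed.

Lemma continuous_abel e : continuous (abel e).
Proof.
move=> x; apply: (@continuous_comp _ _ _ (fun x : R => - (e * `|x|)) expR); last exact: continuous_expR.
by apply: cvgN; apply: cvgM; [exact: cvg_cst|exact: norm_continuous].
Qed.

Lemma cvg_expR_scaled e : 0 < e -> expR (- (e * w)) @[w --> +oo] --> (0 : R).
Proof.
move=> e0; have := cvg_comp (fun w : R => e * w) (fun y : R => expR (- y)) (gt0_cvgMry e0 cvg_id) (@cvgr_expR R).
exact.
Qed.

(** Adding 1 to the cosine makes the integrand e^(-e w) (1 + cos (s w)) nonnegative,
    so that its integral over the half-line follows from this primitive. *)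
Definition abel_primitive e s w := expR (- (e * w)) *
  (- e^-1 + (s * sin (s * w) - e * cos (s * w)) / (e ^+ 2 + s ^+ 2)).

Lemma is_derive_abel_primitive e s (w : R) : 0 < e ->
  is_derive w 1 (abel_primitive e s) (expR (- (e * w)) * (1 + cos (s * w))).
Proof.
move=> e0; rewrite /abel_primitive.
have es : e ^+ 2 + s ^+ 2 != 0 by rewrite gt_eqF// ltr_wpDr ?sqr_ge0// exprn_gt0.
have en : e != 0 by rewrite gt_eqF.
apply: is_derive_eq => /=.
by rewrite /GRing.scale /=; field; rewrite en es.
Qed.

Lemma continuous_mulcos s : continuous (fun w : R => cos (s * w)).
Proof.
move=> x; apply: (@continuous_comp _ _ _ (fun x : R => s * x) cos); last exact: continuous_cos.
by apply: cvgM; [exact: cvg_cst|exact: cvg_id].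
Qed.

Lemma continuous_abel_cos e s : continuous (fun w => abel e w * (1 + cos (s * w))).
Proof.
move=> x; apply: cvgM; first exact: continuous_abel.
by apply: cvgD; [exact: cvg_cst|exact: continuous_mulcos].
Qed.

Lemma abel_cos_ge0 e s w : 0 <= abel e w * (1 + cos (s * w)).
Proof. by rewrite mulr_ge0 ?abel_ge0//; have := cos_geN1 (s * w); lra. Qed.

Lemma integral_abel_cos e s : 0 < e ->
  (\int[mu]_w (abel e w * (1 + cos (s * w)))%:E =
   (2 * (e^-1 + e / (e ^+ 2 + s ^+ 2)))%:E)%E.
Proof.
move=> e0; rewrite ge0_symfun_integralT; last first.
- by move=> x /=; rewrite /abel normrN mulrN cosN.
- exact: continuous_abel_cos.
- exact: abel_cos_ge0.
rewrite -set_itvcy EFinM; congr (_ * _)%E.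
rewrite (@ge0_continuous_FTC2y _ _ (abel_primitive e s) 0 0).
- rewrite /abel_primitive mulr0 oppr0 expR0 mulr0 sin0 cos0 -EFinB; congr EFin.
  have es : e ^+ 2 + s ^+ 2 != 0 by rewrite gt_eqF// ltr_wpDr ?sqr_ge0// exprn_gt0.
  have en : e != 0 by rewrite gt_eqF.
  by field; rewrite en es.
- by move=> x _; exact: abel_cos_ge0.
- by apply: continuous_subspaceT; exact: continuous_abel_cos.
- pose C := e^-1 + (`|s| + e) / (e ^+ 2 + s ^+ 2).
  have es : 0 < e ^+ 2 + s ^+ 2 by rewrite ltr_wpDr ?sqr_ge0// exprn_gt0.
  apply/cvgr0Pnorm_lt => eps eps0.
  have /cvgr0Pnorm_lt/(_ (eps / (C + 1))) := cvg_expR_scaled e0.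
  have C0 : 0 <= C by rewrite addr_ge0 ?invr_ge0 ?(ltW e0)// divr_ge0 ?(ltW es)// addr_ge0// ltW.
  have -> : 0 < eps / (C + 1) by rewrite divr_gt0// ltr_pwDr.
  move=> /(_ isT); apply: filterS => w; rewrite ger0_norm ?expR_ge0// ltr_pdivlMr ?ltr_pwDr// => h.
  apply: le_lt_trans h; rewrite normrM ger0_norm ?expR_ge0// ler_pM2l ?expR_gt0//.
  apply: (@le_trans _ _ C); last by rewrite lerDl.
  apply: le_trans (ler_normD _ _) _; rewrite normrN ger0_norm ?invr_ge0 ?(ltW e0)// lerD2l.
  rewrite normrM [X in _ * X <= _]ger0_norm ?invr_ge0 ?(ltW es)// ler_pM2r ?invr_gt0//.
  apply: le_trans (ler_normB _ _) _; rewrite !normrM (gtr0_norm e0).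
  by apply: lerD; [rewrite ler_piMr ?ler_norml ?sin_geN1 ?sin_le1//|rewrite ler_piMr ?(ltW e0)// ler_norml cos_geN1 cos_le1].
- by move=> x _; have := is_derive_abel_primitive s x e0; case.
- apply: cvg_at_right_filter; apply: differentiable_continuous.
  by apply/derivable1_diffP; have := is_derive_abel_primitive s 0 e0; case.
- move=> x; rewrite in_itv/= andbT => x0.
  rewrite derive1E; have [_ ->] := is_derive_abel_primitive s x e0.
  by rewrite /abel gtr0_norm.
Qed.

Lemma integrable_abel e : 0 < e -> mu.-integrable setT (EFin \o abel e).
Proof.
move=> e0; apply/integrableP; split.
  by apply/measurable_EFinP; apply: continuous_measurable_fun; exact: continuous_abel.
apply: (@le_lt_trans _ _ (\int[mu]_w (abel e w * (1 + cos (0 * w)))%:E)%E); last first.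
  by rewrite integral_abel_cos ?ltry.
apply: ge0_le_integral => //.
- apply: measurableT_comp => //.
  by apply/measurable_EFinP; apply: continuous_measurable_fun; exact: continuous_abel.
- by apply/measurable_EFinP; apply: continuous_measurable_fun; exact: continuous_abel_cos.
- move=> w _; rewrite /= lee_fin ger0_norm ?abel_ge0// mul0r cos0.
  by rewrite ler_peMr ?abel_ge0//; lra.
Qed.

Lemma integral_abel e : 0 < e -> \int[mu]_w abel e w = 2 / e.
Proof.
move=> e0; have := integral_abel_cos 0 e0.
have -> : (fun w : R => (abel e w * (1 + cos (0 * w)))%:E) = (fun w => 2%:E * (abel e w)%:E)%E.
  by apply/funext => w; rewrite mul0r cos0 -EFinM mulrC.
rewrite integralZl//; last exact: integrable_abel.
have fi := integrable_fin_num measurableT (integrable_abel e0).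
rewrite -(fineK fi) -EFinM => -[] /(mulfI _) H.
rewrite /Rintegral [LHS]H ?pnatr_eq0//.
have e1 : e != 0 by rewrite gt_eqF.
by field.
Qed.

Lemma measurable_muln (u : R -> R) s : continuous u -> measurable_fun [set: measurableTypeR R] (fun w => u (s * w)).
Proof.
move=> cu; apply: continuous_measurable_fun => x; apply: (@continuous_comp _ _ _ (fun x : R => s * x) u); last exact: cu.
by apply: cvgM; [exact: cvg_cst|exact: cvg_id].
Qed.

Lemma integrable_abelM e (u : R -> R) : 0 < e -> measurable_fun [set: measurableTypeR R] u ->
  (forall w, `|u w| <= 1) -> mu.-integrable setT (fun w => (abel e w * u w)%:E).
Proof.
move=> e0 mu_ u1; apply: le_integrable (integrable_abel e0) => //.
  apply/measurable_EFinP; apply: measurable_funM => //.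
  by apply: continuous_measurable_fun; exact: continuous_abel.
by move=> w _; rewrite /= lee_fin normrM ler_piMr.
Qed.

Lemma cos_norm_le1 (x : R) : `|cos x| <= 1. Proof. by rewrite ler_norml cos_geN1 cos_le1. Qed.
Lemma sin_norm_le1 (x : R) : `|sin x| <= 1. Proof. by rewrite ler_norml sin_geN1 sin_le1. Qed.

Lemma Rintegral_abel_cos e s : 0 < e ->
  \int[mu]_w (abel e w * cos (s * w)) = 2 * e / (e ^+ 2 + s ^+ 2).
Proof.
move=> e0; have := integral_abel_cos s e0.
have ic : mu.-integrable setT (fun w => (abel e w * cos (s * w))%:E).
  apply: integrable_abelM => //; last by move=> w; exact: cos_norm_le1.
  by apply: measurable_muln => x; exact: continuous_cos.
have -> : (fun w : R => (abel e w * (1 + cos (s * w)))%:E) =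
   (fun w => (abel e w + abel e w * cos (s * w))%:E)%E.
  by apply/funext => w; rewrite mulrDr mulr1.
move=> /(congr1 (@fine R)); rewrite -[LHS]/(\int[mu]_w (abel e w + abel e w * cos (s * w))).
rewrite RintegralD ?integral_abel//=; last exact: integrable_abel.
by move=> H; apply: (addrI (2 / e)); rewrite H; ring.
Qed.

Lemma Rintegral_abel_sin e s : 0 < e -> \int[mu]_w (abel e w * sin (s * w)) = 0.
Proof.
move=> e0; have mu_ : measurable_fun [set: measurableTypeR R] (fun w => abel e w * sin (s * w)).
  apply: measurable_funM; first by apply: continuous_measurable_fun; exact: continuous_abel.
  by apply: measurable_muln => x; exact: continuous_sin.
have H : \int[mu]_w (abel e w * sin (s * w)) = \int[mu]_w (- (abel e w * sin (s * w))).
  rewrite /Rintegral; congr fine.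
  have mN : measurable_fun [set: measurableTypeR R] (-%R : _ -> measurableTypeR R) by exact: measurable_funN.
  transitivity (\int[pushforward mu (-%R : _ -> measurableTypeR R)]_w (abel e w * sin (s * w))%:E)%E.
    by apply: eq_measure_integral => A mA _; exact/esym/lebesgue_measureN.
  rewrite (@integral_pushforward_measurable _ _ _ _ _ _ mN mu (fun w => (abel e w * sin (s * w))%:E)).
    by apply: eq_integral => w _; rewrite /abel normrN mulrN sinN mulrN.
  exact/measurable_EFinP.
have is_ : mu.-integrable setT (fun w => (abel e w * sin (s * w))%:E).
  apply: integrable_abelM => //; last by move=> w; exact: sin_norm_le1.
  by apply: measurable_muln => x; exact: continuous_sin.
move: H; under [in X in _ = X -> _]eq_Rintegral do rewrite -mulN1r.
by rewrite RintegralZl// mulN1r => /eqP; rewrite -addr_eq0 -mulr2n mulrn_eq0/= => /eqP.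
Qed.

(** The Fourier transform of the two-sided exponential is the Poisson kernel. *)
Lemma abel_kernel e t : 0 < e ->
  cint mu (fun w => (abel e w)%:C * expi (t * w)) = (2 * e / (e ^+ 2 + t ^+ 2))%:C.
Proof.
move=> e0; rewrite /cint; congr (_ +i* _).
  rewrite -(Rintegral_abel_cos t e0); apply: eq_Rintegral => w _.
  by rewrite cReM /= mul0r subr0.
rewrite -(Rintegral_abel_sin t e0); apply: eq_Rintegral => w _.
by rewrite cImM /= mul0r addr0.
Qed.

Lemma integral_poisson e y c d : 0 < e -> c < d ->
  \int[mu]_(x in `[c, d]) (2 * e / (e ^+ 2 + (2 * pi * (x - y)) ^+ 2)) =
  (atan (2 * pi * (d - y) / e) - atan (2 * pi * (c - y) / e)) / pi.
Proof.
move=> e0 cd.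
have pi0 : pi != 0 :> R by rewrite gt_eqF ?pi_gt0.
have en : e != 0 by rewrite gt_eqF.
pose F (x : R) := pi^-1 * atan (2 * pi / e * (x - y)).
have pos (x : R) : 0 < e ^+ 2 + (2 * pi * (x - y)) ^+ 2 by rewrite ltr_wpDr ?sqr_ge0// exprn_gt0.
have dF (x : R) : is_derive x 1 F (2 * e / (e ^+ 2 + (2 * pi * (x - y)) ^+ 2)).
  rewrite /F; apply: is_derive_eq; rewrite /GRing.scale /=.
  have p2 : 1 + (2 * pi / e * (x - y)) ^+ 2 != 0 by rewrite gt_eqF// ltr_wpDr ?sqr_ge0.
  have := lt0r_neq0 (pos x); move: p2 pi0 en; clear; move: (pi : R) => p p2 p0 en p3.
  by field; rewrite p3 en p0.
rewrite /Rintegral (@continuous_FTC2 _ _ F)//.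
- by rewrite /F /= -mulrBr mulrC; congr ((atan _ - atan _) / _); ring.
- apply: continuous_subspaceT => x; apply: cvgM; first exact: cvg_cst.
  apply: cvgV; first by rewrite gt_eqF.
  apply: cvgD; first exact: cvg_cst.
  rewrite expr2; under eq_fun do rewrite expr2.
  by apply: cvgM; (apply: cvgM; [exact: cvg_cst|apply: cvgB; [exact: cvg_id|exact: cvg_cst]]).
- split; first by move=> x _; case: (dF x).
    by apply: cvg_at_right_filter; apply: differentiable_continuous; apply/derivable1_diffP; case: (dF c).
  by apply: cvg_at_left_filter; apply: differentiable_continuous; apply/derivable1_diffP; case: (dF d).
- by move=> x _; rewrite derive1E; case: (dF x).
Qed.

End abel.

(** * Fourier inversion and the Parseval identity *)

Section oscillatory.
Context {R : realType}.
Local Notation mu := (@lebesgue_measure R).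
Local Notation TR := (measurableTypeR R).
Implicit Types (f g h k : R -> R[i]) (s e y : R).

Lemma null_on_subintervals a b (u : R -> R) : mu.-integrable `[a, b] (EFin \o u) ->
  (forall c d, a <= c -> c < d -> d <= b -> \int[mu]_(x in `[c, d]) u x = 0) ->
  {ae mu, forall x, a <= x <= b -> u x = 0}.
Proof.
move=> iu u0.
have iv : mu.-integrable setT (EFin \o (u \_ `[a, b])).
  by move: iu; rewrite integrable_mkcond//= (restrict_EFin u).
have uv c d : c < d -> \int[mu]_(x in `[c, d]) (u \_ `[a, b]) x = 0.
  move=> cd; rewrite -Rintegral_mkcondr.
  have -> : `[c, d]%classic `&` `[a, b]%classic = `[Num.max c a, Num.min d b]%classic.
    apply/seteqP; split=> x /=; rewrite !in_itv /= ge_max le_min.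
      by move=> [/andP[-> ->] /andP[-> ->]].
    by move=> /andP[/andP[-> ->] /andP[-> ->]].
  have [h|h|->] := ltgtP (Num.max c a) (Num.min d b).
  - by apply: u0 => //; rewrite ?le_max ?ge_min lexx orbT.
  - by rewrite set_itv_ge ?Rintegral_set0// bnd_simp -ltNge.
  - by rewrite set_itv1 Rintegral_set1.
have := null_on_intervals iv uv; apply: ae_mono => x + xab.
by rewrite patchE ifT// inE/= in_itv.
Qed.

(** A dominating function for f that is additive in the two coordinates. *)
Definition cdom f x := `|complex.Re (f x)| + `|complex.Im (f x)|.

Lemma nsq_cdom f x : nsq (f x) <= cdom f x ^+ 2.
Proof.
rewrite /nsq /cdom -(real_normK (num_real (complex.Re _))) -(real_normK (num_real (complex.Im _))).
by rewrite sqrrD -addrA lerD2l lerDr mulrn_wge0// mulr_ge0.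
Qed.

Lemma integrable_cdom f : cintegrable mu f -> mu.-integrable setT (EFin \o cdom f).
Proof.
move=> [f1 f2]; apply: (@integrableRD _ TR R mu (fun x => `|complex.Re (f x)|) (fun x => `|complex.Im (f x)|)).
  exact: integrable_abse f1.
exact: integrable_abse f2.
Qed.

Lemma nsq_cint f : cintegrable mu f -> nsq (cint mu f) <= (\int[mu]_x cdom f x) ^+ 2.
Proof.
move=> [f1 f2]; rewrite /cdom RintegralD//; [|exact: integrable_abse f1|exact: integrable_abse f2].
set A := \int[mu]_x `|complex.Re (f x)|; set B := \int[mu]_x `|complex.Im (f x)|.
have A1 : `|complex.Re (cint mu f)| <= A by apply: le_normr_Rintegral.
have B1 : `|complex.Im (cint mu f)| <= B by apply: le_normr_Rintegral.
apply: le_trans (nsq_cdom (fun=> cint mu f) 0) _.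
have A0 : 0 <= A := le_trans (normr_ge0 _) A1; have B0 : 0 <= B := le_trans (normr_ge0 _) B1.
rewrite ler_pXn2r ?nnegrE ?addr_ge0//; exact: lerD.
Qed.

Lemma cintegrableM_bounded f g (C : R) : cmeas g -> (forall x, nsq (g x) <= C ^+ 2) ->
  cintegrable mu f -> cintegrable mu (fun x => f x * g x).
Proof.
move=> mg gC If; apply: (@cintegrable_le _ TR R mu _ (fun x => C * cdom f x)).
- by apply: cmeasM => //; exact: cintegrable_meas If.
- exact: integrableRZ (integrable_cdom If).
- by move=> x; rewrite nsqM exprMn mulrC ler_pM ?nsq_ge0//; exact: nsq_cdom.
Qed.

Lemma cmeas_expi_lin s : @cmeas _ TR R (fun x => expi (s * x)).
Proof. by apply: measurable_expi; exact: measurable_funM. Qed.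

Lemma cintegrableM_expi f s : cintegrable mu f -> cintegrable mu (fun x => f x * expi (s * x)).
Proof.
move=> If; apply: (@cintegrableM_bounded _ _ 1) => //; first exact: cmeas_expi_lin.
by move=> x; rewrite nsq_expi expr1n.
Qed.

(** Fourier integrals with a frequency normalization s: [s = - (2 * pi)] gives the
    transform and [s = 2 * pi] the inverse transform, and the same lemmas serve
    for both. *)
Definition osc s f w := cint mu (fun x => f x * expi (s * w * x)).

Lemma fourier_oscE f : fourier_integral f = osc (- (2 * pi)) f.
Proof.
apply/funext => w; apply: (@eq_cint _ TR R mu) => x; congr (_ * expi _).
by rewrite !mulNr; congr (- _); rewrite mulrAC.
Qed.

Lemma cmeas_prodE s : @cmeas _ (TR * TR)%type R (fun z => expi (s * z.2 * z.1)).
Proof. by apply: measurable_expi; do 2?apply: measurable_funM. Qed.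

Lemma cmeas_fst f : @cmeas _ TR R f -> @cmeas _ (TR * TR)%type R (fun z => f z.1).
Proof. by move=> [f1 f2]; split; [exact: (measurableT_comp f1)|exact: (measurableT_comp f2)]. Qed.

Lemma cmeas_snd f : @cmeas _ TR R f -> @cmeas _ (TR * TR)%type R (fun z => f z.2).
Proof. by move=> [f1 f2]; split; [exact: (measurableT_comp f1)|exact: (measurableT_comp f2)]. Qed.

(** The multiplication formula, by exchanging the order of integration. *)
Lemma osc_mul s f k : cintegrable mu f -> cintegrable mu k ->
  cintegrable mu (fun w => osc s f w * k w) /\
  cint mu (fun w => osc s f w * k w) = cint mu (fun x => f x * osc s k x).
Proof.
move=> If Ik; pose F (z : TR * TR) := f z.1 * expi (s * z.2 * z.1) * k z.2.
have mF : cmeas F.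
  apply: cmeasM; first apply: cmeasM; last by apply: cmeas_snd; exact: cintegrable_meas Ik.
    by apply: cmeas_fst; exact: cintegrable_meas If.
  exact: cmeas_prodE.
have Fle x w : nsq (F (x, w)) <= (cdom f x * cdom k w) ^+ 2.
  rewrite /F /= !nsqM nsq_expi mulr1 exprMn ler_pM ?nsq_ge0//; exact: nsq_cdom.
have E1 w : cint mu (fun x => F (x, w)) = osc s f w * k w.
  rewrite mulrC /osc -cintZ; last exact: cintegrableM_expi.
  by apply: eq_cint => x; rewrite mulrC.
have E2 x : cint mu (fun w => F (x, w)) = f x * osc s k x.
  rewrite /osc -cintZ; last exact: cintegrableM_expi.
  by apply: eq_cint => w; rewrite /F /= -mulrA [expi _ * _]mulrC (mulrAC s).
have i1 := integrable_cdom If; have i2 := integrable_cdom Ik.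
split.
  have := cintegrable_cint2 i1 i2 mF Fle.
  by under eq_fun do rewrite E1.
have := cint_swap i1 i2 mF Fle.
rewrite (@eq_cint _ _ _ _ _ _ E2) (@eq_cint _ _ _ _ _ _ E1) => <- //.
Qed.

Lemma cintegrable_abel : cintegrable mu (fun w => (abel 1 w)%:C).
Proof. by split; [exact: integrable_abel|exact: integrable0]. Qed.

(** Multiplied by the integrable function [abel 1], the transform is a marginal of
    an integrable function of two variables, hence measurable; the factor is then
    divided out. *)
Lemma cmeas_osc s f : cintegrable mu f -> cmeas (osc s f).
Proof.
move=> If; have [/cintegrable_meas m _] := osc_mul s If cintegrable_abel.
have me : @cmeas _ TR R (fun w => (expR `|w|)%:C).
  by apply: cmeasR; apply: measurableT_comp.
have := cmeasM m me; congr cmeas; apply/funext => w.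
by rewrite -mulrA -rmorphM/= /abel mul1r -expRD addNr expR0 mulr1.
Qed.

Lemma nsq_osc s f w : cintegrable mu f -> nsq (osc s f w) <= (2 * \int[mu]_x cdom f x) ^+ 2.
Proof.
move=> If; apply: le_trans (nsq_cint (cintegrableM_expi (s * w) If)) _.
have If' := cintegrableM_expi (s * w) If.
have ge (h : R -> R[i]) : 0 <= \int[mu]_x cdom h x.
  by apply: Rintegral_ge0 => x _; rewrite addr_ge0.
rewrite ler_pXn2r ?nnegrE ?mulr_ge0// -RintegralZl//; last exact: integrable_cdom.
apply: le_Rintegral => //; [exact: integrable_cdom|exact: integrableRZ (integrable_cdom If)|].
move=> x _; rewrite /cdom cReM cImM /=.
have := cos_norm_le1 (s * w * x); have := sin_norm_le1 (s * w * x).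
move: (complex.Re _) (complex.Im _) (sin _) (cos _) => a b S C S1 C1.
have [aS aC bS bC] : [/\ `|a * S| <= `|a|, `|a * C| <= `|a|, `|b * S| <= `|b| & `|b * C| <= `|b|].
  by split; rewrite normrM ler_piMr.
have := ler_normB (a * C) (b * S); have := ler_normD (a * S) (b * C); lra.
Qed.

Lemma conj_osc s f w : cintegrable mu f -> conjc (osc s f w) = osc (- s) (fun x => conjc (f x)) w.
Proof.
move=> If; rewrite /osc -cintJ; last exact: cintegrableM_expi.
by apply: eq_cint => x; rewrite conjM -expiN !mulNr.
Qed.

Lemma cvg_Rintegral_scale (en : nat -> R -> R) (e0 : R -> R) (u : R -> R) :
  (forall n, measurable_fun [set: TR] (en n)) -> measurable_fun [set: TR] e0 ->
  (forall n x, `|en n x| <= 1) ->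
  {ae mu, forall x, en n x @[n --> \oo] --> e0 x} ->
  mu.-integrable setT (EFin \o u) ->
  (\int[mu]_x (en n x * u x)) @[n --> \oo] --> \int[mu]_x (e0 x * u x).
Proof.
move=> men me e1 ec iu.
have mu_ : measurable_fun [set: TR] u by exact/measurable_EFinP/measurable_int/iu.
have [] := @dominated_convergence _ TR R mu setT measurableT
  (fun n x => (en n x * u x)%:E) (fun x => (e0 x * u x)%:E) (fun x => `|u x|%:E).
- by move=> n; apply/measurable_EFinP; exact: measurable_funM.
- by apply/measurable_EFinP; exact: measurable_funM.
- apply: ae_mono ec => x cx _; apply: cvg_EFin; first exact: nearW.
  by apply: cvgM => //; exact: cvg_cst.
- exact: integrable_abse iu.
- by apply: aeW => x n _; rewrite /= lee_fin normrM ler_piMl.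
move=> /(integrable_fin_num measurableT) fi _; rewrite -(fineK fi) => /fine_cvg.
by [].
Qed.

Lemma cvg_cint_scale (en : nat -> R -> R) (e0 : R -> R) f :
  (forall n, measurable_fun [set: TR] (en n)) -> measurable_fun [set: TR] e0 ->
  (forall n x, `|en n x| <= 1) ->
  {ae mu, forall x, en n x @[n --> \oo] --> e0 x} -> cintegrable mu f ->
  complex.Re (cint mu (fun x => (en n x)%:C * f x)) @[n --> \oo] -->
    complex.Re (cint mu (fun x => (e0 x)%:C * f x)) /\
  complex.Im (cint mu (fun x => (en n x)%:C * f x)) @[n --> \oo] -->
    complex.Im (cint mu (fun x => (e0 x)%:C * f x)).
Proof.
have RE (a : R) (z : R[i]) : complex.Re (a%:C * z) = a * complex.Re z by rewrite cReM/= mul0r subr0.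
have IE (a : R) (z : R[i]) : complex.Im (a%:C * z) = a * complex.Im z by rewrite cImM/= mul0r addr0.
move=> men me e1 ec [f1 f2]; rewrite /cint /=; split.
  have E (a : R -> R) : \int[mu]_x complex.Re ((a x)%:C * f x) = \int[mu]_x (a x * complex.Re (f x)).
    by apply: eq_Rintegral => x _; exact: RE.
  have := cvg_Rintegral_scale men me e1 ec f1.
  by rewrite E; under [in X in _ -> X]eq_fun do rewrite E.
have E (a : R -> R) : \int[mu]_x complex.Im ((a x)%:C * f x) = \int[mu]_x (a x * complex.Im (f x)).
  by apply: eq_Rintegral => x _; exact: IE.
have := cvg_Rintegral_scale men me e1 ec f2.
by rewrite E; under [in X in _ -> X]eq_fun do rewrite E.
Qed.

Definition ind c d (x : R) : R[i] := (\1_(`[c, d]) x)%:C.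

Lemma cintegrable_ind c d : cintegrable mu (ind c d).
Proof.
split; last exact: integrable0.
by apply: integrable_indic_itv.
Qed.

Lemma cint_ind c d f : cint mu (fun x => ind c d x * f x) =
  (\int[mu]_(x in `[c, d]) complex.Re (f x)) +i* (\int[mu]_(x in `[c, d]) complex.Im (f x)).
Proof.
rewrite /cint; congr (_ +i* _).
  rewrite [RHS]Rintegral_mkcond; apply: eq_Rintegral => x _.
  by rewrite cReM/= mul0r subr0 patchE indicE; case: ifPn => _; rewrite ?mul1r ?mul0r.
rewrite [RHS]Rintegral_mkcond; apply: eq_Rintegral => x _.
by rewrite cImM/= mul0r addr0 patchE indicE; case: ifPn => _; rewrite ?mul1r ?mul0r.
Qed.

(** The convolution of the indicator of [c, d] with a Poisson kernel of width
    1 / (n + 1): a bounded function that tends to the indicator except at c and d. *)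
Definition atan_window c d (n : nat) y :=
  (atan (2 * pi * (d - y) * n.+1%:R) - atan (2 * pi * (c - y) * n.+1%:R)) / pi.

Lemma cint_ind_poisson c d n y : c < d ->
  cint mu (fun x => ind c d x *
    (2 * n.+1%:R^-1 / (n.+1%:R^-1 ^+ 2 + (2 * pi * x - 2 * pi * y) ^+ 2))%:C) =
  (atan_window c d n y)%:C.
Proof.
move=> cd; rewrite cint_ind; congr (_ +i* _); last by rewrite Rintegral_cst// mul0r.
rewrite /atan_window -[in RHS](invrK (n.+1%:R : R)) -integral_poisson// ?invr_gt0 ?ltr0n//.
by apply: eq_Rintegral => x _; rewrite /= -mulrBr.
Qed.

Lemma atan_window_le1 c d n y : `|atan_window c d n y| <= 1.
Proof.
have p0 : 0 < (pi : R) by exact: pi_gt0.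
rewrite /atan_window normrM (gtr0_norm (x := pi^-1)) ?invr_gt0// ler_pdivrMr// mul1r ler_norml.
have := atan_gtNpi2 (2 * pi * (d - y) * n.+1%:R); have := atan_ltpi2 (2 * pi * (d - y) * n.+1%:R).
have := atan_gtNpi2 (2 * pi * (c - y) * n.+1%:R); have := atan_ltpi2 (2 * pi * (c - y) * n.+1%:R).
by move: (pi : R) p0 (atan (2 * pi * (d - y) * _)) (atan (2 * pi * (c - y) * _)) => p p0 a b *; apply/andP; split; lra.
Qed.

Lemma measurable_atan_window c d n : measurable_fun [set: TR] (atan_window c d n).
Proof.
have H (k : R) : measurable_fun [set: TR] (fun y => atan (2 * pi * (k - y) * n.+1%:R)).
  apply: (@measurableT_comp _ _ _ TR TR TR (@atan R)).
    by apply: continuous_measurable_fun => x; exact: continuous_atan.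
  by apply: measurable_funM => //; apply: measurable_funM => //; apply: measurable_funB.
by apply: measurable_funM => //; apply: measurable_funB.
Qed.

Lemma cvg_atan_pos (t : R) : 0 < t -> atan (t * n.+1%:R) @[n --> \oo] --> pi / 2.
Proof.
move=> t0; have h : t * n.+1%:R @[n --> \oo] --> +oo.
  have h : n.+1%:R @[n --> \oo] --> (+oo : set_system R) by have := @cvgr_idn R; rewrite -cvg_shiftS.
  have := cvg_comp (fun n : nat => n.+1%:R : R) (fun y => t * y) h (gt0_cvgMry t0 cvg_id).
  exact.
have := cvg_comp (fun n : nat => t * n.+1%:R) (@atan R) h (@cvgy_atan R).
exact.
Qed.

Lemma cvg_atan_window c d y : c < d -> y != c -> y != d ->
  atan_window c d n y @[n --> \oo] --> (\1_(`[c, d]) y : R).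
Proof.
have p0 : pi != 0 :> R by rewrite gt_eqF// pi_gt0.
have P (t : R) : 0 < t -> atan (2 * pi * t * n.+1%:R) @[n --> \oo] --> pi / 2.
  by move=> t0; apply: cvg_atan_pos; rewrite !mulr_gt0// pi_gt0.
have N (t : R) : t < 0 -> atan (2 * pi * t * n.+1%:R) @[n --> \oo] --> - (pi / 2).
  move=> t0; have -> : (fun n : nat => atan (2 * pi * t * n.+1%:R)) = (fun n => - atan (2 * pi * (- t) * n.+1%:R)).
    by apply/funext => n; rewrite mulrN mulNr atanN opprK.
  by apply: cvgN; apply: P; rewrite oppr_gt0.
move=> cd yc yd; have [h1|h1|/eqP] := ltgtP y c; last by rewrite (negbTE yc).
  have -> : (\1_(`[c, d]) y : R) = (pi / 2 - pi / 2) / pi.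
    rewrite subrr mul0r indicE memNset// /= in_itv/= => /andP[].
    by rewrite leNgt h1.
  by apply: cvgM; [apply: cvgB; apply: P; rewrite subr_gt0// (lt_trans h1)|exact: cvg_cst].
have [h2|h2|/eqP] := ltgtP y d; last by rewrite (negbTE yd).
  have -> : (\1_(`[c, d]) y : R) = (pi / 2 - - (pi / 2)) / pi.
    by rewrite opprK -splitr divff// indicE mem_set//= in_itv/= !ltW.
  by apply: cvgM; [apply: cvgB; [apply: P; rewrite subr_gt0|apply: N; rewrite subr_lt0]|exact: cvg_cst].
have -> : (\1_(`[c, d]) y : R) = (- (pi / 2) - - (pi / 2)) / pi.
  rewrite subrr mul0r indicE memNset// /= in_itv/= => /andP[_].
  by rewrite leNgt h2.
by apply: cvgM; [apply: cvgB; apply: N; rewrite subr_lt0|exact: cvg_cst].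
Qed.

Lemma ae_neq c : {ae mu, forall x : R, x != c}.
Proof.
exists [set c]; split => //; first exact: lebesgue_measure_set1.
by move=> x /= /negP; rewrite negbK => /eqP.
Qed.

(** Insert the factor [abel (1 / (n + 1))] and move the transforms around with
    [osc_mul]: on one side it tends to 1, on the other side its transform turns the
    indicator into [atan_window], which tends to the indicator.  Integrating over
    an interval first removes any need for pointwise approximate identities. *)
Lemma inversion_test f c d : c < d -> cintegrable mu f -> cintegrable mu (osc (- (2 * pi)) f) ->
  cint mu (fun x => ind c d x * osc (2 * pi) (osc (- (2 * pi)) f) x) =
  cint mu (fun x => ind c d x * f x).
Proof.
move=> cd If IF; set F := osc _ f; set k := osc (2 * pi) (ind c d).
have Ii := cintegrable_ind c d.
have mE n : measurable_fun [set: TR] (abel (n.+1%:R^-1 : R)).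
  by apply: continuous_measurable_fun; exact: continuous_abel.
have IE n : cintegrable mu (fun w : R => (abel (n.+1%:R^-1) w)%:C).
  by split; [apply: integrable_abel|exact: integrable0].
have [IkF E1] := osc_mul (2 * pi) Ii IF.
have Ek n : cint mu (fun w => (abel n.+1%:R^-1 w)%:C * (k w * F w)) =
            cint mu (fun y => (atan_window c d n y)%:C * f y).
  have IEk : cintegrable mu (fun w => (abel n.+1%:R^-1 w)%:C * k w).
    exact: (cintegrableM_bounded (cmeas_osc (2 * pi) Ii) (fun x => nsq_osc (2 * pi) x Ii) (IE n)).
  have [_ E2] := osc_mul (- (2 * pi)) If IEk.
  transitivity (cint mu (fun w => F w * ((abel n.+1%:R^-1 w)%:C * k w))).
    by apply: eq_cint => w; rewrite [RHS]mulrC -mulrA.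
  rewrite E2; apply: eq_cint => y; rewrite [RHS]mulrC; congr (_ * _).
  rewrite /osc -(cint_ind_poisson n y cd).
  have Iy : cintegrable mu (fun w => (abel n.+1%:R^-1 w)%:C * expi (- (2 * pi) * y * w)).
    exact: cintegrableM_expi.
  have [_ E3] := osc_mul (2 * pi) Ii Iy.
  transitivity (cint mu (fun w => k w * ((abel n.+1%:R^-1 w)%:C * expi (- (2 * pi) * y * w)))).
    by apply: eq_cint => w; rewrite mulrAC mulrC.
  rewrite E3; apply: eq_cint => x; congr (_ * _).
  have e0 : 0 < n.+1%:R^-1 :> R by rewrite invr_gt0.
  have <- := abel_kernel (2 * pi * x - 2 * pi * y) e0.
  rewrite /osc.
  apply: eq_cint => w; rewrite -mulrA -expiD; congr (_ * expi _); ring.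
have E1n (n : nat) (x : R) : `|abel n.+1%:R^-1 x| <= 1.
  by rewrite ger0_norm; [apply: abel_le1; rewrite invr_ge0 ler0n|exact: abel_ge0].
have Ecvg : {ae mu, forall x : R, abel n.+1%:R^-1 x @[n --> \oo] --> (1 : R)}.
  apply: aeW => x; rewrite /abel.
  rewrite [X in _ --> X](_ : 1 = expR (- (0 * `|x|))); last by rewrite mul0r oppr0 expR0.
  apply: continuous_cvg; first exact: continuous_expR.
  by apply: cvgN; apply: cvgM; [exact: cvg_harmonic|exact: cvg_cst].
have [c1 c2] := @cvg_cint_scale (fun n => abel n.+1%:R^-1) (fun=> 1) (fun w => k w * F w)
  mE (measurable_cst _) E1n Ecvg IkF.
have Acvg : {ae mu, forall y : R, atan_window c d n y @[n --> \oo] --> (\1_(`[c, d]) y : R)}.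
  by apply: ae_mono (ae_and (ae_neq c) (ae_neq d)) => y [yc yd]; exact: cvg_atan_window.
have mI : measurable_fun [set: TR] (\1_(`[c, d]) : R -> R) by apply: measurable_indic.
have [d1 d2] := @cvg_cint_scale (atan_window c d) (\1_(`[c, d])) f
  (fun n => measurable_atan_window c d n) mI (fun n y => atan_window_le1 c d n y) Acvg If.
rewrite -E1 -/F -/k.
transitivity (cint mu (fun w => 1%:C * (k w * F w))); first by apply: eq_cint => w; rewrite mul1r.
apply/eqP; rewrite eq_complex; apply/andP; split; apply/eqP.
  rewrite (funext (fun n => congr1 (@complex.Re R) (Ek n))) in c1.
  exact: cvg_unique c1 d1.
rewrite (funext (fun n => congr1 (@complex.Im R) (Ek n))) in c2.
exact: cvg_unique c2 d2.
Qed.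

Lemma ae_eq_of_intervals f g : cintegrable mu f ->
  (forall c d, c < d -> cintegrable mu (fun x => ind c d x * g x)) ->
  (forall c d, c < d -> cint mu (fun x => ind c d x * f x) = cint mu (fun x => ind c d x * g x)) ->
  {ae mu, forall x, f x = g x}.
Proof.
move=> If Ig E.
have loc (u : R -> R) c d : mu.-integrable setT (fun x => (\1_(`[c, d]) x * u x)%:E) ->
    mu.-integrable `[c, d] (EFin \o u).
  move=> iu; rewrite integrable_mkcond//= (restrict_EFin u).
  apply: eq_integrable iu => // x _; rewrite /= patchE indicE; case: ifPn => _; by rewrite ?mul1r ?mul0r.
have IfR c d : mu.-integrable `[c, d] (fun x => (complex.Re (f x))%:E).
  exact: integrableS If.1.
have IfI c d : mu.-integrable `[c, d] (fun x => (complex.Im (f x))%:E).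
  exact: integrableS If.2.
have IgR c d : c < d -> mu.-integrable `[c, d] (fun x => (complex.Re (g x))%:E).
  move=> cd; apply: loc; have [+ _] := Ig _ _ cd.
  by apply: eq_integrable => // x _; rewrite cReM/= mul0r subr0.
have IgI c d : c < d -> mu.-integrable `[c, d] (fun x => (complex.Im (g x))%:E).
  move=> cd; apply: loc; have [_ +] := Ig _ _ cd.
  by apply: eq_integrable => // x _; rewrite cImM/= mul0r addr0.
have E' c d : c < d -> \int[mu]_(x in `[c, d]) (complex.Re (f x) - complex.Re (g x)) = 0 /\
    \int[mu]_(x in `[c, d]) (complex.Im (f x) - complex.Im (g x)) = 0.
  move=> cd; have := E _ _ cd; rewrite !cint_ind => -[e1 e2].
  have := (IfR c d, IgR c d cd, IfI c d, IgI c d cd) => -[[[a1 a2] a3] a4].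
  by split; rewrite RintegralB// ?e1 ?e2 subrr.
have ND n : (- n.+1%:R : R) < n.+1%:R by rewrite gtrN.
have IB (u v : R -> R) c d : mu.-integrable `[c, d] (EFin \o u) -> mu.-integrable `[c, d] (EFin \o v) ->
  mu.-integrable `[c, d] (EFin \o (fun x => u x - v x)).
  move=> iu iv; rewrite (_ : EFin \o _ = (EFin \o u) \- (EFin \o v))%E; first exact: integrableB.
  by apply/funext => x /=; rewrite EFinB.
have H1 := ae_foralln (fun n => null_on_subintervals (IB (fun x => complex.Re (f x)) (fun x => complex.Re (g x)) _ _ (IfR _ _) (IgR _ _ (ND n))) (fun c d _ cd _ => (E' c d cd).1)).
have H2 := ae_foralln (fun n => null_on_subintervals (IB (fun x => complex.Im (f x)) (fun x => complex.Im (g x)) _ _ (IfI _ _) (IgI _ _ (ND n))) (fun c d _ cd _ => (E' c d cd).2)).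
apply: ae_mono (ae_and H1 H2) => x [h1 h2].
have xn : - (Num.truncn `|x|).+1%:R <= x <= (Num.truncn `|x|).+1%:R.
  by rewrite -ler_norml ltW//; have /andP[] := truncn_itv (normr_ge0 x).
apply/eqP; rewrite eq_complex; apply/andP; split; rewrite -subr_eq0; apply/eqP; [exact: h1 xn|exact: h2 xn].
Qed.

Lemma nsq_ind_le1 c d x : nsq (ind c d x) <= 1 ^+ 2.
Proof. by rewrite expr1n nsqR indicE; case: (_ \in _); rewrite ?expr1n ?expr0n. Qed.

Lemma cintegrable_ind_bounded c d g (C : R) : cmeas g -> (forall x, nsq (g x) <= C ^+ 2) ->
  cintegrable mu (fun x => ind c d x * g x).
Proof. by move=> mg gC; apply: cintegrableM_bounded mg gC (cintegrable_ind c d). Qed.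

Lemma cintegrable_indM c d f : cintegrable mu f -> cintegrable mu (fun x => ind c d x * f x).
Proof.
move=> If; under eq_fun do rewrite mulrC.
exact: cintegrableM_bounded (cintegrable_meas (cintegrable_ind c d)) (nsq_ind_le1 c d) If.
Qed.

Lemma fourier_inversion f : cintegrable mu f -> cintegrable mu (osc (- (2 * pi)) f) ->
  {ae mu, forall x, f x = osc (2 * pi) (osc (- (2 * pi)) f) x}.
Proof.
move=> If IF; apply: ae_eq_of_intervals => // c d cd; last by rewrite inversion_test.
exact: cintegrable_ind_bounded (cmeas_osc (2 * pi) IF) (fun x => nsq_osc (2 * pi) x IF).
Qed.

Lemma ae_eq_cint f g : cmeas f -> cmeas g -> {ae mu, forall x, f x = g x} -> cint mu f = cint mu g.
Proof.
move=> [f1 f2] [g1 g2] fg; rewrite /cint /Rintegral; congr (fine _ +i* fine _).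
  apply: ae_eq_integral => //; [exact/measurable_EFinP|exact/measurable_EFinP|].
  by apply: ae_mono fg => x ->.
apply: ae_eq_integral => //; [exact/measurable_EFinP|exact/measurable_EFinP|].
by apply: ae_mono fg => x ->.
Qed.

(** Inversion for g, then the multiplication formula. *)
Lemma parseval f g : cintegrable mu f -> cintegrable mu g -> cintegrable mu (osc (- (2 * pi)) g) ->
  cip mu f g = cip mu (osc (- (2 * pi)) f) (osc (- (2 * pi)) g).
Proof.
move=> If Ig IG; rewrite /cip; set G := osc _ g.
have mg := cintegrable_meas Ig; have mf := cintegrable_meas If.
transitivity (cint mu (fun x => f x * osc (- (2 * pi)) (fun w => conjc (G w)) x)).
  apply: ae_eq_cint.
  - by apply: cmeasM => //; exact: cmeasJ.
  - by apply: cmeasM => //; apply: cmeas_osc; exact: cintegrableJ.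
  - by apply: ae_mono (fourier_inversion Ig IG) => x {1}->; rewrite conj_osc.
by have [_ <-] := osc_mul (- (2 * pi)) If (cintegrableJ IG).
Qed.

Lemma fourier_unique f : cintegrable mu f -> (forall w, osc (- (2 * pi)) f w = 0) ->
  {ae mu, forall x, f x = 0}.
Proof.
move=> If F0; have F0' : osc (- (2 * pi)) f = fun=> 0 by apply/funext.
have I0 : cintegrable mu (fun _ : R => 0 : R[i]) by split; exact: integrable0.
have IF : cintegrable mu (osc (- (2 * pi)) f) by rewrite F0'.
apply: ae_mono (fourier_inversion If IF) => x ->; rewrite F0' /osc.
transitivity (cint mu (fun _ : TR => 0 * (0 : R[i]))); first by apply: eq_cint => w; rewrite !mul0r.
by rewrite cintZ ?mul0r.
Qed.

End oscillatory.

(** * The Fourier transform on square-integrable functions *)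

Section fourier_transform.
Context {R : realType}.
Local Notation mu := (@lebesgue_measure R).
Local Notation TR := (measurableTypeR R).
Implicit Types (f g h k : R -> R[i]) (s e y : R).

Lemma inL1_cintegrable f : inL 1 f -> cintegrable mu f.
Proof.
move=> [mf fi].
have mN : measurable_fun [set: TR] (fun x => Normc.normc (f x)).
  rewrite (_ : (fun x => _) = (fun x => Num.sqrt (nsq (f x)))); last first.
    by apply/funext => x; rewrite /nsq; case: (f x).
  apply: measurableT_comp; last exact: measurable_nsq.
  by apply: continuous_measurable_fun; exact: sqrt_continuous.
apply: (@cintegrable_le _ TR R mu _ (fun x => Normc.normc (f x))) => //; last by move=> x; rewrite normc_sqr.
by apply/integrableP; split; [exact/measurable_EFinP|move: fi; rewrite /cLnorm Lnorm1].
Qed.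

Lemma cvg_cLnorm_small (F : nat -> R -> R[i]) (e : R) : 0 < e ->
  (fun n => cLnorm 2 (F n)) @ \oo --> (0 : \bar R)%E ->
  \forall n \near \oo, (cLnorm 2 (F n) < e%:E)%E.
Proof.
move=> e0 /fine_cvgP[ff /cvgr0Pnorm_lt/(_ _ e0) fl]; near=> n.
have fn : cLnorm 2 (F n) \is a fin_num by near: n.
rewrite -(fineK fn) lte_fin; apply: le_lt_trans (ler_norm _) _.
by near: n.
Unshelve. all: by end_near. Qed.

Lemma nsq_cint_lt f k (e : R) : 0 < e -> cmeas f -> (cLnorm 2 f < e%:E)%E -> sqint mu k ->
  nsq (cint mu (fun x => f x * k x)) <= e ^+ 2 * \int[mu]_x nsq (k x).
Proof.
move=> e0 mf fe lk.
have lf : sqint mu f by apply/inL2P; split => //; apply: lt_trans fe _; exact: ltry.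
have lk' : sqint mu (fun x => conjc (k x)).
  case: lk => mk ki; split; first exact: cmeasJ.
  by under eq_integral do rewrite nsqJ.
have -> : cint mu (fun x => f x * k x) = ip (L2space mu) f (fun x => conjc (k x)).
  by rewrite /= /cip; apply: eq_cint => x; rewrite conjcK.
have := @cauchy_schwarz R _ (L2space mu) f _ lf lk'; move=> /le_trans; apply.
have -> : nrm2 (L2space mu) (fun x => conjc (k x)) = \int[mu]_x nsq (k x).
  by rewrite L2_nrm2; apply: eq_Rintegral => x _; rewrite nsqJ.
apply: ler_wpM2r; first by apply: Rintegral_ge0 => x _; exact: nsq_ge0.
by rewrite -lee_fin L2_nrm2E// ltW// cLnorm_lt.
Qed.

Lemma cintB (u v : R -> R[i]) : cintegrable mu u -> cintegrable mu v ->
  cint mu (fun x => u x - v x) = cint mu u - cint mu v.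
Proof.
move=> Iu Iv; rewrite -[in RHS]mulN1r -cintZ// -cintD//; last exact: cintegrableZ.
by apply: eq_cint => x; rewrite mulN1r.
Qed.

Lemma sqintM f k : sqint mu f -> sqint mu k -> cintegrable mu (fun x => f x * k x).
Proof.
move=> lf [mk ki]; have lk' : sqint mu (fun x => conjc (k x)).
  by split; [exact: cmeasJ|under eq_integral do rewrite nsqJ].
by have := sqintJM lf lk'; congr cintegrable; apply/funext => x; rewrite conjcK.
Qed.

(** The multiplication formula survives the limit that defines the transform of a
    square-integrable function, since both sides are continuous in the mean. *)
Lemma fourier_pairing g gh k : sqint mu g -> is_fourier_transform g gh ->
  cintegrable mu k -> sqint mu k -> sqint mu (osc (- (2 * pi)) k) ->
  cint mu (fun w => gh w * k w) = cint mu (fun x => g x * osc (- (2 * pi)) k x).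
Proof.
move=> lg [/inL2P lgh [f [fL fg fgh]]] Ik lk lFk.
apply/eqP; rewrite -subr_eq0; apply/eqP; apply: nsq_eq0.
set z := _ - _.
pose C := 2 * (\int[mu]_x nsq (k x) + \int[mu]_x nsq (osc (- (2 * pi)) k x)).
have C0 : 0 <= C by rewrite mulr_ge0// addr_ge0//; apply: Rintegral_ge0 => x _; exact: nsq_ge0.
apply/eqP; rewrite eq_le nsq_ge0 andbT; apply/ler_addgt0Pl => eps eps0; rewrite addr0.
pose e := Num.sqrt (eps / (C + 1)).
have e0 : 0 < e by rewrite sqrtr_gt0 divr_gt0// ltr_pwDr.
have [n [nf ngh]] : exists n, (cLnorm 2 (f n \- g)%R < e%:E)%E /\ (cLnorm 2 (fourier_integral (f n) \- gh)%R < e%:E)%E.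
  have [N _ HN] := filterI (cvg_cLnorm_small e0 fg) (cvg_cLnorm_small e0 fgh).
  by exists N; apply: HN; exact: leqnn.
have [fn1 /inL2P fn2] := fL n; have If := inL1_cintegrable fn1.
have b1 := nsq_cint_lt e0 (cmeasB fn2.1 lg.1) nf lFk.
have mF : cmeas (fourier_integral (f n)) by rewrite fourier_oscE; exact: cmeas_osc.
have b2 := nsq_cint_lt e0 (cmeasB mF lgh.1) ngh lk.
have [IFk e1] := osc_mul (- (2 * pi)) If Ik.
have E1 : cint mu (fun x => (f n \- g) x * osc (- (2 * pi)) k x) =
  cint mu (fun x => f n x * osc (- (2 * pi)) k x) - cint mu (fun x => g x * osc (- (2 * pi)) k x).
  by rewrite -cintB; [apply: eq_cint => x; rewrite -mulrBl|exact: sqintM|exact: sqintM].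
have E2 : cint mu (fun x => (fourier_integral (f n) \- gh) x * k x) =
  cint mu (fun x => osc (- (2 * pi)) (f n) x * k x) - cint mu (fun x => gh x * k x).
  by rewrite -cintB; [apply: eq_cint => x; rewrite -mulrBl fourier_oscE|exact: IFk|exact: sqintM].
have -> : z = cint mu (fun x => (f n \- g) x * osc (- (2 * pi)) k x) -
              cint mu (fun x => (fourier_integral (f n) \- gh) x * k x).
  by rewrite E1 E2 e1 /z; ring.
apply: le_trans (nsqB _ _) _.
apply: (@le_trans _ _ (e ^+ 2 * C)).
  rewrite /C mulrCA -mulrDr ler_pM2l//; apply: le_trans (lerD b1 b2) _.
  by rewrite -mulrDr [X in _ <= _ * X]addrC.
rewrite /e sqr_sqrtr; last by rewrite divr_ge0 ?ltW// ltr_pwDr.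
rewrite mulrAC ler_pdivrMr ?ltr_pwDr// ler_pM2l// lerDl//.
Qed.

Lemma integrable_oneDsqrV : mu.-integrable setT (fun x : R => ((oneDsqr x)^-1)%:E).
Proof.
apply/integrableP; split.
  by apply/measurable_EFinP; apply: continuous_measurable_fun => x; exact: continuous_oneDsqrV.
under eq_integral do rewrite /= (@ger0_norm _ ((oneDsqr _)^-1)) ?invr_ge0 ?(le_trans _ (oneDsqr_ge1 _))//.
rewrite ge0_symfun_integralT; last first.
- by move=> x; rewrite /= /oneDsqr sqrrN.
- by move=> x; exact: continuous_oneDsqrV.
- by move=> x; rewrite invr_ge0 (le_trans _ (oneDsqr_ge1 x)).
by rewrite -set_itvcy integral0y_oneDsqr -EFinM ltry.
Qed.

(** The bound on the square is a multiple of 1 / (1 + (x + y)^2). *)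
Lemma sqint_poisson y : sqint mu (fun x : R => (2 / (1 + (2 * pi * (x + y)) ^+ 2))%:C).
Proof.
have mq (y' : R) : measurable_fun [set: TR] (fun x : R => 2 / (1 + (2 * pi * (x + y')) ^+ 2)).
  apply: continuous_measurable_fun => x; apply: cvgM; first exact: cvg_cst.
  apply: cvgV; first by rewrite gt_eqF// ltr_pwDl// sqr_ge0.
  apply: cvgD; first exact: cvg_cst.
  rewrite expr2; under eq_fun do rewrite expr2.
  by apply: cvgM; (apply: cvgM; [exact: cvg_cst|apply: cvgD; [exact: cvg_id|exact: cvg_cst]]).
have i0 : mu.-integrable setT (fun x : R => (4 * (oneDsqr x)^-1)%:E).
  by apply: (@integrableRZ _ TR R mu); exact: integrable_oneDsqrV.
apply: (@sqint_le _ TR R mu _ (fun x => 4 * (oneDsqr (x + y))^-1)).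
- exact: cmeasR.
- exact: (@integrable_shift _ (fun x => 4 * (oneDsqr x)^-1)).
- move=> x; rewrite nsqR expr_div_n -[in leLHS]natrX; apply: ler_wpM2l => //.
  have p1 : 1 <= 2 * pi :> R by have := @pi_ge2 R; lra.
  have o1 := oneDsqr_ge1 (x + y); have o0 : 0 < oneDsqr (x + y) by exact: lt_le_trans o1.
  have le1 : oneDsqr (x + y) <= 1 + (2 * pi * (x + y)) ^+ 2.
    by rewrite /oneDsqr lerD2l exprMn ler_peMl ?sqr_ge0// exprn_ege1.
  have l0 := lt_le_trans o0 le1.
  rewrite lef_pV2 ?posrE ?exprn_gt0//; apply: le_trans le1 _.
  by rewrite expr2 ler_peMl ?(ltW l0)// lerDl sqr_ge0.
Qed.

Lemma sqint_abel_expi y : sqint mu (fun w => (abel 1 w)%:C * expi (y * w)).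
Proof.
apply: (@sqint_le _ TR R mu _ (abel 1)); last first.
- move=> x; rewrite nsqM nsq_expi mulr1 nsqR expr2 ler_piMl ?abel_ge0//.
  by apply: abel_le1.
- exact: integrable_abel.
- apply: cmeasM; last exact: cmeas_expi_lin.
  by apply: cmeasR; apply: continuous_measurable_fun; exact: continuous_abel.
Qed.

Lemma osc_abel y x : osc (- (2 * pi)) (fun w => (abel 1 w)%:C * expi (y * w)) x =
  (2 / (1 + (2 * pi * (x + - (y / (2 * pi)))) ^+ 2))%:C.
Proof.
have p0 : 2 * pi != 0 :> R by rewrite gt_eqF// mulr_gt0// pi_gt0.
have := abel_kernel (y - 2 * pi * x) (@ltr01 R); rewrite expr1n mulr1.
have -> : (y - 2 * pi * x) ^+ 2 = (2 * pi * (x + - (y / (2 * pi)))) ^+ 2.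
  by rewrite mulrBr (mulrCA _ y) divff// mulr1 -sqrrN opprB.
move=> <-; apply: eq_cint => w; rewrite -mulrA -expiD; congr (_ * expi _); ring.
Qed.

(** Both gh and the Fourier integral have the same pairing with all functions
    [abel 1 w * expi (y * w)], by [fourier_pairing] and [osc_mul].  Hence the
    integrable function [D] has a vanishing transform, and D = 0. *)
Lemma fourier_transform_integrable g gh : cintegrable mu g -> sqint mu g -> is_fourier_transform g gh ->
  {ae mu, forall w, gh w = osc (- (2 * pi)) g w}.
Proof.
move=> Ig lg ft; have lgh : sqint mu gh by have [/inL2P] := ft.
set Fg := osc _ g.
pose D w := (abel 1 w)%:C * (gh w - Fg w).
have Ik y : cintegrable mu (fun w => (abel 1 w)%:C * expi (y * w)).
  exact: cintegrableM_expi cintegrable_abel.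
have IDg y := sqintM lgh (sqint_abel_expi y).
have key y : cintegrable mu (fun w => Fg w * ((abel 1 w)%:C * expi (y * w))) /\
   cint mu (fun w => gh w * ((abel 1 w)%:C * expi (y * w))) =
             cint mu (fun w => Fg w * ((abel 1 w)%:C * expi (y * w))).
  have [i1 e1] := osc_mul (- (2 * pi)) Ig (Ik y); split => //.
  rewrite e1; apply: fourier_pairing => //; first exact: sqint_abel_expi.
  by rewrite (funext (osc_abel y)); exact: sqint_poisson.
have ID : cintegrable mu D.
  have := cintegrableD (IDg 0) (cintegrableZ (-1) (key 0).1).
  by congr cintegrable; apply/funext => w; rewrite mul0r expi0 mulr1 mulN1r -mulrBl mulrC.
have D0 w : osc (- (2 * pi)) D w = 0.
  have [i1 /eqP] := key (- (2 * pi) * w); rewrite -subr_eq0 => /eqP <-.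
  rewrite -cintB; [|exact: IDg|exact: i1].
  by apply: eq_cint => x; rewrite /D; ring.
apply: ae_mono (fourier_unique ID D0) => w /eqP; rewrite mulf_eq0 subr_eq0 => /orP[|/eqP//].
by rewrite eq_complex /= gt_eqF// expR_gt0.
Qed.

End fourier_transform.

(** * Time-frequency shifts, second moments and smoothness *)

Section time_frequency.
Context {R : realType}.
Local Notation mu := (@lebesgue_measure R).
Local Notation TR := (measurableTypeR R).
Local Notation "'F'" := (osc (- (2 * pi))).
Implicit Types (f g h k : R -> R[i]) (s e y u eta : R).

Lemma sqint_tfshift u eta g : sqint mu g -> sqint mu (tfshift u eta g).
Proof.
move=> lg; apply: sqintM_bounded; [exact: cmeas_expi_lin| |exact: sqint_shift].
by move=> x; rewrite nsq_expi.
Qed.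

Lemma cintegrable_tfshift u eta g : cintegrable mu g -> cintegrable mu (tfshift u eta g).
Proof.
move=> Ig; rewrite /tfshift; under eq_fun do rewrite mulrC.
by apply: cintegrableM_expi; exact: cintegrable_shift.
Qed.

(** The Fourier transform rotates the time-frequency plane by a quarter turn. *)
Lemma osc_tfshift u eta g w : cintegrable mu g ->
  F (tfshift u eta g) w = expi (2 * pi * u * eta) * tfshift eta (- u) (F g) w.
Proof.
move=> Ig; rewrite /osc /tfshift.
have m : @cmeas _ TR R (fun x => expi (2 * pi * eta * x) * g (x - u) * expi (- (2 * pi) * w * x)).
  apply: cmeasM; last exact: cmeas_expi_lin.
  by apply: cmeasM; [exact: cmeas_expi_lin|apply: cmeas_shift; exact: cintegrable_meas Ig].
rewrite -(cint_shift u m) mulrA -cintZ; last exact: cintegrableM_expi.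
apply: eq_cint => x /=; rewrite addrK -expiD mulrAC -expiD mulrCA -!expiD [RHS]mulrC.
by congr (expi _ * _); ring.
Qed.

Lemma oscD f g w : cintegrable mu f -> cintegrable mu g ->
  F (fun x => f x + g x) w = F f w + F g w.
Proof.
move=> If Ig; rewrite /osc -cintD; [|exact: cintegrableM_expi|exact: cintegrableM_expi].
by apply: eq_cint => x; rewrite mulrDl.
Qed.

Lemma oscZ (a : R[i]) f w : cintegrable mu f -> F (fun x => a * f x) w = a * F f w.
Proof.
move=> If; rewrite /osc -cintZ; last exact: cintegrableM_expi.
by apply: eq_cint => x; rewrite mulrA.
Qed.

Lemma osc_sum (I : Type) (s : seq I) (f : I -> R -> R[i]) w : (forall i, cintegrable mu (f i)) ->
  F (fun x => \sum_(i <- s) f i x) w = \sum_(i <- s) F (f i) w.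
Proof.
move=> If; elim: s => [|i s IH].
  rewrite big_nil /osc -[RHS](mul0r (cint mu (fun _ : TR => 0))) -cintZ; last by split; exact: integrable0.
  by apply: eq_cint => x; rewrite big_nil !mul0r.
rewrite big_cons -IH -oscD//; last exact: (cint_sum s If).1.
by congr (osc _ _ w); apply/funext => x; rewrite big_cons.
Qed.

Lemma bounded_cintegrable_sqint f C : cintegrable mu f -> (forall x, nsq (f x) <= C ^+ 2) -> sqint mu f.
Proof.
move=> If fC; apply: (@sqint_le _ TR R mu _ (fun x => `|C| * cdom f x)).
- exact: cintegrable_meas If.
- exact: integrableRZ (integrable_cdom If).
- move=> x; have c0 : 0 <= cdom f x by rewrite addr_ge0.
  rewrite -(ler_pXn2r (ltn0Sn 1)) ?nnegrE ?nsq_ge0 ?mulr_ge0//.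
  rewrite exprMn real_normK ?num_real// expr2 ler_pM ?nsq_ge0//; exact: nsq_cdom.
Qed.

Lemma sqint_osc f : cintegrable mu f -> cintegrable mu (F f) -> sqint mu (F f).
Proof. by move=> If IF; apply: bounded_cintegrable_sqint IF (fun x => nsq_osc _ x If). Qed.

Lemma parseval_nsq f : cintegrable mu f -> cintegrable mu (F f) ->
  \int[mu]_x nsq (f x) = \int[mu]_x nsq (F f x).
Proof. by move=> If IF; have := parseval If If IF; rewrite !cipE => -[]. Qed.

(** With t = 1 + (x - alpha)^2 and N = |f|^2, the inequality 2 sqrt N <= 1 / t + t N
    bounds |f| by integrable functions. *)
Lemma moment_cintegrable f alpha : sqint mu f ->
  mu.-integrable setT (fun x => ((x - alpha) ^+ 2 * nsq (f x))%:E) -> cintegrable mu f.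
Proof.
move=> lf mf.
have io' := @integrable_shift _ (fun x => (oneDsqr x)^-1) (- alpha) integrable_oneDsqrV.
apply: (@cintegrable_le _ TR R mu _ (fun x => (oneDsqr (x - alpha))^-1 + (nsq (f x) + (x - alpha) ^+ 2 * nsq (f x)))).
- exact: lf.1.
- apply: (@integrableRD _ TR R mu (fun x => (oneDsqr (x - alpha))^-1)) => //.
  by apply: (@integrableRD _ TR R mu (fun x => nsq (f x))) => //; exact: sqint_integrable.
- move=> x; rewrite -{2}[nsq (f x)]mul1r -mulrDl -/(oneDsqr (x - alpha)).
  have := nsq_ge0 (f x); move: (nsq _) => N N0.
  have t0 : 0 < oneDsqr (x - alpha) by exact: lt_le_trans (oneDsqr_ge1 _).
  move: (oneDsqr _) t0 => t t0; have tn : t != 0 by rewrite gt_eqF.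
  have -> : (t^-1 + t * N) ^+ 2 = (t^-1 - t * N) ^+ 2 + 4 * N by field.
  by apply: ler_wpDl; [exact: sqr_ge0|lra].
Qed.

Lemma sqintB f g (z : R[i]) : sqint mu f -> sqint mu g -> sqint mu (fun x => f x - z * g x).
Proof.
move=> lf lg; have := sqintZD (- z) lg lf; congr sqint; apply/funext => x.
by rewrite addrC mulNr.
Qed.

(** On the Fourier side a translation by t multiplies by e^(- 2 pi i t w), which
    differs from the phase e^(- 2 pi i t beta) by at most 2 pi |t (w - beta)|. *)
Lemma shift_close g beta : cintegrable mu g -> cintegrable mu (F g) ->
  mu.-integrable setT (fun w => ((w - beta) ^+ 2 * nsq (F g w))%:E) ->
  forall t, exists2 z : R[i], nsq z = 1 &
  \int[mu]_x nsq (g (x - t) - z * g x) <=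
   (2 * pi) ^+ 2 * \int[mu]_w ((w - beta) ^+ 2 * nsq (F g w)) * t ^+ 2.
Proof.
move=> Ig IG im t; exists (expi (- (2 * pi * t * beta))); first exact: nsq_expi.
set z := expi _.
have Is : cintegrable mu (fun x => g (x - t)) by exact: cintegrable_shift.
have If : cintegrable mu (fun x => g (x - t) + (- z) * g x) by apply: cintegrableD => //; exact: cintegrableZ.
have EF w : F (fun x => g (x - t) + (- z) * g x) w = (expi (- (2 * pi * t) * w) - z) * F g w.
  rewrite oscD//; last exact: cintegrableZ.
  rewrite oscZ//; have -> : (fun x => g (x - t)) = tfshift t 0 g.
    by apply/funext => x; rewrite /tfshift mulr0 mul0r expi0 mul1r.
  rewrite osc_tfshift// mulr0 expi0 mul1r /tfshift subr0 mulrBl mulNr; congr (expi _ * _ - _); ring.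
have IFf : cintegrable mu (F (fun x => g (x - t) + (- z) * g x)).
  rewrite (funext EF); under eq_fun do rewrite mulrC.
  apply: (@cintegrableM_bounded _ _ _ 2) => //.
    by apply: cmeasB; [exact: cmeas_expi_lin|exact: cmeas_cst].
  by move=> w; apply: le_trans (nsqD _ _) _; rewrite nsqN !nsq_expi; lra.
have -> : \int[mu]_x nsq (g (x - t) - z * g x) = \int[mu]_x nsq (g (x - t) + (- z) * g x).
  by apply: eq_Rintegral => x _; rewrite mulNr.
rewrite parseval_nsq// -mulrA [X in _ <= _ * X]mulrC mulrA -exprMn -RintegralZl//.
apply: le_Rintegral => //.
- by apply: sqint_integrable; exact: sqint_osc.
- exact: (@integrableRZ _ TR R mu).
- move=> w _; rewrite EF nsqM mulrA; apply: ler_wpM2r; first exact: nsq_ge0.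
  have -> : expi (- (2 * pi * t) * w) - z = z * (expi (- (2 * pi * t) * (w - beta)) - 1).
    by rewrite /z mulrBr mulr1 -expiD; congr (expi _ - _); ring.
  rewrite nsqM nsq_expi mul1r; apply: le_trans (nsq_expi_sub1 _) _.
  move: (w - beta) (2 * pi * t) => A B; clear.
  by rewrite le_eqVlt; apply/orP; left; apply/eqP; ring.
Qed.

(** The translation of the transform is the transform of a modulation, to which
    the bound of [shift_close] applies on the original side. *)
Lemma shift_close_osc g alpha : cintegrable mu g -> cintegrable mu (F g) -> sqint mu g ->
  mu.-integrable setT (fun x => ((x - alpha) ^+ 2 * nsq (g x))%:E) ->
  forall t, exists2 z : R[i], nsq z = 1 &
  \int[mu]_w nsq (F g (w - t) - z * F g w) <=
   (2 * pi) ^+ 2 * \int[mu]_x ((x - alpha) ^+ 2 * nsq (g x)) * t ^+ 2.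
Proof.
move=> Ig IG lg im t; exists (expi (2 * pi * t * alpha)); first exact: nsq_expi.
set z := expi _.
pose f x := tfshift 0 t g x + (- z) * g x.
have Is := cintegrable_tfshift 0 t Ig.
have If : cintegrable mu f by apply: cintegrableD => //; exact: cintegrableZ.
have EF w : F f w = F g (w - t) - z * F g w.
  rewrite oscD//; last exact: cintegrableZ.
  rewrite oscZ// osc_tfshift// mulr0 mul0r expi0 mul1r /tfshift oppr0 mulr0 mul0r expi0 mul1r.
  by rewrite mulNr.
have IFf : cintegrable mu (F f).
  rewrite (funext EF); under eq_fun do rewrite -(mulNr z).
  by apply: cintegrableD; [exact: cintegrable_shift|exact: cintegrableZ].
have -> : \int[mu]_w nsq (F g (w - t) - z * F g w) = \int[mu]_w nsq (F f w).
  by apply: eq_Rintegral => w _; rewrite EF.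
rewrite -parseval_nsq// -mulrA [X in _ <= _ * X]mulrC mulrA -exprMn -RintegralZl//.
have Ef x : f x = (expi (2 * pi * t * x) - z) * g x.
  by rewrite /f /tfshift subr0 mulrBl mulNr.
apply: le_Rintegral => //.
- apply: sqint_integrable; rewrite (_ : f = fun x => tfshift 0 t g x - z * g x); last first.
    by apply/funext => x; rewrite /f mulNr.
  by apply: sqintB => //; exact: sqint_tfshift.
- exact: (@integrableRZ _ TR R mu).
- move=> x _; rewrite Ef nsqM mulrA; apply: ler_wpM2r; first exact: nsq_ge0.
  have -> : expi (2 * pi * t * x) - z = z * (expi (2 * pi * t * (x - alpha)) - 1).
    by rewrite /z mulrBr mulr1 -expiD; congr (expi _ - _); ring.
  by rewrite nsqM nsq_expi mul1r; apply: le_trans (nsq_expi_sub1 _) _; rewrite -exprMn.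
Qed.

End time_frequency.

(** * Integration over the cosets of a lattice *)

HB.instance Definition _ := isPointed.Build int 0%R.
HB.instance Definition _ := @isMeasurable.Build default_measure_display int
  discrete_measurable discrete_measurable0 discrete_measurableC discrete_measurableU.

Section counting_int.
Context {R : realType}.

Lemma measurable_from_int (d : measure_display) (T : measurableType d) (f : int -> T) : measurable_fun setT f.
Proof. by []. Qed.

Lemma counting_set1 (T : choiceType) (k : T) : @counting T R [set k] = 1%E.
Proof. by rewrite /counting asboolT// fset_set1 finmap.cardfs1. Qed.

(** Enumeration of the integers by naturals, with empty slots for the naturals that
    encode no integer; it gives countable unions over int. *)
Definition slot (n : nat) : set int := [set k | pickle k = n].

Lemma slot_pickle (k : int) : slot (pickle k) = [set k].
Proof. by apply/seteqP; split=> j /=; [exact: (pcan_inj pickleK)|move=> ->]. Qed.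

Lemma slot_cases n : slot n = set0 \/ exists k, slot n = [set k].
Proof.
have [->|/set0P[k kn]] := eqVneq (slot n) set0; [by left|right].
by exists k; rewrite -kn slot_pickle.
Qed.

Lemma slot_cover : \bigcup_n slot n = setT.
Proof. by apply/seteqP; split=> // k _; exists (pickle k). Qed.

Lemma slot_disjoint : trivIset setT slot.
Proof. by move=> m n _ _ [k [/= <- <-]]. Qed.

(** Sums over int are integrals for this measure, so that Fubini and the results on
    square-integrable functions apply to them. *)
Definition Zcount : set int -> \bar R := @counting int R.
HB.instance Definition _ := Measure.copy Zcount (@counting int R : {measure set int -> \bar R}).

Lemma Zcount_sigma_finite : sigma_finite [set: int] Zcount.
Proof.
exists slot; first by rewrite slot_cover.
move=> n; split => //; have [->|[k ->]] := slot_cases n.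
  by rewrite measure0.
by rewrite /Zcount counting_set1 ltry.
Qed.

HB.instance Definition _ := @Measure_isSigmaFinite.Build _ _ _ Zcount Zcount_sigma_finite.

Lemma Zcount_set1 k : Zcount [set k] = 1%E.
Proof. exact: counting_set1. Qed.

Lemma Zcount_shift (p : int) (A : set int) : measurable A ->
  pushforward Zcount (fun k => k + p) A = Zcount A.
Proof.
move=> _; rewrite /pushforward /= /Zcount /= /counting.
have E : (fun k => k + p) @^-1` A = (fun k => k - p) @` A.
  apply/seteqP; split=> k /=; first by move=> Ak; exists (k + p) => //; rewrite addrK.
  by move=> [j Aj <-]; rewrite subrK.
have inj : injective (fun k : int => k - p) by exact: addIr.
case: (pselect (finite_set A)) => fA.
  rewrite !asboolT//; last by rewrite E; exact: finite_image.
  by rewrite E fset_set_image// finmap.card_imfset.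
rewrite !asboolF// E => fi; apply: fA.
have := finite_image (fun k : int => k + p) fi; rewrite image_comp.
by rewrite (_ : _ \o _ = id) ?image_id//; apply/funext => k /=; rewrite subrK.
Qed.

Lemma integral_Zcount_shift (p : int) (f : int -> \bar R) :
  (\int[Zcount]_k f (k + p)%R = \int[Zcount]_k f k)%E.
Proof.
rewrite -(@integral_pushforward_measurable _ _ int int R (fun k : int => k + p) (measurable_from_int _) Zcount f)//.
apply: eq_measure_integral => //=.
by move=> mphi A mA _; exact: Zcount_shift.
Qed.

Lemma cint_Zcount_shift (p : int) (f : int -> R[i]) :
  cint Zcount (fun k => f (k + p)) = cint Zcount f.
Proof.
rewrite /cint /Rintegral.
rewrite (integral_Zcount_shift (p : int) (fun k => (complex.Re (f k))%:E)).
by rewrite (integral_Zcount_shift (p : int) (fun k => (complex.Im (f k))%:E)).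
Qed.

Lemma sqint_Zcount_shift (p : int) (f : int -> R[i]) : sqint Zcount f -> sqint Zcount (fun k => f (k + p)).
Proof.
by move=> [_ fi]; split=> //; rewrite (integral_Zcount_shift (p : int) (fun k => (nsq (f k))%:E)).
Qed.

End counting_int.

Section periodization.
Context {R : realType}.
Local Notation mu := (@lebesgue_measure R).
Local Notation TR := (measurableTypeR R).
Variables (P : R) (P0 : 0 < P).
Implicit Types (f g h : R -> R[i]) (s x : R) (k : int).

Local Notation I := (`[0%R, P[%classic).
Definition win : R -> R := \1_I.

Lemma win_ge0 x : 0 <= win x. Proof. by rewrite /win indicE. Qed.
Lemma measurable_win : measurable_fun [set: TR] win.
Proof. by apply: measurable_indic. Qed.

Lemma measurable_wrap : measurable_fun setT (fun z : TR * int => (z.1 + z.2%:~R * P)%R : TR).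
Proof.
apply: measurable_funD => //; apply: measurable_funM => //.
exact: (measurableT_comp (measurable_from_int (fun k : int => k%:~R : TR))).
Qed.

Lemma tile_cover : \bigcup_n (\bigcup_(k in slot n) `[k%:~R * P, (k + 1)%:~R * P[%classic) = [set: R].
Proof.
apply/seteqP; split=> // x _; exists (pickle (Num.floor (x / P))) => //.
exists (Num.floor (x / P)) => //=; rewrite in_itv/= -ler_pdivlMr// -ltr_pdivrMr//.
by rewrite ge_floor/= floorD1_gt.
Qed.

Lemma tile_inj x k l : x \in `[k%:~R * P, (k + 1)%:~R * P[ -> x \in `[l%:~R * P, (l + 1)%:~R * P[ -> k = l.
Proof.
rewrite !in_itv/= -!ler_pdivlMr// -!ltr_pdivrMr// => /andP[a b] /andP[c d].
move: (le_lt_trans a d) (le_lt_trans c b).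
by rewrite !ltr_int; lia.
Qed.

(** The line is the disjoint union of the translates of [0, P) by P Z. *)
Lemma integral_tiles (F : R -> \bar R) : measurable_fun [set: TR] F -> (forall x, 0 <= F x)%E ->
  (\int[mu]_x F x = \int[mu]_x \int[Zcount]_k ((win x)%:E * F (x + k%:~R * P)%R))%E.
Proof.
move=> mF F0.
pose G (n : nat) x := (\int[Zcount]_(k in slot n) ((win x)%:E * F (x + k%:~R * P)%R))%E.
have wF0 x k : (0 <= (win x)%:E * F (x + k%:~R * P)%R)%E by rewrite mule_ge0// lee_fin win_ge0.
have GE n : (exists k, slot n = [set k] /\ G n = fun x => ((win x)%:E * F (x + k%:~R * P)%R)%E) \/
            (slot n = set0 /\ G n = fun=> 0%E).
  have [e|[k e]] := slot_cases n; [right|left].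
    by split => //; apply/funext => x; rewrite /G e integral_set0.
  exists k; split => //; apply/funext => x; rewrite /G e.
  rewrite (eq_integral (cst ((win x)%:E * F (x + k%:~R * P)%R)))%E; last first.
    by move=> j; rewrite inE/= => ->.
  by rewrite integral_cst//= Zcount_set1 mule1.
have mwF k : measurable_fun [set: TR] (fun x => (win x)%:E * F (x + k%:~R * P)%R)%E.
  apply: emeasurable_funM; first by apply/measurable_EFinP; exact: measurable_win.
  exact: (measurableT_comp mF (measurable_shift _)).
have mG n : measurable_fun [set: TR] (G n).
  by have [[k [_ ->]]|[_ ->]] := GE n; [exact: mwF|exact: measurable_cst].
have G0 n x : (0 <= G n x)%E by apply: integral_ge0 => k _; exact: wF0.
transitivity (\int[mu]_x (\sum_(n <oo) G n x))%E; last first.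
  apply: eq_integral => x _; rewrite -slot_cover ge0_integral_bigcup//.
  exact: slot_disjoint.
rewrite integral_nneseries//.
rewrite -{1}tile_cover ge0_integral_bigcup//; last 3 first.
- move=> n; have [->|[k ->]] := slot_cases n; first by rewrite bigcup_set0.
  by rewrite bigcup_set1; exact: measurable_itv.
- by rewrite tile_cover.
- move=> m n _ _ [x [[k /= <- xk] [l /= <- xl]]].
  by rewrite (tile_inj (x := x) (k := k) (l := l)).
apply: eq_eseriesr => n _.
have [[k [-> ->]]|[-> ->]] := GE n; last by rewrite bigcup_set0 integral_set0 integral0.
rewrite bigcup_set1 integral_mkcond.
rewrite -(@integral_shift _ (k%:~R * P) (F \_ `[k%:~R * P, (k + 1)%:~R * P[)); last first.
  have mt : measurable (`[k%:~R * P, (k + 1)%:~R * P[%classic : set TR) by exact: measurable_itv.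
  by apply/(measurable_restrictT _ mt); exact: measurable_funS mF.
apply: eq_integral => x _; rewrite patchE /win indicE.
have -> : (x + k%:~R * P \in `[k%:~R * P, (k + 1)%:~R * P[%classic) = (x \in I).
  by apply/idP/idP; rewrite !inE/= !in_itv/= lerDr intrD mulrDl mul1r addrC ltrD2l.
by case: ifPn => _; rewrite ?mul1e ?mul0e.
Qed.

Lemma ae_shift (Q : R -> Prop) c : {ae mu, forall x, Q x} -> {ae mu, forall x, Q (x + c)}.
Proof.
move=> [A [mA A0 QA]]; exists ((fun x : R => x + c) @^-1` A); split.
- by have := measurable_shift c measurableT mA; rewrite setTI.
- by have := lebesgue_measure_shift c mA; rewrite A0.
- by move=> x /= nQ; exact: QA.
Qed.

Lemma ae_forall_int (Q : int -> R -> Prop) : (forall k, {ae mu, forall x, Q k x}) ->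
  {ae mu, forall x k, Q k x}.
Proof.
move=> aQ; have H n : {ae mu, forall x, forall k, unpickle n = Some k -> Q k x}.
  case E : (unpickle n) => [k|]; last by apply: aeW.
  by apply: ae_mono (aQ k) => x Qx _ [<-].
by have /ae_foralln := H; apply: ae_mono => x Qx k; apply: (Qx (pickle k)); rewrite pickleK.
Qed.

Lemma floor_win x : exists k, x + k%:~R * P \in `[0, P[.
Proof.
exists (- Num.floor (x / P)); rewrite in_itv/= rmorphN mulNr subr_ge0 ltrBlDr.
rewrite -ler_pdivlMr// -[X in _ < X + _]mul1r -mulrDl -ltr_pdivrMr// ge_floor/=.
by have := floorD1_gt (x / P); rewrite intrD addrC.
Qed.

Lemma winE x : x \in `[0, P[ -> win x = 1.
Proof. by move=> xI; rewrite /win indicE mem_set. Qed.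

Lemma win_out x : x \notin `[0, P[ -> win x = 0.
Proof. by move=> xI; rewrite /win indicE memNset//; exact/negP. Qed.

(** A property of the cosets x + P Z may be checked for x in one window. *)
Lemma ae_periodic (Q : R -> Prop) : (forall x k, Q (x + k%:~R * P) -> Q x) ->
  {ae mu, forall x, x \in `[0, P[ -> Q x} -> {ae mu, forall x, Q x}.
Proof.
move=> Qper aQ; have := ae_forall_int (fun k => ae_shift (k%:~R * P) aQ).
by apply: ae_mono => x Qx; have [k xk] := floor_win x; apply: Qper (Qx k xk).
Qed.

Section real_fiber.
Variables (u : R -> R) (iu : mu.-integrable setT (EFin \o u)).

Let mu_ : measurable_fun [set: TR] u.
Proof. by apply/measurable_EFinP; case/integrableP: iu. Qed.

Let W (z : TR * int) := win z.1 * u (z.1 + z.2%:~R * P).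

Let mW : measurable_fun setT W.
Proof.
apply: measurable_funM; first exact: (measurableT_comp measurable_win).
exact: (measurableT_comp mu_ measurable_wrap).
Qed.

(** Integrability on the line is integrability on window times int, which gives
    access to Fubini: almost every coset sum converges absolutely. *)
Lemma tiles_integrable : (mu \x Zcount)%E.-integrable setT (fun z : TR * int => (W z)%:E).
Proof.
apply/integrable12ltyP; first exact/measurable_EFinP.
have [_] := integrableP _ _ _ iu.
have ma : measurable_fun [set: TR] (fun x => `|(EFin \o u) x|)%E.
  by apply: measurableT_comp => //; exact/measurable_EFinP.
rewrite (integral_tiles ma (fun x => abse_ge0 _)); apply: le_lt_trans.
rewrite le_eqVlt; apply/orP; left; apply/eqP.
apply: eq_integral => x _; apply: eq_integral => k _.
by rewrite /W /= normrM EFinM (ger0_norm (win_ge0 _)).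
Qed.

Lemma integral_tiles_prod : (\int[(mu \x Zcount)%E]_z (W z)%:E = \int[mu]_x (u x)%:E)%E.
Proof.
have mW' : measurable_fun setT (fun z => (W z)%:E) by exact/measurable_EFinP.
have mu' : measurable_fun [set: TR] (fun z => (u z)%:E) by exact/measurable_EFinP.
rewrite [LHS]integralE [RHS]integralE.
rewrite (fubini_tonelli1 _ (measurable_funepos mW') (@funepos_ge0 _ _ _)).
rewrite (fubini_tonelli1 _ (measurable_funeneg mW') (@funeneg_ge0 _ _ _)).
rewrite (integral_tiles (measurable_funepos mu') (funepos_ge0 _)).
rewrite (integral_tiles (measurable_funeneg mu') (funeneg_ge0 _)).
congr (_ - _)%E; apply: eq_integral => x _; apply: eq_integral => k _.
  rewrite !funeposE /W; have [xI|xI] := boolP (x \in `[0, P[).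
    by rewrite winE// mul1e mul1r.
  by rewrite win_out// mul0e mul0r maxxx.
rewrite !funenegE /W; have [xI|xI] := boolP (x \in `[0, P[).
  by rewrite winE// mul1e mul1r.
by rewrite win_out// mul0e mul0r oppe0 maxxx.
Qed.

Lemma ae_fiber_integrable : {ae mu, forall x, Zcount.-integrable setT (fun k => (u (x + k%:~R * P))%:E)}.
Proof.
apply: ae_periodic.
  move=> x k /integrableP[m i]; apply/integrableP; split => //.
  rewrite -(integral_Zcount_shift k); under eq_integral do rewrite intrD mulrDl addrA addrAC.
  exact: i.
apply: ae_mono (ae_integrable1 tiles_integrable) => x + xI.
by rewrite /W /= winE//; under eq_fun do rewrite mul1r.
Qed.

Let winZ x : \int[Zcount]_k W (x, k) = win x * \int[Zcount]_k u (x + k%:~R * P).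
Proof.
rewrite /W /=; have [xI|xI] := boolP (x \in `[0, P[).
  by rewrite winE// mul1r; apply: eq_Rintegral => k _; rewrite mul1r.
rewrite win_out// mul0r; under eq_Rintegral do rewrite mul0r.
by rewrite /Rintegral integral0.
Qed.

Lemma integrable_fiber : mu.-integrable setT (fun x => (win x * \int[Zcount]_k u (x + k%:~R * P))%:E).
Proof.
have := integrable_fubini_F tiles_integrable; set F := fubini_F _ _ => iF.
apply: le_integrable iF => //.
  under eq_fun do rewrite -winZ; apply/measurable_EFinP.
  apply: (@measurableT_comp _ _ _ _ _ _ fine) => //.
  by have := measurable_fubini_F tiles_integrable.
move=> x _; rewrite -winZ -[\int[Zcount]_k _]/(fine (F x)).
by case: (F x) => [r| |] //=; rewrite normr0 leey.
Qed.

Lemma Rintegral_fiber : \int[mu]_x u x = \int[mu]_x (win x * \int[Zcount]_k u (x + k%:~R * P)).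
Proof.
rewrite {1}/Rintegral -integral_tiles_prod -(integral12_prod_meas1 tiles_integrable).
congr fine; apply: ae_eq_integral => //.
- by have := measurable_fubini_F tiles_integrable.
- by have /measurable_int := integrable_fiber.
- apply: ae_mono (ae_integrable1 tiles_integrable) => x ix _.
  by rewrite -winZ /Rintegral fineK//; exact: integrable_fin_num ix.
Qed.

End real_fiber.

End periodization.

(** * An integrable function on a circle is determined by its coefficients *)

Section geometric_limits.
Context {R : realType}.
Implicit Types (r y th : R).

(** (1 - t)^n (1 + t)^n <= 1, and (1 + t)^n >= 1 + n t. *)
Lemma expr1B_le (t : R) n : 0 <= t <= 1 -> (1 - t) ^+ n <= (1 + n%:R * t)^-1.
Proof.
move=> /andP[t0 t1]; have b : 1 + n%:R * t <= (1 + t) ^+ n.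
  elim: n => [|n IH]; first by rewrite mul0r addr0 expr0.
  rewrite exprS; apply: le_trans (ler_wpM2l _ IH); last by rewrite addr_ge0.
  have : 0 <= n%:R * t * t by rewrite !mulr_ge0.
  by rewrite -natr1; lra.
have p : 0 < 1 + n%:R * t by rewrite ltr_pwDl// mulr_ge0.
rewrite -[leRHS]mul1r ler_pdivlMr//.
apply: (@le_trans _ _ ((1 - t) ^+ n * (1 + t) ^+ n)).
  by apply: ler_wpM2l b; rewrite exprn_ge0// subr_ge0.
rewrite -exprMn; apply: exprn_ile1; first by rewrite mulr_ge0 ?subr_ge0 ?addr_ge0.
have : 0 <= t * t by rewrite mulr_ge0.
by lra.
Qed.

Lemma bernoulli_le (t : R) n : 0 <= t <= 1 -> 1 - n%:R * t <= (1 - t) ^+ n.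
Proof.
move=> /andP[t0 t1]; elim: n => [|n IH]; first by rewrite mul0r subr0 expr0.
rewrite exprS; apply: le_trans (ler_wpM2l _ IH); last by rewrite subr_ge0.
have : 0 <= n%:R * t * t by rewrite !mulr_ge0.
by rewrite -natr1; lra.
Qed.

(** With s = sqrt r, both s^n and n s^n are controlled by [expr1B_le]. *)
Lemma cvg_nat_geometric r : 0 <= r < 1 -> n%:R * r ^+ n @[n --> \oo] --> (0 : R).
Proof.
move=> /andP[r0 r1]; pose s := Num.sqrt r; pose d := 1 - s.
have s0 : 0 <= s by exact: sqrtr_ge0.
have s1 : s < 1 by rewrite -[X in _ < X]sqrtr1 ltr_sqrt.
have d0 : 0 < d by rewrite subr_gt0.
have d1 : d <= 1 by rewrite /d; lra.
have sb n : s ^+ n <= (1 + n%:R * d)^-1.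
  by have := @expr1B_le d n; rewrite /d subKr; apply; rewrite ltW//=; rewrite /d in d1.
have H n : n%:R * r ^+ n <= d^-1 ^+ 2 * n.+1%:R^-1.
  have -> : r ^+ n = s ^+ n * s ^+ n by rewrite -exprD addnn -muln2 mulnC exprM sqr_sqrtr.
  have q0 : 0 < 1 + n%:R * d by rewrite ltr_pwDl// mulr_ge0// ltW.
  have h1 : n%:R * s ^+ n <= d^-1.
    apply: (@le_trans _ _ (n%:R * (1 + n%:R * d)^-1)); first by rewrite ler_wpM2l.
    by rewrite ler_pdivrMr// -(ler_pM2l d0) mulrA divff ?gt_eqF// mul1r; lra.
  have h2 : s ^+ n <= d^-1 * n.+1%:R^-1.
    apply: le_trans (sb n) _; rewrite -invfM lef_pV2 ?posrE ?mulr_gt0//.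
    by rewrite -natr1; have : 0 <= n%:R :> R by []; nra.
  rewrite mulrA expr2 -[leRHS]mulrA; apply: ler_pM => //.
    by rewrite mulr_ge0 ?exprn_ge0.
  exact: exprn_ge0.
apply: (@squeeze_cvgr _ _ _ _ (fun=> 0) (fun n => d^-1 ^+ 2 * n.+1%:R^-1)).
- by apply: nearW => n; rewrite H andbT mulr_ge0// exprn_ge0.
- exact: cvg_cst.
- by rewrite -[X in _ --> X](mulr0 (d^-1 ^+ 2)); apply: cvgM; [exact: cvg_cst|exact: cvg_harmonic].
Qed.

(** An exponent N for which N y^n tends to 0 when y < th and to infinity when
    th <= y; n th^(-n), rounded to a natural number, has both properties. *)
Definition steep th n : nat := (n * (Num.truncn (th ^- n)).+1)%N.

(** Polynomials in y that tend to the indicator of {y < th}, boundedly on [0, 1]: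
    the upper bound is [expr1B_le] and the lower bound Bernoulli's inequality. *)
Lemma cvg_step th y : 0 < th <= 1 -> 0 <= y <= 1 ->
  (1 - y ^+ n) ^+ steep th n @[n --> \oo] --> (if y < th then 1 else 0 : R).
Proof.
move=> /andP[th0 th1] /andP[y0 y1].
have yn n : 0 <= y ^+ n <= 1 by rewrite exprn_ge0// exprn_ile1.
have tr n : th ^- n <= (Num.truncn (th ^- n)).+1%:R <= th ^- n + 1.
  have t0 : 0 <= th ^- n by rewrite invr_ge0 exprn_ge0// ltW.
  have /andP[a b] := truncn_itv t0.
  by rewrite ltW//= -natr1 lerD2r.
have a01 n : 0 <= (1 - y ^+ n) ^+ steep th n <= 1.
  by have /andP[a b] := yn n; rewrite exprn_ge0 ?exprn_ile1 ?subr_ge0//; lra.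
have [yt|ty] := ltP y th; last first.
  apply: (@squeeze_cvgr _ _ _ _ (fun=> 0) (fun n => n.+1%:R^-1)).
  - apply: nearW => n; have /andP[-> _] := a01 n => /=.
    apply: le_trans (expr1B_le _ (yn n)) _.
    have tn0 : 0 < th ^+ n by rewrite exprn_gt0.
    have /andP[tr1 _] := tr n.
    have h : n%:R <= (steep th n)%:R * y ^+ n.
      rewrite /steep natrM -mulrA ler_peMr//.
      apply: (@le_trans _ _ (th ^- n * th ^+ n)); first by rewrite mulVf// gt_eqF.
      by apply: ler_pM => //; [rewrite invr_ge0 ltW|exact: ltW|exact: lerXn2r (ltW th0) y0 ty].
    rewrite lef_pV2 ?posrE ?ltr0n//; first by rewrite -natr1 addrC lerD2l.
    by apply: lt_le_trans (_ : 1 + n%:R <= _); rewrite ?lerD2l// ltr_pwDl.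
  - exact: cvg_cst.
  - exact: cvg_harmonic.
have r01 : 0 <= y / th < 1 by rewrite divr_ge0 ?(ltW th0)//= ltr_pdivrMr// mul1r.
have y01 : 0 <= y < 1 by rewrite y0 (lt_le_trans yt).
apply: (@squeeze_cvgr _ _ _ _ (fun n => 1 - (n%:R * (y / th) ^+ n + n%:R * y ^+ n)) (fun=> 1)).
- apply: nearW => n; have /andP[_ ->] := a01 n; rewrite andbT.
  apply: le_trans (bernoulli_le _ (yn n)).
  rewrite lerD2l lerN2 /steep natrM -mulrA -mulrDr ler_wpM2l//.
  have /andP[_ tr2] := tr n; have /andP[yn0 _] := yn n.
  by apply: le_trans (ler_wpM2r yn0 tr2) _; rewrite mulrDl mul1r exprMn exprVn mulrC.
- rewrite -[X in _ --> X]subr0 -[X in _ - X]addr0; apply: cvgB; first exact: cvg_cst.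
  by apply: cvgD; apply: cvg_nat_geometric.
- exact: cvg_cst.
Qed.

End geometric_limits.

Lemma expi_2pi {R : realType} (k : int) : expi (2 * pi * k%:~R) = 1 :> R[i].
Proof.
have H (n : nat) : expi (2 * pi * n%:R) = 1 :> R[i].
  elim: n => [|n IH]; first by rewrite mulr0 expi0.
  have -> : 2 * pi * n.+1%:R = 2 * pi * n%:R + 2 * pi :> R by rewrite -natr1; move: (pi : R) => p; ring.
  rewrite expiD IH mul1r /expi.
  by rewrite mulr_natl cos2pi sin2pi.
case: k => n; first exact: H.
by rewrite NegzE rmorphN mulrN expiN H /= ; apply/eqP; rewrite eq_complex /= oppr0 !eqxx.
Qed.

Section complex_fiber.
Context {R : realType}.
Local Notation mu := (@lebesgue_measure R).
Local Notation TR := (measurableTypeR R).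
Variables (P : R) (P0 : 0 < P).
Implicit Types (f g h : R -> R[i]) (s x : R) (k : int).

Definition fiber f x : int -> R[i] := fun k => f (x + k%:~R * P).
Definition periodize f x : R[i] := cint Zcount (fiber f x).

Lemma fiberS f x k : fiber f (x + k%:~R * P) = fun j => fiber f x (j + k).
Proof. by apply/funext => j; rewrite /fiber intrD mulrDl addrA addrAC. Qed.

Lemma periodizeS f x k : periodize f (x + k%:~R * P) = periodize f x.
Proof. by rewrite /periodize fiberS cint_Zcount_shift. Qed.

Lemma fiber_shift f s x : fiber f (x + s) = fiber (fun y => f (y + s)) x.
Proof. by apply/funext => k; rewrite /fiber addrAC. Qed.

Lemma ae_fiber_cintegrable f : cintegrable mu f -> {ae mu, forall x, cintegrable Zcount (fiber f x)}.
Proof.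
move=> [f1 f2]; apply: ae_mono (ae_and (ae_fiber_integrable P0 f1) (ae_fiber_integrable P0 f2)).
by move=> x [].
Qed.

Lemma ae_fiber_sqint f : sqint mu f -> {ae mu, forall x, sqint Zcount (fiber f x)}.
Proof.
move=> lf; apply: ae_mono (ae_fiber_integrable P0 (sqint_integrable lf)) => x ix.
exact: integrable_sqint.
Qed.

Lemma cint_periodize f : cintegrable mu f ->
  cintegrable mu (fun x => (win P x)%:C * periodize f x) /\
  cint mu f = cint mu (fun x => (win P x)%:C * periodize f x).
Proof.
move=> [f1 f2]; have i1 := integrable_fiber P0 f1; have i2 := integrable_fiber P0 f2.
have RE (a : R) (z : R[i]) : complex.Re (a%:C * z) = a * complex.Re z by rewrite cReM/= mul0r subr0.
have IE (a : R) (z : R[i]) : complex.Im (a%:C * z) = a * complex.Im z by rewrite cImM/= mul0r addr0.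
split; first by split; [under eq_fun do rewrite RE|under eq_fun do rewrite IE].
rewrite /cint (Rintegral_fiber P0 f1) (Rintegral_fiber P0 f2).
by congr (_ +i* _); apply: eq_Rintegral => x _; rewrite ?RE ?IE.
Qed.

(** The windows [0, P) and [s, s + P) represent the same circle. *)
Lemma cint_periodize_shift f s : cintegrable mu f ->
  cint mu f = cint mu (fun x => (win P (x - s))%:C * periodize f x).
Proof.
move=> If; have If' := cintegrable_shift s If.
have [Ip E] := cint_periodize If'.
rewrite -(cint_shift s (cintegrable_meas If)) E.
rewrite -(cint_shift (- s) (cintegrable_meas Ip)).
apply: eq_cint => x; congr (_ * _).
by rewrite /periodize -fiber_shift subrK.
Qed.

Lemma periodizeM f (p : R -> R) x : (forall y k, p (y + k%:~R * P) = p y) -> 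
  cintegrable Zcount (fiber f x) ->
  periodize (fun y => (p y)%:C * f y) x = (p x)%:C * periodize f x.
Proof.
by move=> pper If; rewrite /periodize -cintZ//; apply: eq_cint => k; rewrite /fiber pper.
Qed.

Local Notation om := (2 * pi / P).

(** All the Fourier coefficients of the periodization of f vanish, expressed on
    the line. *)
Definition no_coef f := cintegrable mu f /\
  forall n : int, cint mu (fun x => f x * expi (om * n%:~R * x)) = 0.

(** sin^2 (pi (x - m) / P): a trigonometric polynomial of degree 1 with values in
    [0, 1] whose sublevel sets are the arcs centered at m. *)
Definition bump m x : R := (1 - cos (om * (x - m))) / 2.

Lemma bump_expi m x : (bump m x)%:C =
  (1 / 2)%:C + (- (1 / 4)%:C * expi (- (om * m))) * expi (om * x) + (- (1 / 4)%:C * expi (om * m)) * expi (- (om * x)).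
Proof.
have -> : bump m x = (1 - (cos (om * x) * cos (om * m) + sin (om * x) * sin (om * m))) / 2.
  by rewrite /bump mulrBr cosB.
rewrite !expiN /expi; move: (cos _) (sin _) (cos _) (sin _) => a b c d.
by apply/eqP; rewrite eq_complex /=; apply/andP; split; apply/eqP; field.
Qed.

Lemma no_coefB f g : no_coef f -> no_coef g -> no_coef (fun x => f x - g x).
Proof.
move=> [If Zf] [Ig Zg]; split.
  have := cintegrableD If (cintegrableZ (-1) Ig); congr cintegrable.
  by apply/funext => x; rewrite mulN1r.
move=> n; transitivity (cint mu (fun x => f x * expi (om * n%:~R * x) - g x * expi (om * n%:~R * x))).
  by apply: eq_cint => x; rewrite mulrBl.
by rewrite cintB ?Zf ?Zg ?subrr//; exact: cintegrableM_expi.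
Qed.

Lemma measurable_bump m : measurable_fun [set: TR] (bump m).
Proof.
apply: measurable_funM => //; apply: measurable_funB => //.
apply: (@measurableT_comp _ _ _ TR TR TR (@cos R)).
  by apply: continuous_measurable_fun => x; exact: continuous_cos.
by apply: measurable_funM => //; apply: measurable_funB.
Qed.

Lemma bump01 m x : 0 <= bump m x <= 1.
Proof.
rewrite /bump; have := cos_geN1 (om * (x - m)); have := cos_le1 (om * (x - m)).
by move: (cos _) => c *; apply/andP; split; lra.
Qed.

Lemma cintegrable_scale f (p : R -> R) : measurable_fun [set: TR] p -> (forall x, `|p x| <= 1) ->
  cintegrable mu f -> cintegrable mu (fun x => (p x)%:C * f x).
Proof.
move=> mp p1 If; under eq_fun do rewrite mulrC.
have p1' x : nsq (p x)%:C <= 1 ^+ 2.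
  by rewrite nsqR expr1n -(real_normK (num_real (p x))) exprn_ile1.
exact: (cintegrableM_bounded (cmeasR mp) p1' If).
Qed.

(** Multiplying by a trigonometric polynomial of degree 1 combines neighbouring
    coefficients. *)
Lemma no_coef_bump m f : no_coef f -> no_coef (fun x => (bump m x)%:C * f x).
Proof.
move=> [If Zf]; split.
  apply: cintegrable_scale => //; first exact: measurable_bump.
  by move=> x; have /andP[b0 b1] := bump01 m x; rewrite ger0_norm.
move=> n; have Ie (j : int) := cintegrableM_expi (om * j%:~R) If.
pose A : R[i] := (1 / 2)%:C; pose B : R[i] := - (1 / 4)%:C * expi (- (om * m)); pose C : R[i] := - (1 / 4)%:C * expi (om * m).
transitivity (cint mu (fun x => A * (f x * expi (om * n%:~R * x)) +
   B * (f x * expi (om * (n + 1)%:~R * x)) + C * (f x * expi (om * (n - 1)%:~R * x)))).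
  apply: eq_cint => x; rewrite bump_expi -/A -/B -/C.
  have -> : om * (n + 1)%:~R * x = om * n%:~R * x + om * x by rewrite intrD; ring.
  have -> : om * (n - 1)%:~R * x = om * n%:~R * x + - (om * x) by rewrite rmorphB/=; ring.
  rewrite !expiD; ring.
rewrite !cintD ?cintZ ?Zf ?mulr0 ?addr0//; try exact: Ie; try exact: (cintegrableZ _ (Ie _)).
by apply: cintegrableD; exact: (cintegrableZ _ (Ie _)).
Qed.

Lemma no_coef_step m n N f : no_coef f -> no_coef (fun x => ((1 - bump m x ^+ n) ^+ N)%:C * f x).
Proof.
have step1 g : no_coef g -> no_coef (fun x => ((1 - bump m x ^+ n))%:C * g x).
  move=> Zg; have : no_coef (fun x => (bump m x ^+ n)%:C * g x).
    elim: n => [|j IH]; first by under eq_fun do rewrite expr0 mul1r.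
    by under eq_fun do rewrite exprS rmorphM/= -mulrA; exact: no_coef_bump.
  move=> /(no_coefB Zg); congr no_coef; apply/funext => x.
  by rewrite rmorphB/= mulrBl mul1r.
move=> Zf; elim: N => [|j IH]; first by under eq_fun do rewrite expr0 mul1r.
by under eq_fun do rewrite exprS rmorphM/= -mulrA; exact: step1.
Qed.

(** The indicator of an arc is a bounded limit of the trigonometric polynomials
    (1 - bump^n)^N of [cvg_step]. *)
Lemma no_coef_arc m th f : 0 < th <= 1 -> no_coef f ->
  cint mu (fun x => (if bump m x < th then 1 else 0)%:C * f x) = 0.
Proof.
move=> th01 Zf; have [If _] := Zf.
have mp n N : measurable_fun [set: TR] (fun x => (1 - bump m x ^+ n) ^+ N).
  by apply: measurable_funX; apply: measurable_funB => //; apply: measurable_funX; exact: measurable_bump.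
have mi : measurable_fun [set: TR] (fun x => if bump m x < th then 1 else 0 : R).
  apply: measurable_fun_if => //.
  by apply: measurable_fun_ltr => //; exact: measurable_bump.
have le1 n x : `|(1 - bump m x ^+ n) ^+ steep th n| <= 1.
  have /andP[b0 b1] := bump01 m x.
  have c0 : 0 <= bump m x ^+ n by rewrite exprn_ge0.
  have c1 : bump m x ^+ n <= 1 by rewrite exprn_ile1.
  by rewrite ger0_norm ?exprn_ge0 ?exprn_ile1 ?subr_ge0//; lra.
have cv : {ae mu, forall x, (1 - bump m x ^+ n) ^+ steep th n @[n --> \oo] --> (if bump m x < th then 1 else 0 : R)}.
  by apply: aeW => x; apply: cvg_step => //; exact: bump01.
have [c1 c2] := cvg_cint_scale (fun n => mp n (steep th n)) mi le1 cv If.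
have E n : cint mu (fun x => ((1 - bump m x ^+ n) ^+ steep th n)%:C * f x) = 0.
  have [_ /(_ 0)] := no_coef_step m n (steep th n) Zf.
  by rewrite /=; under eq_cint do rewrite mulr0 mul0r expi0 mulr1.
apply/eqP; rewrite eq_complex; apply/andP; split; apply/eqP.
  rewrite (funext (fun n => congr1 (@complex.Re R) (E n))) in c1.
  by have := cvg_unique _ c1 (cvg_cst 0); apply.
rewrite (funext (fun n => congr1 (@complex.Im R) (E n))) in c2.
by have := cvg_unique _ c2 (cvg_cst 0); apply.
Qed.

Lemma bump_arc c d x : c < d -> d - c <= P ->
  win P (x - ((c + d) / 2 - P / 2)) * (if bump ((c + d) / 2) x < bump 0 ((d - c) / 2) then 1 else 0)
  = \1_(`]c, d[) x.
Proof.
move=> cd dcP; set m := (c + d) / 2; set h := (d - c) / 2.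
have h0 : 0 < h by rewrite /h; lra.
have om0 : 0 < om by rewrite divr_gt0// mulr_gt0// pi_gt0.
have omP (y : R) : y <= P / 2 -> om * y <= pi.
  move=> yP; apply: le_trans (ler_wpM2l (ltW om0) yP) _.
  by rewrite mulrCA -mulrA (mulrC 2) mulrA -!mulrA; rewrite le_eqVlt; apply/orP; left; apply/eqP;
     move: (pi : R) => p; field; rewrite gt_eqF.
have [xw|xw] := boolP (x - (m - P / 2) \in `[0, P[); last first.
  rewrite win_out// mul0r indicE memNset//= in_itv/= => /andP[cx xd]; apply/negP : xw.
  by move: cx xd; rewrite in_itv/= /m /h => cx xd; apply/negPn/andP; split; lra.
have xm : `|x - m| <= P / 2.
  by move: xw; rewrite in_itv/= => /andP[a b]; rewrite ler_norml; apply/andP; split; lra.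
rewrite winE// mul1r.
have E : (bump m x < bump 0 h) = (`|x - m| < h).
  rewrite /bump subr0 ltr_pM2r ?invr_gt0// ltrD2l ltrN2.
  have -> : cos (om * (x - m)) = cos (om * `|x - m|).
    by have [k|k] := leP 0 (x - m); rewrite ?(ger0_norm k)// (ltr0_norm k) mulrN cosN.
  rewrite ltr_cos ?in_itv/= ?ltr_pM2l//.
    by rewrite mulr_ge0 ?(ltW om0)//= omP.
  by rewrite mulr_ge0 ?(ltW om0) ?(ltW h0)//= omP// /h ler_pM2r// ?invr_gt0.
rewrite E indicE mem_setE in_itv /= ltr_norml.
have -> : (- h < x - m < h) = (c < x < d) by apply/idP/idP => /andP[a b]; apply/andP; move: a b; rewrite /h /m => a b; split; lra.
by case: (c < x < d).
Qed.

Lemma cmeas_periodize f : cintegrable mu f ->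
  cmeas (fun x => (win P x)%:C * periodize f x).
Proof. by move=> If; have [/cintegrable_meas] := cint_periodize If. Qed.

Lemma cint_periodize_arc f c d : no_coef f -> c < d -> d - c <= P ->
  cint mu (fun x => (\1_(`]c, d[) x)%:C * periodize f x) = 0.
Proof.
move=> Zf cd dcP; have [If _] := Zf.
pose m := (c + d) / 2; pose th := bump 0 ((d - c) / 2); pose s := m - P / 2.
pose q x : R := if bump m x < th then 1 else 0.
have th01 : 0 < th <= 1.
  have /andP[_ ->] := bump01 0 ((d - c) / 2); rewrite andbT /th /bump subr0 divr_gt0// subr_gt0.
  have om0 : 0 < om by rewrite divr_gt0// mulr_gt0// pi_gt0.
  have h0 : 0 < (d - c) / 2 by lra.
  have le_pi : om * ((d - c) / 2) <= pi.
    apply: (@le_trans _ _ (om * (P / 2))); first by rewrite ler_pM2l// ler_pM2r// invr_gt0.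
    by move: (pi : R) => p; rewrite le_eqVlt; apply/orP; left; apply/eqP; field; rewrite gt_eqF.
  have p0 : 0 < om * ((d - c) / 2) by rewrite mulr_gt0.
  rewrite -[X in _ < X](@cos0 R) ltr_cos ?in_itv/= ?lexx ?pi_ge0//.
  by rewrite ltW.
have mq : measurable_fun [set: TR] q.
  apply: measurable_fun_if => //.
  by apply: measurable_fun_ltr => //; exact: measurable_bump.
have q1 x : `|q x| <= 1 by rewrite /q; case: ifP => _; rewrite ?normr1 ?normr0.
have Iq := cintegrable_scale mq q1 If.
have := no_coef_arc m th01 Zf; rewrite -/q (cint_periodize_shift s Iq) => <-.
have om_per y k : bump m (y + k%:~R * P) = bump m y.
  rewrite /bump; congr ((1 - _) / _).
  have -> : om * (y + k%:~R * P - m) = om * (y - m) + 2 * pi * k%:~R.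
    by move: (pi : R) => p; field; rewrite gt_eqF.
  have := congr1 (@complex.Re R) (expiD (om * (y - m)) (2 * pi * k%:~R)).
  by rewrite expi_2pi mulr1.
have Iw : cintegrable mu (fun x => (win P (x - s))%:C * periodize f x).
  have [J _] := cint_periodize (cintegrable_shift s If).
  have := cintegrable_shift (- s) J; congr cintegrable; apply/funext => x.
  by rewrite /periodize -fiber_shift subrK.
have Iqw : cintegrable mu (fun x => (win P (x - s))%:C * periodize (fun y => (q y)%:C * f y) x).
  have [J _] := cint_periodize (cintegrable_shift s Iq).
  have := cintegrable_shift (- s) J; congr cintegrable; apply/funext => x.
  by rewrite /periodize -(fiber_shift (fun y => (q y)%:C * f y)) subrK.
have E x : (\1_(`]c, d[) x)%:C * periodize f x = (q x)%:C * ((win P (x - s))%:C * periodize f x).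
  by rewrite -(bump_arc x cd dcP) rmorphM /= -mulrA mulrCA.
under eq_cint do rewrite E.
apply: ae_eq_cint.
- exact: cintegrable_meas (cintegrable_scale mq q1 Iw).
- exact: cintegrable_meas Iqw.
- apply: ae_mono (ae_fiber_cintegrable If) => x ifx.
  rewrite periodizeM//; first by rewrite mulrCA.
  by move=> y k; rewrite /q om_per.
Qed.

(** The integral of the periodization over every arc vanishes, so the periodization
    is zero; a general interval is cut to the window [0, P). *)
Lemma periodize_eq0 f : no_coef f -> {ae mu, forall x, periodize f x = 0}.
Proof.
move=> Zf; have [If _] := Zf; have [Ip _] := cint_periodize If.
apply: (ae_periodic P0); first by move=> x k; rewrite periodizeS.
have I0 : cintegrable mu (fun _ : R => 0 : R[i]) by split; exact: integrable0.
have : {ae mu, forall x, 0 = (win P x)%:C * periodize f x}.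
  apply: (ae_eq_of_intervals I0) => c d cd; first exact: cintegrable_indM.
  pose c' := Num.max c 0; pose d' := Num.min d P.
  transitivity (0 : R[i]).
    transitivity (cint mu (fun _ : TR => 0 * (0 : R[i]))); first by apply: eq_cint => x; rewrite mulr0 mul0r.
    by rewrite cintZ ?mul0r.
  have mg := cmeas_periodize If.
  transitivity (cint mu (fun x => (\1_(`]c', d'[) x)%:C * ((win P x)%:C * periodize f x))).
    have [cd'|dc'] := ltP c' d'; last first.
      apply/esym; transitivity (cint mu (fun _ : TR => 0 * (0 : R[i]))); last by rewrite cintZ ?mul0r.
      by apply: eq_cint => x; rewrite set_itv_ge ?indic0 ?mul0r//= bnd_simp -leNgt.
    rewrite -(cint_periodize_arc Zf cd'); last first.
      by rewrite lerBlDl; apply: (@le_trans _ _ P); rewrite /d' /c' ?ge_min ?lexx ?orbT// lerDr le_max lexx orbT.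
    apply: eq_cint => x; have [xI|xI] := boolP (x \in `]c', d'[); last first.
      by rewrite indicE memNset ?mul0r//; exact/negP.
    rewrite winE ?mul1r//; move: xI; rewrite !in_itv/= gt_max lt_min => /andP[/andP[_ a] /andP[_ b]].
    by rewrite ltW.
  have mi : @cmeas _ TR R (fun x => (\1_(`]c', d'[) x)%:C) by apply: cmeasR; apply: measurable_indic.
  apply: ae_eq_cint.
  - by apply: cmeasM.
  - by apply: cmeasM => //; exact: cintegrable_meas (cintegrable_ind c d).
  - apply: ae_mono (ae_and (ae_neq c') (ae_neq d')) => x [xc xd].
    have [xI|xI] := boolP (x \in `[0, P[); last by rewrite win_out// mul0r !mulr0.
    congr (_%:C * _); rewrite !indicE; congr (_%:R); congr (nat_of_bool _).
    move: xI; rewrite !mem_setE !in_itv/= => /andP[x0 xP].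
    have -> : (c' < x) = (c <= x) by rewrite lt_neqAle eq_sym xc ge_max x0 andbT.
    by have -> : (x < d') = (x <= d) by rewrite lt_neqAle xd le_min (ltW xP) andbT.
apply: ae_mono => x /[swap] xI; rewrite winE// mul1r => <- //.
Qed.

End complex_fiber.

Section constant_periodization.
Context {R : realType}.
Local Notation mu := (@lebesgue_measure R).
Local Notation TR := (measurableTypeR R).
Variables (P : R) (P0 : 0 < P).
Implicit Types (f g h : R -> R[i]) (s x : R) (k n : int).
Local Notation om := (2 * pi / P).

Lemma Zcount_win x : Zcount.-integrable setT (fun k => (win P (x + k%:~R * P))%:E) /\
  \int[Zcount]_k win P (x + k%:~R * P) = 1.
Proof.
have [k0 k0P] := floor_win P0 x.
have E k : win P (x + k%:~R * P) = \1_[set k0] k.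
  rewrite [RHS]indicE; case: (eqVneq k k0) => [->|kk0].
    by rewrite winE// mem_set.
  rewrite memNset; last by move=> /= e; rewrite e eqxx in kk0.
  rewrite win_out//; apply: contra kk0 => kP; apply/eqP.
  move: k0P kP; rewrite !in_itv/= => /andP[a b] /andP[c d].
  have h1 : (k - k0)%:~R * P < P by rewrite rmorphB/= mulrBl; lra.
  have h2 : (k0 - k)%:~R * P < P by rewrite rmorphB/= mulrBl; lra.
  have cancel (z : int) : z%:~R * P < P -> (z < 1)%R.
    by rewrite -[X in _ < X -> _]mul1r ltr_pM2r// -[1]/(1%:~R) ltr_int.
  by move: (cancel _ h1) (cancel _ h2); lia.
have I1 : (\int[@Zcount R]_k (\1_[set k0] k)%:E = 1)%E.
  by rewrite integral_indic// setIT; exact: Zcount_set1.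
split.
  under eq_fun do rewrite E.
  apply/integrableP; split => //.
  rewrite (eq_integral (fun k => (\1_[set k0] k)%:E)); last by move=> k _; rewrite gee0_abs// lee_fin.
  by rewrite I1 ltry.
under eq_Rintegral do rewrite E.
by rewrite /Rintegral I1.
Qed.

Lemma periodize_win (p : R -> R[i]) x : (forall y k, p (y + k%:~R * P) = p y) ->
  periodize P (fun y => (win P y)%:C * p y) x = p x.
Proof.
move=> pper; have [iw w1] := Zcount_win x.
have Iw : cintegrable Zcount (fun k => (win P (x + k%:~R * P))%:C).
  by split => //; exact: integrable0.
rewrite /periodize -[RHS]mulr1.
have <- : cint Zcount (fun k => (win P (x + k%:~R * P))%:C) = 1.
  rewrite /cint /= w1; congr (_ +i* _).
  by rewrite /Rintegral integral0.
by rewrite -cintZ//; apply: eq_cint => k; rewrite /fiber pper mulrC.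
Qed.

Lemma cintegrable_win : cintegrable mu (fun x => (win P x)%:C).
Proof. by split; [apply: integrable_indic_itv|exact: integrable0]. Qed.

Lemma cint_win : cint mu (fun x => (win P x)%:C) = P%:C.
Proof.
rewrite /cint; congr (_ +i* _); last by rewrite /Rintegral integral0.
rewrite /Rintegral /= integral_indic// setIT.
suff h : mu `[0, P[ = P%:E by exact: (congr1 fine h).
by rewrite lebesgue_measure_itv/= lte_fin P0 -EFinD subr0.
Qed.

Lemma expi_per n (y : R) k : expi (om * n%:~R * (y + k%:~R * P)) = expi (om * n%:~R * y) :> R[i].
Proof.
have -> : om * n%:~R * (y + k%:~R * P) = om * n%:~R * y + 2 * pi * (n * k)%:~R.
  by rewrite intrM; move: (pi : R) => p; field; rewrite gt_eqF.
by rewrite expiD expi_2pi mulr1.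
Qed.

(** For n <> 0, moving the window by half a period of the exponential changes the
    sign of the integral without changing its value. *)
Lemma cint_win_expi n : cint mu (fun x => (win P x)%:C * expi (om * n%:~R * x)) = (n == 0)%:R * P%:C.
Proof.
case: (eqVneq n 0) => [->|n0].
  by rewrite mul1r -cint_win; apply: eq_cint => x; rewrite mulr0 mul0r expi0 mulr1.
rewrite mul0r; set F := (fun x => _).
have IF : cintegrable mu F by apply: cintegrableM_expi; exact: cintegrable_win.
(* Half a period of the exponential. *)
pose s := P / (2 * n%:~R).
have E : cint mu F = expi (om * n%:~R * s) * cint mu F.
  rewrite {1}(cint_periodize_shift P0 s IF) -cintZ//.
  have Iw := cintegrable_shift (- s) cintegrable_win.
  have m : @cmeas _ TR R (fun x => (win P (x - s))%:C * periodize P F x).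
    have -> : (fun x => (win P (x - s))%:C * periodize P F x) = (fun x => (win P (x - s))%:C * expi (om * n%:~R * x)).
      by apply/funext => x; rewrite periodize_win// => y k; exact: expi_per.
    by apply: cmeasM; [exact: cintegrable_meas Iw|exact: cmeas_expi_lin].
  rewrite -(cint_shift s m); apply: eq_cint => x; rewrite addrK periodize_win; last by move=> y k; exact: expi_per.
  by rewrite /F mulrCA -expiD -mulrDr addrC.
have e : expi (om * n%:~R * s) = -1 :> R[i].
  have -> : om * n%:~R * s = pi.
    have n1 : n%:~R != 0 :> R by rewrite intr_eq0.
    by rewrite /s; move: (pi : R) => p; field; rewrite n1 gt_eqF.
  by rewrite /expi cospi sinpi; apply/eqP; rewrite eq_complex /= oppr0 !eqxx.
move: E; rewrite e mulN1r => /eqP; rewrite -addr_eq0 -mulr2n mulrn_eq0/= => /eqP ->; by [].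
Qed.

(** Subtracting c / P times the window leaves a function without coefficients. *)
Lemma periodize_const f (c : R[i]) : cintegrable mu f ->
  (forall n, cint mu (fun x => f x * expi (om * n%:~R * x)) = (n == 0)%:R * c) ->
  {ae mu, forall x, periodize P f x = c / P%:C}.
Proof.
move=> If cf; pose d := c / P%:C.
have Iw : cintegrable mu (fun x => d * (win P x)%:C) by apply: cintegrableZ; exact: cintegrable_win.
have P1 : P%:C != 0 by rewrite eq_complex /= gt_eqF.
have Z : no_coef P (fun x => f x - d * (win P x)%:C).
  split.
    have := cintegrableD If (cintegrableZ (-1) Iw); congr cintegrable.
    by apply/funext => x; rewrite mulN1r.
  move=> n; transitivity (cint mu (fun x => f x * expi (om * n%:~R * x) - d * ((win P x)%:C * expi (om * n%:~R * x)))).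
    by apply: eq_cint => x; rewrite mulrBl mulrA.
  have Iwn := cintegrableM_expi (om * n%:~R) cintegrable_win.
  rewrite cintB ?cintZ ?cf ?cint_win_expi//; [|exact: cintegrableM_expi|exact: cintegrableZ].
  by rewrite mulrCA /d divfK// subrr.
apply: ae_mono (ae_and (periodize_eq0 P0 Z) (ae_fiber_cintegrable P0 If)) => x [zx ifx].
have ifw : cintegrable Zcount (fiber P (fun x => d * (win P x)%:C) x).
  by apply: cintegrableZ; have [iw _] := Zcount_win x; split => //; exact: integrable0.
rewrite -/d; have <- : periodize P (fun x => d * (win P x)%:C) x = d.
  rewrite -[RHS](@periodize_win (fun=> d) x)//.
  by apply: eq_cint => k; rewrite /fiber mulrC.
apply/eqP; rewrite -subr_eq0 -zx; apply/eqP.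
rewrite /periodize -[in LHS]mulN1r -cintZ// -cintD//; last exact: cintegrableZ.
by apply: eq_cint => k; rewrite /fiber mulN1r.
Qed.

End constant_periodization.

(** * The index on one coset *)

Section one_fiber.
Context {R : realType}.
Local Notation mu := (@lebesgue_measure R).
Variables (P : R) (P0 : 0 < P) (a : R) (q : nat) (p : int).
Hypotheses (p0 : p != 0) (hq : a * q%:R = p%:~R * P).
Implicit Types (f g h : R -> R[i]) (k l : int).

Definition translate (c : R) f : R -> R[i] := fun y => f (y - c).

(** The restriction of f to x + P Z.  The factor sqrt P makes the translates of g
    orthonormal and not only orthogonal.  The values are in R[i]^o because the
    pre-Hilbert space of these vectors is a module over R[i]. *)
Definition vec f (x : R) : int -> R[i]^o := fun k => (Num.sqrt P)%:C * fiber P f x k.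

Lemma sqint_vec f x : sqint Zcount (fiber P f x) -> sqint Zcount (vec f x).
Proof. exact: sqintZ. Qed.

Lemma cip_vec f g x : sqint Zcount (fiber P f x) -> sqint Zcount (fiber P g x) ->
  cip Zcount (vec f x) (vec g x) = P%:C * periodize P (fun y => f y * conjc (g y)) x.
Proof.
move=> lf lg; rewrite /cip /periodize -cintZ; last exact: sqintJM.
apply: eq_cint => k; rewrite /vec /fiber conjM conjc_real.
have -> : P%:C = (Num.sqrt P)%:C * (Num.sqrt P)%:C :> R[i] by rewrite -rmorphM/= -expr2 sqr_sqrtr// ltW.
ring.
Qed.

Variables (g h : R -> R[i]) (alpha x : R).
Local Notation Tg l := (translate (a * l%:~R) g).
Local Notation Th l := (translate (a * l%:~R) h).
Local Notation X f := (fun y => (y - alpha)%:C * f y).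

Hypotheses (lg : forall l, sqint Zcount (fiber P (Tg l) x)) (lh : forall l, sqint Zcount (fiber P (Th l) x)).
Hypotheses (xg : forall l, sqint Zcount (fiber P (X (Tg l)) x)) (xh : forall l, sqint Zcount (fiber P (X (Th l)) x)).
Hypothesis og : forall l l', P%:C * periodize P (fun y => Tg l y * conjc (Tg l' y)) x = (l == l')%:R.
Hypothesis oh : forall l l', P%:C * periodize P (fun y => Th l y * conjc (Th l' y)) x = (l == l')%:R.
Hypothesis total : forall l (eps : R), 0 < eps -> exists2 J : seq int, uniq J &
  1 - eps <= \sum_(j <- J) nsq (P%:C * periodize P (fun y => Th l y * conjc (Tg j y)) x).

Let E := L2space (@Zcount R).
(** The l-th translate sits in block s at place r, where l = r + q s; translation
    by one block is a shift by p on the coset, because a q = p P. *)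
Let ix (s : int) (r : 'I_q) : int := r%:Z + q%:Z * s.
Let G s r : int -> R[i]^o := vec (Tg (ix s r)) x.
Let H s r : int -> R[i]^o := vec (Th (ix s r)) x.

Let ix_inj s r t r' : (ix s r == ix t r') = ((s, r) == (t, r')).
Proof.
apply/eqP/eqP => [|[-> ->//]]; rewrite /ix => e.
have h1 := ltn_ord r; have h2 := ltn_ord r'.
have st : s = t by nia.
by rewrite st in e *; congr (_, _); apply: val_inj; move/addIr : e => [].
Qed.

Let oG : orthonormal E (fun u : int * 'I_q => G u.1 u.2).
Proof.
split=> [[s r]|[s r] [t r']]; first exact: sqint_vec.
by rewrite [LHS]cip_vec// og ix_inj.
Qed.

Let oH : orthonormal E (fun u : int * 'I_q => H u.1 u.2).
Proof.
split=> [[s r]|[s r] [t r']]; first exact: sqint_vec.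
by rewrite [LHS]cip_vec// oh ix_inj.
Qed.

Let shift_ix f s r t k : vec (translate (a * (ix (s + t) r)%:~R) f) x k =
                     vec (translate (a * (ix s r)%:~R) f) x (k - p * t).
Proof.
rewrite /vec /fiber /translate; congr (_ * f _).
have e1 : (ix (s + t) r)%:~R = (ix s r)%:~R + q%:R * t%:~R :> R.
  by rewrite -[q%:R]/((q%:Z)%:~R) -intrM -intrD; congr (_%:~R); rewrite /ix; ring.
have e2 : (k - p * t)%:~R = k%:~R - p%:~R * t%:~R :> R by rewrite rmorphB/= intrM.
have e3 : a * (q%:R * t%:~R) = p%:~R * t%:~R * P by rewrite mulrA hq mulrAC.
by rewrite e1 e2 mulrDr e3; ring.
Qed.

Let shift_ip (F F' : int -> R[i]) (j : int) :
  cip Zcount (fun k => F (k - j)) (fun k => F' (k - j)) = cip (@Zcount R) F F'.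
Proof. by rewrite /cip (cint_Zcount_shift (- j) (fun k => F k * conjc (F' k))). Qed.

Let shiftHG s r t r' : ip E (H (s + 1) r) (G (t + 1) r') = ip E (H s r) (G t r').
Proof.
rewrite -[RHS](shift_ip _ _ p); congr (cip _ _ _); apply/funext => k.
  by rewrite /H shift_ix mulr1.
by rewrite /G shift_ix mulr1.
Qed.

Let overlapE r r' t : overlap E G H r r' t =
  P%:C * periodize P (fun y => Th (ix 0 r) y * conjc (Tg (ix t r') y)) x.
Proof. exact: cip_vec. Qed.

(** The blocks of finitely many translates fit in a window of blocks. *)
Let completeHG r (eps : R) : 0 < eps ->
  exists N, 1 - eps <= \sum_(t <- cwin N) \sum_r' nsq (overlap E G H r r' t).
Proof.
move=> eps0; have [J uJ HJ] := total (ix 0 r) eps0.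
have q0 : (0 < q)%N := leq_ltn_trans (leq0n r) (ltn_ord r).
have [N HN] : exists N : nat, forall j : int, j \in J -> - N%:Z < j < N%:Z.
  elim: J {uJ HJ} => [|j J [N IH]]; first by exists 0%N.
  by exists (`|j|%N + N).+1 => i; rewrite inE => /orP[/eqP->|/IH]; lia.
exists N; apply: le_trans HJ _.
pose K := [seq ix t r' | t <- cwin N, r' <- enum 'I_q].
apply: (@le_trans _ _ (\sum_(j <- K) nsq (P%:C * periodize P (fun y => Th (ix 0 r) y * conjc (Tg j y)) x))); last first.
  rewrite big_allpairs_dep le_eqVlt; apply/orP; left; apply/eqP; apply: eq_bigr => t _.
  by rewrite big_enum; apply: eq_bigr => r' _; rewrite overlapE.
apply: ler_sum_sub => //.
- apply: allpairs_uniq; [exact: cwin_uniq|exact: enum_uniq|].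
  by move=> [s r1] [t r2] _ _ /= /eqP; rewrite ix_inj => /eqP.
- move=> j jJ; have := HN j jJ => jN.
  have qz : (q%:Z != 0) by lia.
  have := divz_eq j q%:Z; have := modz_ge0 j qz; have := ltz_mod j qz.
  set t := (j %/ q%:Z)%Z; set m := (j %% q%:Z)%Z => m1 m0 je.
  have mq : (`|m| < q)%N by lia.
  apply/allpairsP; exists (t, Ordinal mq); split => /=.
  + by rewrite mem_cwin; nia.
  + by rewrite mem_enum.
  + by rewrite /ix /=; lia.
- by move=> j; exact: nsq_ge0.
Qed.

Definition fiber_moment f := \int[Zcount]_k ((x + k%:~R * P - alpha) * nsq (f (x + k%:~R * P))).

Let ip_moment f : sqint Zcount (fiber P f x) -> sqint Zcount (fiber P (X f) x) ->
  cip Zcount (vec (X f) x) (vec f x) = (P * fiber_moment f)%:C.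
Proof.
move=> lf lxf; rewrite cip_vec// rmorphM/=; congr (_ * _).
rewrite /periodize /fiber_moment /cint; congr (_ +i* _).
  apply: eq_Rintegral => k _; rewrite /fiber -mulrA -nsqE.
  by rewrite cReM /= mulr0 subr0.
transitivity (\int[@Zcount R]_k (fun=> 0 : R) k); last by rewrite /Rintegral integral0.
apply: eq_Rintegral => k _; rewrite /fiber -mulrA -nsqE.
by rewrite cImM /= mulr0 mul0r addr0.
Qed.

(** [position_trace_integrality] for A r = (y - alpha) h_r and B r = (y - alpha) g_r.
    The hypothesis [position] holds with c = a q, because translating a block by t
    blocks moves the position by a q t. *)
Theorem fiber_moments_integral : exists z : int,
  P * \sum_(r < q) (fiber_moment (Th r%:Z) - fiber_moment (Tg r%:Z)) = a * q%:R * z%:~R.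
Proof.
pose A (r : 'I_q) : int -> R[i]^o := vec (X (Th (ix 0 r))) x.
pose B (r : 'I_q) : int -> R[i]^o := vec (X (Tg (ix 0 r))) x.
have dA r : dom E (A r) by exact: sqint_vec.
have dB r : dom E (B r) by exact: sqint_vec.
have c0 : a * q%:R != 0 by rewrite hq mulf_neq0 ?intr_eq0// gt_eqF.
have shiftG f t r k : vec (translate (a * (ix t r)%:~R) f) x k = vec (translate (a * (ix 0 r)%:~R) f) x (k - p * t).
  by rewrite -shift_ix add0r.
have pos t r r' : ip E (A r) (G t r') - ip E (H (- t) r) (B r') = (a * q%:R * t%:~R)%:C * overlap E G H r r' t.
  apply/eqP; rewrite subr_eq addrC; apply/eqP.
  have -> : ip E (H (- t) r) (B r') = cip Zcount (H 0 r) (fun k => B r' (k - p * t)).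
    rewrite -(shift_ip (H 0 r) _ (- (p * t))); congr (cip _ _ _); apply/funext => k.
      by rewrite /H shiftG mulrN.
    by rewrite opprK addrK.
  have lB : sqint Zcount (fun k => B r' (k - p * t)) by exact: (sqint_Zcount_shift (- (p * t)) (dB r')).
  have lH : sqint Zcount (H 0 r) := oH.1 (0, r).
  have lG : sqint Zcount (G t r') := oG.1 (t, r').
  rewrite /overlap /= /cip -cintZ; last exact: sqintJM.
  rewrite -cintD; [|exact: sqintJM|by apply: cintegrableZ; exact: sqintJM].
  apply: eq_cint => k; rewrite /A /H /G (shiftG g) /B /vec /fiber.
  set Y := x + k%:~R * P.
  have -> : x + (k - p * t)%:~R * P = Y - a * q%:R * t%:~R.
    by rewrite hq rmorphB/= intrM /Y; ring.
  move: (translate _ h _) (translate _ g _) => u v.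
  rewrite !conjM !conjc_real; rewrite !rmorphB/=; ring.
have [z Hz] := position_trace_integrality oG oH shiftHG completeHG dA dB c0 pos.
exists z; apply: (@complexI R); rewrite -Hz mulr_sumr realC_sum; apply: eq_bigr => r _.
rewrite mulrBr rmorphB/=.
have ix0 : r%:Z = ix 0 r by rewrite /ix mulr0 addr0.
rewrite ix0; congr (_ - _); first exact/esym/(ip_moment (lh _) (xh _)).
have := ip_moment (lg (ix 0 r)) (xg (ix 0 r)) => /(congr1 (@conjc R)); rewrite conjc_real => <-.
by rewrite -cipJ//; exact: sqint_vec.
Qed.

End one_fiber.

(** * From the line to almost every coset *)

Section markov.
Context {R : realType}.
Local Notation mu := (@lebesgue_measure R).
Local Notation TR := (measurableTypeR R).

(** The indicator of {l <= u} is at most u / l. *)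
Lemma markov_le (u : R -> R) (l : R) : measurable_fun [set: TR] u -> (forall x, 0 <= u x) -> 0 < l ->
  (mu [set x | (l <= u x)%R] <= (l^-1)%:E * \int[mu]_x (u x)%:E)%E.
Proof.
move=> mu_ u0 l0; have mB : measurable ([set x | l <= u x] : set TR).
  rewrite (_ : [set x | l <= u x] = u @^-1` `[l, +oo[).
    by rewrite -[X in measurable X]setTI; apply: mu_ => //; exact: measurable_itv.
  by apply/seteqP; split=> x /=; rewrite in_itv/= andbT.
rewrite -lee_pdivrMl// ?invr_gt0// invrK.
have -> : (l%:E * mu [set x | (l <= u x)%R] = \int[mu]_(x in [set x | (l <= u x)%R]) (cst l%:E) x)%E.
  by rewrite integral_cst.
apply: (@le_trans _ _ (\int[mu]_(x in [set x | (l <= u x)%R]) (u x)%:E)%E).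
  apply: ge0_le_integral => //.
  - by move=> x _; rewrite lee_fin ltW.
  - by apply/measurable_EFinP; exact: measurable_funS mu_.
apply: ge0_subset_integral => //; first exact/measurable_EFinP.
by move=> x _; rewrite lee_fin.
Qed.

(** Almost no point belongs to all the sets {V n >= eps}, whose measures tend to 0
    by [markov_le]. *)
Lemma ae_small (V : nat -> R -> R) : (forall n x, 0 <= V n x) ->
  (forall n, mu.-integrable setT (EFin \o V n)) ->
  (forall n, \int[mu]_x V n x <= n.+1%:R^-1) ->
  {ae mu, forall x, forall eps, 0 < eps -> exists n, V n x < eps}.
Proof.
move=> V0 iV hV.
have mV n : measurable_fun [set: TR] (V n) by apply/measurable_EFinP; case/integrableP: (iV n).
have E n : (\int[mu]_x (V n x)%:E)%E = (\int[mu]_x V n x)%:E.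
  by rewrite /Rintegral fineK//; exact: (integrable_fin_num measurableT (iV n)).
have H (m : nat) : {ae mu, forall x, exists n, V n x < m.+1%:R^-1}.
  exists (\bigcap_n [set x | m.+1%:R^-1 <= V n x]); split.
  - apply: bigcap_measurable => // n _.
    rewrite (_ : [set x | m.+1%:R^-1 <= V n x] = (V n) @^-1` `[m.+1%:R^-1, +oo[).
      by rewrite -[X in measurable X]setTI; apply: (mV n) => //; exact: measurable_itv.
    by apply/seteqP; split=> x /=; rewrite in_itv/= andbT.
  - apply/eqP; rewrite eq_le measure_ge0 andbT; apply/lee_addgt0Pr => e e0; rewrite add0e.
    have [n nP] : exists n : nat, n.+1%:R^-1 <= e / m.+1%:R.
      exists (Num.truncn (m.+1%:R / e)); rewrite -[leRHS]invrK lef_pV2 ?posrE ?invr_gt0 ?divr_gt0//.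
      have te : 0 <= m.+1%:R / e by rewrite divr_ge0// ltW.
      by rewrite invf_div; have /andP[_ /ltW] := truncn_itv te.
    apply: (@le_trans _ _ (mu [set x | m.+1%:R^-1 <= V n x])).
      apply: le_measure; rewrite ?inE.
      + apply: bigcap_measurable => // j _.
        rewrite (_ : [set x | m.+1%:R^-1 <= V j x] = (V j) @^-1` `[m.+1%:R^-1, +oo[).
          by rewrite -[X in measurable X]setTI; apply: (mV j) => //; exact: measurable_itv.
        by apply/seteqP; split=> x /=; rewrite in_itv/= andbT.
      + rewrite (_ : [set x | m.+1%:R^-1 <= V n x] = (V n) @^-1` `[m.+1%:R^-1, +oo[).
          by rewrite -[X in measurable X]setTI; apply: (mV n) => //; exact: measurable_itv.
        by apply/seteqP; split=> x /=; rewrite in_itv/= andbT.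
      + by move=> x /= h; apply: h.
    apply: le_trans (markov_le (mV n) (V0 n) _) _; first by rewrite invr_gt0.
    rewrite invrK E -EFinM lee_fin mulrC -ler_pdivlMr//.
    exact: le_trans (hV n) nP.
  - move=> x /= nx n _ /=; rewrite leNgt; apply/negP => h; apply: nx; by exists n.
have /ae_foralln := H; apply: ae_mono => x Hx eps e0.
have [n nP] := Hx (Num.truncn eps^-1); exists n; apply: lt_trans nP _.
have te : 0 <= eps^-1 by rewrite invr_ge0 ltW.
rewrite -[ltRHS]invrK ltf_pV2 ?posrE ?invr_gt0//.
by have /andP[] := truncn_itv te.
Qed.

End markov.

Section fiber_conditions.
Context {R : realType}.
Local Notation mu := (@lebesgue_measure R).
Local Notation TR := (measurableTypeR R).
Variables (P : R) (P0 : 0 < P) (a : R) (q : nat) (p : int).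
Hypotheses (p0 : p != 0) (hq : a * q%:R = p%:~R * P).
Variables (g : R -> R[i]) (u eta alpha : R).
Hypothesis lg : sqint mu g.
Hypothesis mg : mu.-integrable setT (fun x => ((x - alpha) ^+ 2 * nsq (g x))%:E).
Local Notation sys l := (tfshift (a * l.1%:~R) (P^-1 * l.2%:~R) g).
Hypothesis ong : forall l l' : int * int, cip mu (sys l) (sys l') = (l == l')%:R.
Let h := tfshift u eta g.
Hypothesis spang : forall eps : R, 0 < eps -> exists (s : seq (int * int)) (c : int * int -> R[i]),
  \int[mu]_x nsq (h x - \sum_(l <- s) c l * sys l x) <= eps.
Implicit Types (f : R -> R[i]) (k l j : int) (x y c : R).
Local Notation Tg l := (translate (a * l%:~R) g).
Local Notation Th l := (translate (a * l%:~R) h).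
Local Notation X f := (fun y => (y - alpha)%:C * f y).
Local Notation om := (2 * pi / P).

Lemma periodize_translate c f x : periodize P (translate c f) x = periodize P f (x - c).
Proof. by rewrite /periodize fiber_shift. Qed.

Let G_at x := forall j, P%:C * periodize P (fun y => g y * conjc (Tg j y)) x = (j == 0)%:R.

(** The n-th coefficient of the periodization of g times the conjugate of its j-th
    translate is the inner product of two elements of the system; it vanishes
    unless n = 0 and j = 0. *)
Let ae_G_at : {ae mu, forall x, G_at x}.
Proof.
apply: ae_forall_int => j.
have ltg : sqint mu (Tg j) by exact: (sqint_shift (- (a * j%:~R)) lg).
have P1 : P%:C != 0 :> R[i] by rewrite eq_complex /= gt_eqF.
apply: ae_mono (periodize_const P0 (c := (j == 0)%:R) (sqintJM lg ltg) _) => [x ->|n].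
  by rewrite mulrC divfK.
transitivity (cip mu (sys ((0 : int), n)) (sys (j, (0 : int)))).
  apply: eq_cint => y; rewrite /tfshift /= !mulr0 mul0r expi0 mul1r subr0 /translate.
  rewrite mulrAC [g y * expi _]mulrC; congr (expi _ * _ * _); ring.
by rewrite ong xpair_eqE eq_sym (eq_sym n); case: (j == 0); case: (0 == n); rewrite ?mul1r ?mul0r ?mulr0.
Qed.

Let sqint_translate c f : sqint mu f -> sqint mu (translate c f).
Proof. exact: sqint_shift. Qed.

Let lh : sqint mu h. Proof. exact: sqint_tfshift. Qed.

Let lX f c : sqint mu f -> sqint mu (X f) -> sqint mu (X (translate c f)).
Proof.
move=> lf lxf; have := sqintZD c%:C (sqint_translate c lf) (sqint_translate c lxf).
congr sqint; apply/funext => y; rewrite /translate /= -mulrDl.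
by rewrite -rmorphD/=; congr (_%:C * _); ring.
Qed.

Let lXg : sqint mu (X g).
Proof.
apply: integrable_sqint; first by apply: cmeasM; [apply: cmeasR; exact: measurable_funB|exact: lg.1].
by under eq_fun do rewrite nsqM nsqR.
Qed.

Let lXh : sqint mu (X h).
Proof.
have [m i] := lX u lg lXg; split.
  by apply: cmeasM; [apply: cmeasR; exact: measurable_funB|exact: lh.1].
by under eq_integral do rewrite nsqM /h /tfshift nsqM nsq_expi mul1r -nsqM.
Qed.

(** The hypotheses of [fiber_moments_integral] on one coset, except for totality. *)
Definition good_fiber x : Prop :=
  [/\ forall l, sqint Zcount (fiber P (Tg l) x) /\ sqint Zcount (fiber P (Th l) x),
      forall l, sqint Zcount (fiber P (X (Tg l)) x) /\ sqint Zcount (fiber P (X (Th l)) x),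
      forall l l', P%:C * periodize P (fun y => Tg l y * conjc (Tg l' y)) x = (l == l')%:R &
      forall l l', P%:C * periodize P (fun y => Th l y * conjc (Th l' y)) x = (l == l')%:R].

Lemma ae_good_fiber : {ae mu, forall x, good_fiber x}.
Proof.
have A1 := ae_forall_int (fun l => ae_fiber_sqint P0 (sqint_translate (a * l%:~R) lg)).
have A2 := ae_forall_int (fun l => ae_fiber_sqint P0 (sqint_translate (a * l%:~R) lh)).
have A3 := ae_forall_int (fun l => ae_fiber_sqint P0 (lX (a * l%:~R) lg lXg)).
have A4 := ae_forall_int (fun l => ae_fiber_sqint P0 (lX (a * l%:~R) lh lXh)).
have A5 := ae_forall_int (fun l => ae_shift (- (a * l%:~R)) ae_G_at).
have A6 := ae_shift (- u) A5.
apply: ae_mono (ae_and (ae_and (ae_and A1 A2) (ae_and A3 A4)) (ae_and A5 A6)) => x.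
move=> [[[a1 a2] [a3 a4]] [a5 a6]]; split => // l l'.
  have E y : Tg l y * conjc (Tg l' y) = translate (a * l%:~R) (fun y => g y * conjc (Tg (l' - l) y)) y.
    rewrite /translate; have -> : y - a * l'%:~R = y - a * l%:~R - a * (l' - l)%:~R by rewrite rmorphB/=; ring.
    by [].
  by rewrite (funext E) periodize_translate (a5 l) subr_eq0 eq_sym.
pose z : R[i] := expi (2 * pi * eta * (a * (l'%:~R - l%:~R))).
have E y : Th l y * conjc (Th l' y) = z * translate (a * l%:~R + u) (fun y => g y * conjc (Tg (l' - l) y)) y.
  rewrite /h /translate /tfshift conjM -expiN.
  have -> : y - (a * l%:~R + u) - a * (l' - l)%:~R = y - a * l'%:~R - u by rewrite rmorphB/=; ring.
  have -> : y - (a * l%:~R + u) = y - a * l%:~R - u by ring.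
  have -> : z = expi (2 * pi * eta * (y - a * l%:~R)) * expi (- (2 * pi * eta * (y - a * l'%:~R))).
    by rewrite -expiD; congr expi; ring.
  ring.
have Ez : periodize P (fun y => Th l y * conjc (Th l' y)) x =
   z * periodize P (translate (a * l%:~R + u) (fun y => g y * conjc (Tg (l' - l) y))) x.
  rewrite /periodize -cintZ; first by apply: eq_cint => k; rewrite /fiber E.
  have := cintegrableZ (conjc z) (sqintJM (a2 l) (a2 l')); congr cintegrable.
  apply/funext => k; rewrite -[fiber P (Th l) x k * _]/(Th l (x + k%:~R * P) * conjc (Th l' (x + k%:~R * P))).
  by rewrite E mulrA (mulrC (conjc z)) expi_conj mul1r.
rewrite Ez periodize_translate mulrCA opprD addrA.
have -> : x - a * l%:~R - u = x - u - a * l%:~R by ring.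
rewrite (a6 l) subr_eq0; have [e|ne] := eqVneq l' l; last by rewrite mulr0.
by rewrite /z e subrr mulr0 mulr0 expi0 mulr1.
Qed.

Let tot_at x := forall eps, 0 < eps -> exists2 J : seq int, uniq J &
  1 - eps <= \sum_(j <- J) nsq (P%:C * periodize P (fun y => h y * conjc (Tg j y)) x).

Let modulation_fiber x (l : int * int) k :
  sys l (x + k%:~R * P) = expi (om * l.2%:~R * x) * Tg l.1 (x + k%:~R * P).
Proof.
rewrite /tfshift /translate; congr (_ * _).
by rewrite -(expi_per P0 l.2 x k); congr expi; ring.
Qed.

(** On a coset the modulations are constant factors, so that a combination of the
    system restricts to a combination of translates of g; the best approximation
    by the latter is given by the coefficients of h. *)
Let tot_of_approx x s (c : int * int -> R[i]) eps : good_fiber x ->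
  P * \int[Zcount]_k nsq (fiber P (fun y => h y - \sum_(l <- s) c l * sys l y) x k) <= eps ->
  exists2 J : seq int, uniq J &
  1 - eps <= \sum_(j <- J) nsq (P%:C * periodize P (fun y => h y * conjc (Tg j y)) x).
Proof.
move=> [l1 _ og oh] small; exists (undup (map fst s)); first exact: undup_uniq.
set J := undup _.
pose e j : int -> R[i]^o := vec P (Tg j) x.
have oe : orthonormal (L2space (@Zcount R)) e.
  split=> [j|i j]; first by apply: sqint_vec; exact: (l1 j).1.
  by rewrite [LHS](cip_vec P0 (l1 i).1 (l1 j).1).
have h0 : h = Th 0 by apply/funext => y; rewrite /translate mulr0 subr0.
have lh0 : sqint Zcount (fiber P h x) by rewrite h0; exact: (l1 0).2.
pose v : int -> R[i]^o := vec P h x.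
have lv : dom (L2space (@Zcount R)) v by exact: sqint_vec.
have nv : nrm2 (L2space (@Zcount R)) v = 1.
  rewrite /nrm2 [ip _ _ _](cip_vec P0 lh0 lh0).
  have -> : (fun y => h y * conjc (h y)) = (fun y => Th 0 y * conjc (Th 0 y)) by rewrite -h0.
  by rewrite oh eqxx.
(* On the coset of x the modulation by l.2 is the constant expi (om l.2 x). *)
pose c' j : R[i] := \sum_(l <- s | l.1 == j) c l * expi (om * l.2%:~R * x).
have := best_approx oe c' (undup_uniq _ : uniq J) lv; rewrite nv.
have -> : \sum_(j <- J) nsq (ip (L2space (@Zcount R)) v (e j)) =
  \sum_(j <- J) nsq (P%:C * periodize P (fun y => h y * conjc (Tg j y)) x).
  by apply: eq_bigr => j _; congr nsq; exact: (cip_vec P0 lh0 (l1 j).1).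
have -> : nrm2 (L2space (@Zcount R)) (v - \sum_(j <- J) c' j *: e j) =
  P * \int[Zcount]_k nsq (fiber P (fun y => h y - \sum_(l <- s) c l * sys l y) x k).
  have E k : (v - \sum_(j <- J) c' j *: e j) k =
     (Num.sqrt P)%:C * fiber P (fun y => h y - \sum_(l <- s) c l * sys l y) x k.
    rewrite /fiber mulrBr; congr (_ - _); rewrite mulr_sumr fct_sumE.
    transitivity (\sum_(j <- J) \sum_(l <- s | l.1 == j) (Num.sqrt P)%:C * (c l * sys l (x + k%:~R * P))).
      apply: eq_bigr => j _; rewrite -[(c' j *: e j) k]/(c' j * e j k) /c' mulr_suml; apply: eq_bigr => l /eqP lj.
      rewrite modulation_fiber lj /e /vec /fiber; ring.
    rewrite (exchange_big_dep predT)//=; apply: eq_big_seq => l ls.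
    rewrite (eq_bigl (pred1 l.1)) => [|i]; last by rewrite /= eq_sym.
    by rewrite -big_filter filter_pred1_uniq ?big_seq1 ?undup_uniq// mem_undup map_f.
  have lF : sqint Zcount (fun k => (Num.sqrt P)%:C * fiber P (fun y => h y - \sum_(l <- s) c l * sys l y) x k).
    rewrite -(funext E); apply: (@domB _ _ (L2space (@Zcount R))) => //.
    by apply: dom_sum => j; apply: domZ; exact: oe.1.
  have lF' : sqint Zcount (fiber P (fun y => h y - \sum_(l <- s) c l * sys l y) x).
    have := sqintZ ((Num.sqrt P)^-1)%:C lF; congr sqint; apply/funext => k.
    by rewrite mulrA -rmorphM/= mulVf ?mul1r// gt_eqF// sqrtr_gt0.
  rewrite L2_nrm2 -RintegralZl//; last exact: sqint_integrable.
  by apply: eq_Rintegral => k _; rewrite E nsqM nsqR sqr_sqrtr// ltW.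
by move=> b; lra.
Qed.

(** Approximations of h in mean on the line are, along a subsequence, approximations
    on almost every coset. *)
Let ae_tot_at : {ae mu, forall x, tot_at x}.
Proof.
pose en (n : nat) : R := n.+1%:R^-1 / P.
have en0 n : 0 < en n by rewrite divr_gt0 ?invr_gt0.
pose F (n : nat) (s : seq (int * int)) (c : int * int -> R[i]) y := h y - \sum_(l <- s) c l * sys l y.
have [s Hs] := choice (fun n => spang (en0 n)).
have [c Hc] := choice (fun n => Hs n).
pose f n := F n (s n) (c n).
have lf n : sqint mu (f n).
  rewrite /f /F; have ls : sqint mu (fun y => \sum_(l <- s n) c n l * sys l y).
    elim: (s n) => [|l r IH]; first by under eq_fun do rewrite big_nil; exact: sqint0.
    by under eq_fun do rewrite big_cons; apply: sqintZD => //; exact: sqint_tfshift.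
  by have := sqintB 1 lh ls; congr sqint; apply/funext => y; rewrite mul1r.
pose V n x := win P x * (P * \int[Zcount]_k nsq (fiber P (f n) x k)).
have iV n : mu.-integrable setT (EFin \o V n).
  have := integrable_fiber P0 (sqint_integrable (lf n)) => /(integrableRZ P).
  by congr integrable; apply/funext => x; rewrite /V /= mulrCA.
have V0 n x : 0 <= V n x.
  rewrite /V mulr_ge0 ?win_ge0// mulr_ge0 ?(ltW P0)//.
  by apply: Rintegral_ge0 => k _; exact: nsq_ge0.
have hV n : \int[mu]_x V n x <= n.+1%:R^-1.
  have -> : \int[mu]_x V n x = P * \int[mu]_x nsq (f n x).
    rewrite (Rintegral_fiber P0 (sqint_integrable (lf n))) -RintegralZl//; last exact: integrable_fiber (sqint_integrable (lf n)).
    by apply: eq_Rintegral => x _; rewrite /V mulrCA.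
  by rewrite mulrC -ler_pdivlMr//; exact: Hc.
apply: (ae_periodic P0).
  move=> x k H eps e0; have [J uJ HJ] := H eps e0; exists J => //.
  by move: HJ; under eq_bigr do rewrite periodizeS.
apply: ae_mono (ae_and ae_good_fiber (ae_small V0 iV hV)) => x [gx Vx] xI eps e0.
have [n Vn] := Vx eps e0; apply: (tot_of_approx (s := s n) (c := c n) gx).
by apply: ltW; move: Vn; rewrite /V winE// mul1r.
Qed.

Definition center x := \int[Zcount]_k ((x + k%:~R * P - alpha) * nsq (g (x + k%:~R * P))).

(** Translating by a r changes the mean position by a r, and by u in addition for
    h, because every translate has norm 1 on the coset; this accounts for q u. *)
Lemma ae_index : {ae mu, forall x, exists z : int,
  P * \sum_(r < q) (center (x - a * r%:R - u) - center (x - a * r%:R)) + q%:R * u = a * q%:R * z%:~R}.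
Proof.
have A := ae_forall_int (fun l => ae_shift (- (a * l%:~R)) ae_tot_at).
apply: ae_mono (ae_and ae_good_fiber A) => x [gx tx].
have [l1 l2 og oh] := gx.
have total l (eps : R) : 0 < eps -> exists2 J : seq int, uniq J &
    1 - eps <= \sum_(j <- J) nsq (P%:C * periodize P (fun y => Th l y * conjc (Tg j y)) x).
  move=> e0; have [J uJ HJ] := tx l eps e0; exists (map (fun j => j + l) J).
    by rewrite map_inj_uniq//; exact: addIr.
  apply: le_trans HJ _; rewrite big_map le_eqVlt; apply/orP; left; apply/eqP.
  have E j y : Th l y * conjc (Tg (j + l) y) = translate (a * l%:~R) (fun y => h y * conjc (Tg j y)) y.
    rewrite /translate; have -> : y - a * (j + l)%:~R = y - a * l%:~R - a * j%:~R by rewrite intrD; ring.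
    by [].
  by apply: eq_bigr => j _; rewrite (funext (E j)) periodize_translate.
have [z Hz] := fiber_moments_integral P0 p0 hq (fun l => (l1 l).1) (fun l => (l1 l).2)
  (fun l => (l2 l).1) (fun l => (l2 l).2) og oh total.
exists z; rewrite -Hz.
have one f c : sqint Zcount (fiber P f x) -> sqint Zcount (fiber P (X f) x) ->
    P%:C * periodize P (fun y => f y * conjc (f y)) x = 1 ->
    P * fiber_moment P alpha x f =
    P * \int[Zcount]_k ((x - c + k%:~R * P - alpha) * nsq (f (x + k%:~R * P))) + c.
  move=> lf lxf nf.
  have nf' : P * \int[Zcount]_k nsq (f (x + k%:~R * P)) = 1.
    move: nf; rewrite /periodize [cint _ _](cipE _ (fiber P f x)) -rmorphM/=.
    by move=> /complexI.
  have i1 := sqint_integrable lf.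
  have i2 : Zcount.-integrable setT (fun k => ((x + k%:~R * P - alpha) * nsq (f (x + k%:~R * P)))%:E).
    have [i2 _] := sqintJM lxf lf.
    apply: eq_integrable i2 => // k _; rewrite /fiber -mulrA -nsqE.
    by rewrite cReM/= mulr0 subr0.
  transitivity (P * \int[Zcount]_k ((x - c + k%:~R * P - alpha) * nsq (f (x + k%:~R * P))) +
      c * (P * \int[Zcount]_k nsq (f (x + k%:~R * P)))); last by rewrite nf' mulr1.
  rewrite [c * _]mulrCA -mulrDr; congr (_ * _).
  rewrite /fiber_moment -RintegralZl// -RintegralD//.
  - by apply: eq_Rintegral => k _; ring.
  - rewrite (_ : EFin \o _ = (fun k => ((x + k%:~R * P - alpha) * nsq (f (x + k%:~R * P)) + (- c) * nsq (f (x + k%:~R * P)))%:E)); last first.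
      by apply/funext => k /=; congr EFin; ring.
    apply: (@integrableRD _ int R Zcount (fun k => (x + k%:~R * P - alpha) * nsq (f (x + k%:~R * P)))) => //.
    exact: (@integrableRZ _ int R Zcount).
  - exact: (@integrableRZ _ int R Zcount).
rewrite !mulr_sumr -[q in q%:R * u](card_ord q) -sum1_card natr_sum mulr_suml -big_split/=.
apply: eq_bigr => r _; rewrite mul1r mulrBr.
have ogr : P%:C * periodize P (fun y => Tg r%:Z y * conjc (Tg r%:Z y)) x = 1 by rewrite og eqxx.
have ohr : P%:C * periodize P (fun y => Th r%:Z y * conjc (Th r%:Z y)) x = 1 by rewrite oh eqxx.
rewrite mulrBr (one _ (a * r%:R) (l1 _).1 (l2 _).1 ogr) (one _ (a * r%:R + u) (l1 _).2 (l2 _).2 ohr).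
have -> : \int[Zcount]_k ((x - (a * r%:R + u) + k%:~R * P - alpha) * nsq (Th r%:Z (x + k%:~R * P))) =
    center (x - a * r%:R - u).
  apply: eq_Rintegral => k _; rewrite /h /translate /tfshift nsqM nsq_expi mul1r; congr (_ * nsq (g _)); ring.
have -> : \int[Zcount]_k ((x - a * r%:R + k%:~R * P - alpha) * nsq (Tg r%:Z (x + k%:~R * P))) =
    center (x - a * r%:R).
  by apply: eq_Rintegral => k _; rewrite /translate; congr (_ * nsq (g _)); ring.
by ring.
Qed.

Lemma ae_norm_fiber : {ae mu, forall x, P * \int[Zcount]_k nsq (g (x + k%:~R * P)) = 1}.
Proof.
apply: ae_mono ae_good_fiber => x [_ _ og _]; have := og 0 0; rewrite eqxx.
rewrite /periodize [cint _ _](cipE _ (fiber P (Tg 0) x)) -rmorphM/= => /complexI e.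
by rewrite -[RHS]e; congr (_ * _); apply: eq_Rintegral => k _; rewrite /fiber /translate mulr0 subr0.
Qed.

End fiber_conditions.

(** * Rigidity of the difference of centers *)

Section periodic_functions.
Context {R : realType}.
Local Notation mu := (@lebesgue_measure R).
Local Notation TR := (measurableTypeR R).
Variables (P : R) (P0 : 0 < P).
Implicit Types (f u : R -> R) (c x : R) (k : int).

Definition Pperiodic f := forall x k, f (x + k%:~R * P) = f x.

Lemma sum_win f x : Pperiodic f ->
  \int[Zcount]_k (win P (x + k%:~R * P) * f (x + k%:~R * P)) = f x.
Proof.
move=> fper; have [iw w1] := Zcount_win P0 x.
transitivity (\int[Zcount]_k (f x * win P (x + k%:~R * P))).
  by apply: eq_Rintegral => k _; rewrite fper mulrC.
by rewrite RintegralZl// w1 mulr1.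
Qed.

(** The sums over cosets of the window and of the translated window agree, being 1
    in both cases. *)
Lemma window_shift f c : Pperiodic f -> mu.-integrable setT (fun x => (win P x * f x)%:E) ->
  mu.-integrable setT (fun x => (win P x * f (x + c))%:E) /\
  \int[mu]_x (win P x * f (x + c)) = \int[mu]_x (win P x * f x).
Proof.
move=> fper iF; pose F x := win P x * f x.
have iFc : mu.-integrable setT (EFin \o (fun x => F (x + c))) by exact: (integrable_shift c iF).
have E x : \int[Zcount]_k F (x + k%:~R * P + c) = f (x + c).
  rewrite -(sum_win (x + c) fper); apply: eq_Rintegral => k _.
  by rewrite /F addrAC.
have i1 := integrable_fiber P0 iFc; have e1 := Rintegral_fiber P0 iFc.
split.
  by move: i1; congr integrable; apply/funext => x; rewrite E.
transitivity (\int[mu]_x (win P x * \int[Zcount]_k F (x + k%:~R * P + c))).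
  by apply: eq_Rintegral => x _; rewrite E.
rewrite -e1 /Rintegral (@integral_shift _ c (fun x => (F x)%:E))//.
by case/integrableP: iF.
Qed.

Lemma Pperiodic_fiber f : Pperiodic (fun x => \int[Zcount]_k f (x + k%:~R * P)).
Proof.
move=> x k; rewrite /Rintegral -(integral_Zcount_shift k (fun j => (f (x + j%:~R * P))%:E)).
by congr fine; apply: eq_integral => j _; rewrite intrD mulrDl addrA addrAC.
Qed.

(** A periodic function need not be bounded, but the part above a large level has
    a small integral; this replaces uniform integrability. *)
Definition tail (v : R -> R) (l : R) x := Num.max (v x - l) 0.

Lemma tail_ge0 v l x : 0 <= tail v l x. Proof. by rewrite /tail le_max lexx orbT. Qed.

Lemma tail_le v l x : v x <= l + tail v l x.
Proof. by rewrite /tail -lerBlDl le_max lexx. Qed.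

Lemma Pperiodic_tail v l : Pperiodic v -> Pperiodic (tail v l).
Proof. by move=> h x k; rewrite /tail h. Qed.

Lemma win_tail v l x : win P x * tail v l x = Num.max (win P x * v x - l * win P x) 0.
Proof.
have [xI|xI] := boolP (x \in `[0, P[); first by rewrite winE// !mul1r mulr1.
by rewrite win_out// !mul0r mulr0 subr0 maxxx.
Qed.

Lemma measurable_win_tail v l : measurable_fun [set: TR] (fun x => win P x * v x) ->
  measurable_fun [set: TR] (fun x => win P x * tail v l x).
Proof.
move=> mv; under eq_fun do rewrite win_tail.
apply: measurable_maxr => //; apply: measurable_funB => //.
by apply: measurable_funM => //; exact: measurable_win.
Qed.

Lemma tail_le_win v l x : 0 <= l -> (forall x, 0 <= v x) -> win P x * tail v l x <= win P x * v x.
Proof.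
move=> l0 v0; rewrite ler_wpM2l ?win_ge0// /tail ge_max v0 andbT.
by rewrite lerBlDr lerDl.
Qed.

Lemma integrable_win_tail v l : 0 <= l -> (forall x, 0 <= v x) ->
  mu.-integrable setT (fun x => (win P x * v x)%:E) ->
  mu.-integrable setT (fun x => (win P x * tail v l x)%:E).
Proof.
move=> l0 v0 iv; have mv : measurable_fun [set: TR] (fun x => win P x * v x).
  by apply/measurable_EFinP; case/integrableP: iv.
apply: le_integrable iv => //; first by apply/measurable_EFinP; exact: measurable_win_tail.
move=> x _; rewrite /= lee_fin !ger0_norm ?mulr_ge0 ?win_ge0 ?tail_ge0//.
exact: tail_le_win.
Qed.

Lemma small_tail v (e : R) : (forall x, 0 <= v x) ->
  mu.-integrable setT (fun x => (win P x * v x)%:E) -> 0 < e ->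
  exists2 l, 0 <= l & \int[mu]_x (win P x * tail v l x) <= e.
Proof.
move=> v0 iv e0; have mv : measurable_fun [set: TR] (fun x => win P x * v x).
  by apply/measurable_EFinP; case/integrableP: iv.
have [] := @dominated_convergence _ TR R mu setT measurableT
  (fun n x => (win P x * tail v n%:R x)%:E) (cst 0%E) (fun x => (win P x * v x)%:E).
- by move=> n; apply/measurable_EFinP; exact: measurable_win_tail.
- exact: measurable_cst.
- apply: aeW => x _; apply: cvg_EFin; first exact: nearW.
  apply: cvg_near_cst; exists (Num.truncn (v x)).+1 => // n /= hn.
  have /andP[_ b] := truncn_itv (v0 x).
  rewrite /tail; have -> : Num.max (v x - n%:R) 0 = 0.
    apply/max_idPr; rewrite subr_le0 ltW// (lt_le_trans b)// ler_nat//.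
  by rewrite mulr0.
- exact: iv.
- apply: aeW => x n _; rewrite /= lee_fin ger0_norm ?mulr_ge0 ?win_ge0 ?tail_ge0//.
  exact: tail_le_win.
move=> _ _; rewrite integral0 => /fine_cvgP[_ /cvgr0Pnorm_lt/(_ _ e0)] [N _ HN].
exists N%:R => //; apply: ltW; apply: le_lt_trans (ler_norm _) _.
exact: (HN N (leqnn N)).
Qed.

Lemma ae_exists (Q : R -> Prop) : {ae mu, forall x, Q x} -> exists x, Q x.
Proof.
move=> [A [mA A0 QA]]; apply: contrapT => nQ.
have : (mu `[0%R, 1%R] <= mu A)%E.
  apply: le_measure; rewrite ?inE//.
  by move=> x _; apply: QA => /= Qx; apply: nQ; exists x.
rewrite A0.
have -> : mu `[0%R, 1%R] = 1%:E by rewrite lebesgue_measure_itv/= lte_fin ltr01 -EFinD subr0.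
by rewrite lee_fin ler10.
Qed.

(** A bound for the measure of exceptional sets: where e < 1 nothing goes wrong, and
    by Markov the set of the other points has measure at most m per period.
    Budgets add up, and translations preserve them. *)
Definition budget (e : R -> R) (m : R) := [/\ forall x, 0 <= e x, Pperiodic e,
  mu.-integrable setT (fun x => (win P x * e x)%:E) & \int[mu]_x (win P x * e x) <= m].

Lemma budgetD e1 e2 m1 m2 : budget e1 m1 -> budget e2 m2 -> budget (fun x => e1 x + e2 x) (m1 + m2).
Proof.
move=> [p1 q1 i1 b1] [p2 q2 i2 b2]; split.
- by move=> x; rewrite addr_ge0.
- by move=> x k; rewrite q1 q2.
- by under eq_fun do rewrite mulrDr; exact: (@integrableRD _ TR R mu).
- under eq_Rintegral do rewrite mulrDr.
  by rewrite RintegralD//; exact: lerD.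
Qed.

Lemma budgetZ (c : R) e m : 0 <= c -> budget e m -> budget (fun x => c * e x) (c * m).
Proof.
move=> c0 [p1 q1 i1 b1]; split.
- by move=> x; rewrite mulr_ge0.
- by move=> x k; rewrite q1.
- by under eq_fun do rewrite mulrCA; exact: (@integrableRZ _ TR R mu).
- under eq_Rintegral do rewrite mulrCA.
  by rewrite RintegralZl//; exact: ler_wpM2l.
Qed.

Lemma budget_shift (c : R) e m : budget e m -> budget (fun x => e (x + c)) m.
Proof.
move=> [p1 q1 i1 b1]; have [i2 E] := window_shift c q1 i1; split => //.
- by move=> x k; rewrite addrAC q1.
- by rewrite E.
Qed.

Lemma budget0 : budget (fun=> 0) 0.
Proof.
split => //; first by under eq_fun do rewrite mulr0; exact: integrable0.
by under eq_Rintegral do rewrite mulr0; rewrite /Rintegral integral0.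
Qed.

Lemma budget_sum n (e : nat -> R -> R) m : (forall i, budget (e i) m) ->
  budget (fun x => \sum_(i < n) e i x) (n%:R * m).
Proof.
move=> h; elim: n => [|n IH].
  by rewrite mul0r; under eq_fun do rewrite big_ord0; exact: budget0.
under eq_fun do rewrite big_ord_recr/=.
by rewrite -natr1 mulrDl mul1r; exact: budgetD.
Qed.

Lemma budget_le e m m' : m <= m' -> budget e m -> budget e m'.
Proof. by move=> mm [p1 q1 i1 b1]; split => //; exact: le_trans mm. Qed.

End periodic_functions.

Lemma int_norm_lt1 (z : int) : `|z| < 1 -> z = 0. Proof. lia. Qed.

Section rigidity.
Context {R : realType}.
Local Notation mu := (@lebesgue_measure R).
Local Notation TR := (measurableTypeR R).
Variables (P : R) (P0 : 0 < P) (g : R -> R[i]) (alpha C : R).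
Hypothesis lg : sqint mu g.
Hypothesis mg : mu.-integrable setT (fun x => ((x - alpha) ^+ 2 * nsq (g x))%:E).
Hypothesis smooth : forall t, exists2 z : R[i], nsq z = 1 &
  \int[mu]_x nsq (g (x - t) - z * g x) <= C * t ^+ 2.
Hypothesis norm_fiber : {ae mu, forall x, P * \int[Zcount]_k nsq (g (x + k%:~R * P)) = 1}.
Implicit Types (x y t c l : R) (k : int).
Local Notation phi := (center P g alpha).
Local Notation budget := (budget P).

Let V x := \int[Zcount]_k ((x + k%:~R * P - alpha) ^+ 2 * nsq (g (x + k%:~R * P))).
Let diff t (z : R[i]) y := g (y + t) - z * g y.
Let W t z x := \int[Zcount]_k nsq (diff t z (x + k%:~R * P)).

(** With B' = z B one has |A|^2 - |B'|^2 = Re ((A - B') conj (A + B')); the weighted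
    arithmetic-geometric inequality separates the two factors. *)
Lemma nsq_diff_le (d k : R) (A B z : R[i]) : nsq z = 1 -> 0 < k ->
  `|d * (nsq A - nsq B)| <= k * nsq (A - z * B) + d ^+ 2 * (nsq A + nsq B) / (2 * k).
Proof.
move=> z1 k0; have -> : nsq B = nsq (z * B) by rewrite nsqM z1 mul1r.
move: (z * B) => {z z1} B'; case: A B' => a1 a2 [b1 b2]; rewrite /nsq /=.
have kn : k != 0 by rewrite gt_eqF.
set lhs := d * _.
have pos (s : R) : s ^+ 2 = 1 -> s * lhs <= k * ((a1 - b1) ^+ 2 + (a2 - b2) ^+ 2) + d ^+ 2 * (a1 ^+ 2 + a2 ^+ 2 + (b1 ^+ 2 + b2 ^+ 2)) / (2 * k).
  move=> s1; rewrite -subr_ge0.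
  have -> : k * ((a1 - b1) ^+ 2 + (a2 - b2) ^+ 2) + d ^+ 2 * (a1 ^+ 2 + a2 ^+ 2 + (b1 ^+ 2 + b2 ^+ 2)) / (2 * k) - s * lhs =
     ((2 * k * (a1 - b1) - s * d * (a1 + b1)) ^+ 2 + (2 * k * (a2 - b2) - s * d * (a2 + b2)) ^+ 2
      + s ^+ 2 * d ^+ 2 * ((a1 - b1) ^+ 2 + (a2 - b2) ^+ 2)) / (4 * k)
      + (1 - s ^+ 2) * (d ^+ 2 * (a1 ^+ 2 + a2 ^+ 2 + (b1 ^+ 2 + b2 ^+ 2)) / (2 * k)).
    by rewrite /lhs; field.
  rewrite s1 subrr mul0r addr0 mul1r divr_ge0 ?mulr_ge0 ?(ltW k0)//.
  apply: addr_ge0; first by apply: addr_ge0; exact: sqr_ge0.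
  by apply: mulr_ge0; [exact: sqr_ge0|apply: addr_ge0; exact: sqr_ge0].
have := pos 1 (expr1n _ _); have := pos (-1); rewrite sqrrN expr1n => /(_ erefl).
by rewrite mulN1r mul1r ler_norml => h1 h2; rewrite h2 andbT; lra.
Qed.

Let in_nsq f : sqint mu f -> mu.-integrable setT (EFin \o (fun x => nsq (f x))).
Proof. exact: sqint_integrable. Qed.

Let ldiff t z : sqint mu (diff t z).
Proof. by apply: sqintB => //; exact: sqint_shift. Qed.

Let phi_per : Pperiodic P phi.
Proof. exact: (Pperiodic_fiber P (fun y => (y - alpha) * nsq (g y))). Qed.

Let V_per : Pperiodic P V.
Proof. exact: (Pperiodic_fiber P (fun y => (y - alpha) ^+ 2 * nsq (g y))). Qed.

Let W_per t z : Pperiodic P (W t z).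
Proof. exact: (Pperiodic_fiber P (fun y => nsq (diff t z y))). Qed.

Let mphi : mu.-integrable setT (fun x => ((x - alpha) * nsq (g x))%:E).
Proof.
have mgx : measurable_fun [set: TR] (fun x => nsq (g x)) by apply: measurable_nsq; exact: lg.1.
have := @integrableRD _ TR R mu (fun x => nsq (g x)) (fun x => (x - alpha) ^+ 2 * nsq (g x)) (in_nsq lg) mg.
apply: le_integrable => //.
  by apply/measurable_EFinP; apply: measurable_funM => //; exact: measurable_funB.
move=> x _; rewrite /= lee_fin; have := nsq_ge0 (g x); move: (nsq _) (x - alpha) => N d N0.
have -> : N + d ^+ 2 * N = (1 + d ^+ 2) * N by ring.
have d1 : 0 <= (1 + d ^+ 2) * N by rewrite mulr_ge0// addr_ge0 ?sqr_ge0.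
rewrite (ger0_norm d1) normrM (ger0_norm N0).
apply: ler_wpM2r => //; rewrite ler_norml; apply/andP; split; first by have := sqr_ge0 (d + 1); nra.
by have := sqr_ge0 (d - 1); nra.
Qed.

Lemma iwphi : mu.-integrable setT (fun x => (win P x * phi x)%:E).
Proof. exact: (integrable_fiber P0 mphi). Qed.

Let iwV : mu.-integrable setT (fun x => (win P x * V x)%:E).
Proof. exact: (integrable_fiber P0 mg). Qed.

Let iwW t z : mu.-integrable setT (fun x => (win P x * W t z x)%:E).
Proof. exact: (integrable_fiber P0 (in_nsq (ldiff t z))). Qed.

Let V_ge0 x : 0 <= V x.
Proof. by apply: Rintegral_ge0 => k _; rewrite mulr_ge0 ?sqr_ge0 ?nsq_ge0. Qed.

Let W_ge0 t z x : 0 <= W t z x.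
Proof. by apply: Rintegral_ge0 => k _; exact: nsq_ge0. Qed.

(** The mean position moves with the coset by t, which costs |t| / P, and for the
    rest |g(y + t)|^2 - |g(y)|^2 is split with [nsq_diff_le] into the deviation W of
    g from its translate and the second moments V. *)
Lemma center_increment t z (kap : R) : nsq z = 1 -> 0 < kap -> {ae mu, forall x,
  `|phi (x + t) - phi x| <= `|t| / P + kap * W t z x +
     (2 * V (x + t) + 2 * t ^+ 2 / P + V x) / (2 * kap)}.
Proof.
move=> z1 k0.
have A1 := ae_fiber_integrable P0 mphi.
have A2 := ae_fiber_integrable P0 mg.
have A3 := ae_fiber_integrable P0 (in_nsq (ldiff t z)).
have A4 := ae_fiber_integrable P0 (in_nsq lg).
apply: ae_mono (ae_and (ae_and (ae_and A1 (ae_shift t A1)) (ae_and A2 (ae_shift t A2)))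
  (ae_and A3 (ae_and (ae_and A4 (ae_shift t A4)) (ae_shift t norm_fiber)))) => x.
move=> [[[a1 b1] [a2 b2]] [a3 [[a4 b4] nf]]].
pose y k := x + k%:~R * P.
have yt k : x + t + k%:~R * P = y k + t by rewrite /y addrAC.
have S : \int[Zcount]_k nsq (g (y k + t)) = P^-1.
  have Pn : P != 0 by rewrite gt_eqF.
  by apply: (mulfI Pn); rewrite divff// -nf; congr (_ * _); apply: eq_Rintegral => k _; rewrite yt.
have i4 : Zcount.-integrable setT (fun k => (nsq (g (y k + t)))%:E).
  by move: b4; congr integrable; apply/funext => k; rewrite yt.
have i1 : Zcount.-integrable setT (fun k => ((y k - alpha) * nsq (g (y k + t)))%:E).
  rewrite (_ : (fun k => _) = (fun k => ((x + t + k%:~R * P - alpha) * nsq (g (x + t + k%:~R * P)) + (- t) * nsq (g (y k + t)))%:E)); last first.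
    by apply/funext => k; rewrite yt; congr EFin; ring.
  by apply: (@integrableRD _ int R Zcount (fun k => (x + t + k%:~R * P - alpha) * nsq (g (x + t + k%:~R * P)))) => //; exact: (@integrableRZ _ int R Zcount).
have i2 : Zcount.-integrable setT (fun k => (2 * ((x + t + k%:~R * P - alpha) ^+ 2 * nsq (g (x + t + k%:~R * P))) + 2 * t ^+ 2 * nsq (g (y k + t)))%:E).
  by apply: (@integrableRD _ int R Zcount (fun k => 2 * ((x + t + k%:~R * P - alpha) ^+ 2 * nsq (g (x + t + k%:~R * P))))); exact: (@integrableRZ _ int R Zcount).
have E : phi (x + t) = \int[Zcount]_k ((y k - alpha) * nsq (g (y k + t))) + t / P.
  rewrite -S -RintegralZl// -RintegralD//; last exact: (@integrableRZ _ int R Zcount).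
  by apply: eq_Rintegral => k _; rewrite yt; ring.
have idiff : Zcount.-integrable setT (fun k => ((y k - alpha) * (nsq (g (y k + t)) - nsq (g (y k))))%:E).
  rewrite (_ : (fun k => _) = (fun k => ((y k - alpha) * nsq (g (y k + t)) + (-1) * ((y k - alpha) * nsq (g (y k))))%:E)); last first.
    by apply/funext => k; congr EFin; ring.
  by apply: (@integrableRD _ int R Zcount (fun k => (y k - alpha) * nsq (g (y k + t)))) => //; exact: (@integrableRZ _ int R Zcount).
have E2 : phi (x + t) - phi x = \int[Zcount]_k ((y k - alpha) * (nsq (g (y k + t)) - nsq (g (y k)))) + t / P.
  rewrite E addrAC; congr (_ + _); rewrite -RintegralB//.
  by apply: eq_Rintegral => k _; rewrite mulrBr.
rewrite E2; apply: le_trans (ler_normD _ _) _; rewrite addrC -addrA.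
apply: lerD; first by rewrite normrM normfV (gtr0_norm P0).
apply: le_trans (le_normr_Rintegral _ idiff) _ => //.
pose w k := kap * nsq (diff t z (y k)) + ((2 * kap)^-1 * (2 * ((x + t + k%:~R * P - alpha) ^+ 2 * nsq (g (x + t + k%:~R * P))) + 2 * t ^+ 2 * nsq (g (y k + t)))
   + (2 * kap)^-1 * ((y k - alpha) ^+ 2 * nsq (g (y k)))).
have j1 : Zcount.-integrable setT (fun k => (kap * nsq (diff t z (y k)))%:E).
  by exact: (@integrableRZ _ int R Zcount).
have j2 := @integrableRZ _ int R Zcount (2 * kap)^-1 _ i2.
have j3 : Zcount.-integrable setT (fun k => ((2 * kap)^-1 * ((y k - alpha) ^+ 2 * nsq (g (y k))))%:E).
  by exact: (@integrableRZ _ int R Zcount).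
have j23 := @integrableRD _ int R Zcount _ _ j2 j3.
have Ew : \int[Zcount]_k w k = kap * W t z x + (2 * V (x + t) + 2 * t ^+ 2 / P + V x) / (2 * kap).
  have E4 : \int[Zcount]_k (2 * ((x + t + k%:~R * P - alpha) ^+ 2 * nsq (g (x + t + k%:~R * P))) + 2 * t ^+ 2 * nsq (g (y k + t))) =
      2 * V (x + t) + 2 * t ^+ 2 / P.
    have k1 : Zcount.-integrable setT (fun k => (2 * ((x + t + k%:~R * P - alpha) ^+ 2 * nsq (g (x + t + k%:~R * P))))%:E).
      exact: (@integrableRZ _ int R Zcount).
    have k2 : Zcount.-integrable setT (fun k => (2 * t ^+ 2 * nsq (g (y k + t)))%:E).
      exact: (@integrableRZ _ int R Zcount).
    by rewrite RintegralD// !RintegralZl// S.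
  rewrite /w RintegralD// RintegralD// !RintegralZl// E4 -/(V x) -/(W t z x).
  by rewrite -mulrDr [X in _ = _ + X]mulrC.
rewrite -Ew; apply: le_Rintegral => //.
- exact: integrable_abse idiff.
- exact: (@integrableRD _ int R Zcount _ _ j1 j23).
- move=> k _; apply: le_trans (nsq_diff_le _ _ _ z1 k0) _.
  rewrite /w /diff lerD2l -!mulrDr -[X in X <= _]mulrC ler_pM2l ?invr_gt0 ?mulr_gt0//.
  rewrite mulrDr yt lerD2r.
  have -> : 2 * ((y k + t - alpha) ^+ 2 * nsq (g (y k + t))) + 2 * t ^+ 2 * nsq (g (y k + t)) =
    (2 * (y k + t - alpha) ^+ 2 + 2 * t ^+ 2) * nsq (g (y k + t)) by ring.
  apply: ler_wpM2r; first exact: nsq_ge0.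
  have := sqr_ge0 (y k - alpha + 2 * t); move: (y k) => Y.
  by rewrite !expr2; nra.
Qed.

Let W_budget t z : \int[mu]_x nsq (diff t z x) <= C * t ^+ 2 -> budget (W t z) (C * t ^+ 2).
Proof.
move=> h; split => //.
by rewrite -(Rintegral_fiber P0 (in_nsq (ldiff t z))).
Qed.

Let C_ge0 : 0 <= C.
Proof.
have [z _ h] := smooth 1; rewrite expr1n mulr1 in h; apply: le_trans h.
by apply: Rintegral_ge0 => x _; exact: nsq_ge0.
Qed.

(** [center_increment] with weight kap / |t|.  The integral of W is at most C t^2,
    so that its term has budget kap C |t|.  The function V has only a finite
    integral: its part below a level l contributes a constant that is small with t,
    and its tail above l a budget that is small with l, both multiplied by |t|. *)
Lemma small_increment eps : 0 < eps -> exists2 d, 0 < d & forall t, 0 < `|t| <= d ->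
  exists2 e, budget e (eps * `|t|) & {ae mu, forall x, `|phi (x + t) - phi x| <= eps + e x}.
Proof.
move=> e0; pose kap := eps / (2 * (C + 1)).
have C1 : 0 < C + 1 by have := C_ge0; lra.
have k0 : 0 < kap by rewrite divr_gt0// mulr_gt0.
have kC : kap * C <= eps / 2.
  rewrite /kap; have -> : eps / (2 * (C + 1)) * C = eps / 2 * (C / (C + 1)) by field; rewrite gt_eqF.
  rewrite -[leRHS]mulr1; apply: ler_wpM2l; first by rewrite divr_ge0// ltW.
  by rewrite ler_pdivrMr// mul1r; lra.
have t0 : 0 < kap * eps / 3 by rewrite divr_gt0// mulr_gt0.
have [l l0 hl] := small_tail V_ge0 iwV t0.
(* Multiplied by |t|, K bounds the part of the increment that does not depend on x. *)
clearbody kap; pose K := P^-1 + P^-1 / kap + 3 * l / (2 * kap).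
have K0 : 0 < K.
  have h1 : 0 < P^-1 by rewrite invr_gt0.
  have h2 : 0 < P^-1 / kap by rewrite divr_gt0.
  have h3 : 0 <= 3 * l / (2 * kap) by rewrite divr_ge0 ?mulr_ge0// ltW.
  by rewrite /K ltr_wpDr// addr_gt0.
exists (Num.min 1 (eps / K)); first by rewrite lt_min ltr01 divr_gt0.
move=> t /andP[tp]; rewrite le_min => /andP[t1 tK].
have tn : `|t| != 0 by rewrite gt_eqF.
have [z z1 hz] := smooth (- t); rewrite sqrrN in hz.
have {}hz : \int[mu]_x nsq (diff t z x) <= C * t ^+ 2.
  by apply: le_trans hz; under [leRHS]eq_Rintegral do rewrite opprK.
have bT : budget (tail V l) (kap * eps / 3).
  by split=> //; [exact: tail_ge0|exact: Pperiodic_tail|exact: integrable_win_tail].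
exists (fun x => kap / `|t| * W t z x + `|t| / (2 * kap) * (2 * tail V l (x + t) + tail V l x)).
  have b1 := budgetZ (ltW (divr_gt0 k0 tp)) (W_budget hz).
  have b2 := budgetZ (ler0n _ 2) (budget_shift P0 t bT).
  have k2 : 0 <= `|t| / (2 * kap) by rewrite divr_ge0// mulr_ge0// ltW.
  have b3 := budgetZ k2 (budgetD b2 bT).
  apply: budget_le (budgetD b1 b3).
  rewrite -[t ^+ 2]real_normK ?num_real//.
  have -> : kap / `|t| * (C * `|t| ^+ 2) + `|t| / (2 * kap) * (2 * (kap * eps / 3) + kap * eps / 3) =
     (kap * C + eps / 2) * `|t|.
    by field; rewrite tn gt_eqF.
  by apply: ler_wpM2r => //; lra.
apply: ae_mono (center_increment t z1 (divr_gt0 k0 tp)) => x h; apply: le_trans h _.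
have h1 := tail_le V l (x + t); have h2 := tail_le V l x.
move: (tail V l (x + t)) (tail V l x) (V (x + t)) (V x) (W t z x) h1 h2 => T1 T2 V1 V2 w h1 h2.
rewrite -[t ^+ 2]real_normK ?num_real//.
move: `|t| tp t1 tK tn {z z1 hz} => s sp s1 sK sn.
have kn : kap != 0 by rewrite gt_eqF.
have Pn : P != 0 by rewrite gt_eqF.
apply: (@le_trans _ _ (s / P + kap / s * w + (2 * (l + T1) + 2 * s ^+ 2 / P + (l + T2)) / (2 * (kap / s)))).
  rewrite lerD2l ler_pM2r; [lra|by rewrite invr_gt0 mulr_gt0// divr_gt0].
have -> : s / P + kap / s * w + (2 * (l + T1) + 2 * s ^+ 2 / P + (l + T2)) / (2 * (kap / s)) =
  s * (P^-1 + s ^+ 2 * (P^-1 / kap) + 3 * l / (2 * kap)) + (kap / s * w + s / (2 * kap) * (2 * T1 + T2)).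
  by field; rewrite ?Pn ?kn ?sn.
rewrite lerD2r; apply: (@le_trans _ _ (s * K)); last by rewrite -ler_pdivlMr.
apply: ler_wpM2l; first exact: ltW.
rewrite /K lerD2r lerD2l ler_piMl ?divr_ge0 ?invr_ge0// ?(ltW P0) ?(ltW k0)//.
by rewrite expr_le1// ltW.
Qed.

Variables (q : nat) (a u c0 : R).
Let D x := \sum_(r < q) (phi (x - a * r%:R - u) - phi (x - a * r%:R)).
Hypothesis quant : {ae mu, forall x, exists z : int, D x = c0 + z%:~R}.

Let D_per : Pperiodic P D.
Proof.
move=> x k; apply: eq_bigr => r _.
have e c : phi (x + k%:~R * P - c) = phi (x - c) by rewrite addrAC; exact: phi_per.
by rewrite -!addrA -!opprD !addrA !e.
Qed.

(** Two values of D differ by an integer, so that an increment below 1 vanishes;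
    it is a sum of 2 q increments of the function center. *)
Lemma local_constancy eps : 0 < eps -> exists2 d, 0 < d & forall t, 0 < `|t| <= d ->
  exists2 e, budget e (eps * `|t|) & {ae mu, forall x, e x < 1 -> D (x + t) = D x}.
Proof.
move=> e0; pose n : R := q.+1%:R.
have n0 : 0 < n by [].
(* The first bound serves the budget of 2 q terms counted twice, the second one keeps the constant part below 1/2. *)
pose e1 := Num.min (eps / (4 * n)) (4 * n)^-1.
have e10 : 0 < e1 by rewrite lt_min divr_gt0// ?invr_gt0 ?mulr_gt0.
have [d d0 H] := small_increment e10; exists d => // t ht.
have [e be He] := H t ht; have [tp _] := andP ht.
exists (fun x => 2 * (\sum_(r < q) e (x - a * r%:R - u) + \sum_(r < q) e (x - a * r%:R))).
  have b1 := budget_sum q (fun r => budget_shift P0 (- (a * r%:R) - u) be).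
  have b2 := budget_sum q (fun r => budget_shift P0 (- (a * r%:R)) be).
  have := budgetZ (ler0n _ 2) (budgetD b1 b2).
  have -> : (fun x => 2 * (\sum_(i < q) e (x + (- (a * i%:R) - u)) + \sum_(i < q) e (x - a * i%:R))) =
      (fun x => 2 * (\sum_(r < q) e (x - a * r%:R - u) + \sum_(r < q) e (x - a * r%:R))).
    by apply/funext => x; congr (_ * (_ + _)); apply: eq_bigr => r _; rewrite addrA.
  apply: budget_le; have -> : 2 * (q%:R * (e1 * `|t|) + q%:R * (e1 * `|t|)) = 4 * q%:R * e1 * `|t| by ring.
  apply: ler_wpM2r => //.
  have h : e1 <= eps / (4 * n) by rewrite ge_min lexx.
  apply: (@le_trans _ _ (4 * n * e1)); last by rewrite mulrC -ler_pdivlMr// mulr_gt0.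
  rewrite /n -natr1; nra.
have A1 := ae_foralln (fun r => ae_shift (- (a * r%:R) - u) He).
have A2 := ae_foralln (fun r => ae_shift (- (a * r%:R)) He).
apply: ae_mono (ae_and (ae_and A1 A2) (ae_and quant (ae_shift t quant))) => x [[h1 h2] [[z1 q1] [z2 q2]]] small.
have E : D (x + t) - D x = \sum_(r < q) ((phi (x - a * r%:R - u + t) - phi (x - a * r%:R - u)) -
       (phi (x - a * r%:R + t) - phi (x - a * r%:R))).
  rewrite /D -sumrB; apply: eq_bigr => r _.
  have -> : x + t - a * r%:R - u = x - a * r%:R - u + t by ring.
  have -> : x + t - a * r%:R = x - a * r%:R + t by ring.
  by ring.
have bnd : `|D (x + t) - D x| < 1.
  rewrite E; apply: le_lt_trans (ler_norm_sum _ _ _) _.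
  apply: (@le_lt_trans _ _ (\sum_(r < q) ((e1 + e1) + (e (x - a * r%:R - u) + e (x - a * r%:R))))).
    apply: ler_sum => r _; apply: le_trans (ler_normB _ _) _.
    have g1 := h1 r; have g2 := h2 r; rewrite !addrA in g1.
    by apply: le_trans (lerD g1 g2) _; rewrite addrACA.
  have Sc : \sum_(r < q) (e1 + e1) = q%:R * (e1 + e1) by rewrite sumr_const card_ord mulr_natl.
  rewrite big_split/= Sc big_split/=.
  have h : e1 <= (4 * n)^-1 by rewrite ge_min lexx orbT.
  have : n * e1 <= 4^-1.
    by rewrite -(@ler_pM2l _ 4)// mulfV// mulrA -ler_pdivlMl ?mulr1// mulr_gt0.
  rewrite /n -natr1; move: small; move: (\sum_(_ < q) _) (\sum_(_ < q) _) => S1 S2.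
  by move: (q%:R : R) => Q; nra.
have : D (x + t) - D x = (z2 - z1)%:~R by rewrite q1 q2 rmorphB/=; ring.
move=> E2; move: bnd; rewrite E2 -intr_norm -[1]/(1%:~R) ltr_int => hz.
have z0 := int_norm_lt1 hz.
by move: E2; rewrite z0 => /eqP; rewrite subr_eq0 => /eqP.
Qed.

(** In n steps of length s / n the total budget is n times eps |s| / n = eps |s|, and
    eps is arbitrary. *)
Lemma constancy s : {ae mu, forall x, D (x + s) = D x}.
Proof.
have [->|s0] := eqVneq s 0; first by apply: aeW => x; rewrite addr0.
have sp : 0 < `|s| by rewrite normr_gt0.
have H (m : nat) : exists v, budget v m.+1%:R^-1 /\ {ae mu, forall x, v x < 1 -> D (x + s) = D x}.
  have e0 : 0 < m.+1%:R^-1 / `|s| by rewrite divr_gt0 ?invr_gt0.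
  have [d d0 Hd] := local_constancy e0.
  (* Enough steps for s / n to be admissible in [local_constancy]. *)
  pose n := (Num.truncn (`|s| / d)).+1.
  have n0 : 0 < n%:R :> R by [].
  have nd : `|s| / n%:R <= d.
    rewrite ler_pdivrMr// mulrC -ler_pdivrMr//.
    by have /andP[_ /ltW] := truncn_itv (ltW (divr_gt0 sp d0)).
  pose t := s / n%:R.
  have nt : `|t| = `|s| / n%:R by rewrite normrM normfV (gtr0_norm n0).
  have [|e be He] := Hd t; first by rewrite nt divr_gt0.
  exists (fun x => \sum_(j < n) e (x + j%:R * t)); split.
    apply: budget_le (budget_sum n (fun j => budget_shift P0 (j%:R * t) be)).
    by rewrite nt le_eqVlt; apply/orP; left; apply/eqP; field; rewrite ?gt_eqF ?normr_gt0.
  have A := ae_foralln (fun j => ae_shift (j%:R * t) He).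
  apply: ae_mono A => x hx small.
  have step (j : nat) : (j <= n)%N -> D (x + j%:R * t) = D x.
    elim: j => [|j IH] jn; first by rewrite mul0r addr0.
    rewrite -(IH (ltnW jn)) -natr1 mulrDl mul1r addrA; apply: hx.
    apply: le_lt_trans small; rewrite (bigD1 (Ordinal jn))//= lerDl.
    by apply: sumr_ge0 => i _; case: be.
  by rewrite -(step n (leqnn n)); congr (D (x + _)); rewrite /t mulrC divfK// gt_eqF.
have [v Hv] := choice H.
have A := ae_foralln (fun m => (Hv m).2).
have B : {ae mu, forall x, forall eps, 0 < eps -> exists m, win P x * v m x < eps}.
  apply: (ae_small (V := fun m x => win P x * v m x)).
  - by move=> m x; rewrite mulr_ge0 ?win_ge0//; case: (Hv m) => -[].
  - by move=> m; case: (Hv m) => -[].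
  - by move=> m; case: (Hv m) => -[].
apply: (ae_periodic P0).
  by move=> x k; rewrite addrAC !D_per.
apply: ae_mono (ae_and A B) => x [hA hB] xI.
have [m hm] := hB 1 ltr01; apply: (hA m).
by move: hm; rewrite winE// mul1r.
Qed.

(** By invariance n D(x) is the sum of D(x - j u) for j < n, which telescopes to
    Phi(x - n u) - Phi(x) with Phi integrable over a period; divided by n this
    tends to 0 in mean. *)
Lemma D_eq0 : {ae mu, forall x, D x = 0}.
Proof.
pose m0 := \int[mu]_x (win P x * `|phi x|).
have bphi : budget (fun x => `|phi x|) m0.
  split => //; first by move=> x k; rewrite phi_per.
  have := integrable_norm iwphi; congr integrable; apply/funext => x /=.
  by rewrite normrM (ger0_norm (win_ge0 _ _)).
have m00 : 0 <= m0 by apply: Rintegral_ge0 => x _; rewrite mulr_ge0 ?win_ge0.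
pose A x := \sum_(r < q) `|phi (x - a * r%:R)|.
pose Phi x := \sum_(r < q) phi (x - a * r%:R).
have PhiA x : `|Phi x| <= A x by exact: ler_norm_sum.
have DPhi x : D x = Phi (x - u) - Phi x.
  by rewrite /D /Phi -sumrB; apply: eq_bigr => r _; rewrite [x - u - _]addrAC.
have bA : budget A (q%:R * m0) := budget_sum q (fun r => budget_shift P0 (- (a * r%:R)) bphi).
pose M := 2 * q%:R * m0 + 1.
have M0 : 0 < M by rewrite ltr_wpDl// mulr_ge0.
pose v n x := (n.+1%:R * M)^-1 * (A (x - n.+1%:R * u) + A x).
have bV n : budget (v n) n.+1%:R^-1.
  have c1 : 0 <= (n.+1%:R * M)^-1 by rewrite invr_ge0 mulr_ge0// ltW.
  apply: budget_le (budgetZ c1 (budgetD (budget_shift P0 (- (n.+1%:R * u)) bA) bA)).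
  rewrite invfM -mulrA ger_pMr ?invr_gt0// ler_pdivrMl// mulr1 /M.
  by move: (q%:R : R) => Q; lra.
have B : {ae mu, forall x, forall eps, 0 < eps -> exists n, win P x * v n x < eps}.
  apply: (ae_small (V := fun n x => win P x * v n x)).
  - by move=> n x; rewrite mulr_ge0 ?win_ge0//; case: (bV n).
  - by move=> n; case: (bV n).
  - by move=> n; case: (bV n).
have K := ae_foralln (fun n => constancy (- (n%:R * u))).
apply: (ae_periodic P0); first by move=> x k; rewrite D_per.
apply: ae_mono (ae_and K B) => x [hK hB] xI; apply/eqP; rewrite -normr_le0.
apply/ler_addgt0Pr => eps e0; rewrite add0r.
have [n hn] := hB (eps / M) (divr_gt0 e0 M0).
have tele (m : nat) : m%:R * D x = Phi (x - m%:R * u) - Phi x.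
  elim: m => [|m IH]; first by rewrite !mul0r subr0 subrr.
  have e := DPhi (x - m%:R * u); rewrite hK in e.
  have -> : x - m.+1%:R * u = x - m%:R * u - u by rewrite -natr1; ring.
  by rewrite -natr1 mulrDl mul1r IH e; ring.
move: hn; rewrite winE// mul1r /v invfM -mulrA.
have h : n.+1%:R * `|D x| <= A (x - n.+1%:R * u) + A x.
  have -> : n.+1%:R * `|D x| = `|n.+1%:R * D x| by rewrite normrM normr_nat.
  rewrite tele; apply: le_trans (ler_normB _ _) _.
  exact: lerD.
move: (_ + _) h => S h; rewrite mulrCA mulrC ltr_pM2r ?invr_gt0// => h2.
by apply: ltW; apply: le_lt_trans h2; rewrite ler_pdivlMl.
Qed.

End rigidity.

(** * Lattice coordinates and the uncertainty principle *)

Section lattice_coordinates.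
Context {R : realType}.
Local Notation mu := (@lebesgue_measure R).
Local Notation TR := (measurableTypeR R).
Local Notation "'F'" := (osc (- (2 * pi))).
Implicit Types (f g h : R -> R[i]) (a b u eta alpha C P : R) (p : int) (q : nat).

(** Take one point where both [D_eq0] and [ae_index] hold. *)
Lemma lattice_coordinate_period P a q p g u eta alpha C : 0 < P -> p != 0 -> a * q%:R = p%:~R * P ->
  sqint mu g -> mu.-integrable setT (fun x => ((x - alpha) ^+ 2 * nsq (g x))%:E) ->
  (forall t, exists2 z : R[i], nsq z = 1 & \int[mu]_x nsq (g (x - t) - z * g x) <= C * t ^+ 2) ->
  (forall l l' : int * int, cip mu (tfshift (a * l.1%:~R) (P^-1 * l.2%:~R) g)
     (tfshift (a * l'.1%:~R) (P^-1 * l'.2%:~R) g) = (l == l')%:R) ->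
  (forall eps : R, 0 < eps -> exists (s : seq (int * int)) (c : int * int -> R[i]),
    \int[mu]_x nsq (tfshift u eta g x - \sum_(l <- s) c l * tfshift (a * l.1%:~R) (P^-1 * l.2%:~R) g x) <= eps) ->
  exists m : int, u = a * m%:~R.
Proof.
move=> P0 p0 hq lg mg smooth ong spang.
have idx := ae_index P0 p0 hq lg mg ong spang.
have nf := ae_norm_fiber P0 u eta lg mg ong.
have q0 : q%:R != 0 :> R.
  apply/eqP => q0; move/eqP: hq; rewrite q0 mulr0 eq_sym mulf_eq0 intr_eq0 (negbTE p0)/=.
  by rewrite gt_eqF.
have quant : {ae mu, forall x, exists z : int,
    \sum_(r < q) (center P g alpha (x - a * r%:R - u) - center P g alpha (x - a * r%:R)) =
    - (q%:R * u / P) + z%:~R}.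
  apply: ae_mono idx => x [z]; move: (\sum_(r < q) _) => S hS; exists (p * z).
  have Pn : P != 0 by rewrite gt_eqF.
  apply: (mulfI Pn); rewrite mulrDr intrM mulrN mulrCA divff// mulr1.
  by rewrite [P * (_ * _)]mulrA [P * _]mulrC -hq -hS; ring.
have D0 := D_eq0 P0 lg mg smooth nf quant.
have [x [h1 [z]]] := ae_exists (ae_and D0 idx).
rewrite h1 mulr0 add0r => h2; exists z; apply: (mulfI q0).
by rewrite h2; ring.
Qed.

(** Replacing b by |b| only changes the indexing of the system. *)
Lemma lattice_coordinate a b q p g u eta alpha C : b != 0 -> p != 0 -> a * b * q%:R = p%:~R ->
  sqint mu g -> mu.-integrable setT (fun x => ((x - alpha) ^+ 2 * nsq (g x))%:E) ->
  (forall t, exists2 z : R[i], nsq z = 1 & \int[mu]_x nsq (g (x - t) - z * g x) <= C * t ^+ 2) ->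
  (forall l l' : int * int, cip mu (tfshift (a * l.1%:~R) (b * l.2%:~R) g)
     (tfshift (a * l'.1%:~R) (b * l'.2%:~R) g) = (l == l')%:R) ->
  (forall eps : R, 0 < eps -> exists (s : seq (int * int)) (c : int * int -> R[i]),
    \int[mu]_x nsq (tfshift u eta g x - \sum_(l <- s) c l * tfshift (a * l.1%:~R) (b * l.2%:~R) g x) <= eps) ->
  exists m : int, u = a * m%:~R.
Proof.
move=> b0 p0 hq lg mg smooth ong spang.
have bn : `|b|^-1 != 0 by rewrite invr_eq0 normr_eq0.
pose e : int := if 0 < b then 1 else -1.
have e2 : e * e = 1 by rewrite /e; case: ifP.
have be : b * e%:~R = `|b|.
  rewrite /e; case: ltgtP b0 => // [h|h] _; first by rewrite gtr0_norm// mulr1.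
  by rewrite ltr0_norm// mulrN1.
have bl (n : int) : `|b|^-1^-1 * n%:~R = b * (e * n)%:~R by rewrite invrK -be intrM mulrA.
apply: (@lattice_coordinate_period `|b|^-1 a q (p * e) g u eta alpha C) => //.
- by rewrite invr_gt0 normr_gt0.
- by rewrite mulf_neq0// /e; case: ifP.
- have ab0 : `|b| != 0 by rewrite normr_eq0.
  apply: (mulIf ab0); rewrite divfK// intrM -hq -be; ring.
- move=> [l1 l2] [l1' l2']; rewrite /= !bl (ong (l1, e * l2) (l1', e * l2')) !xpair_eqE.
  have ei : injective ( *%R e) by move=> x y /(congr1 ( *%R e)); rewrite !mulrA e2 !mul1r.
  by rewrite (inj_eq ei).
- move=> eps /spang[s [c hs]].
  exists [seq (l.1, e * l.2) | l <- s], (fun l => c (l.1, e * l.2)).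
  apply: le_trans hs; rewrite le_eqVlt; apply/orP; left; apply/eqP.
  apply: eq_Rintegral => x _; congr (nsq (_ - _)); rewrite big_map; apply: eq_bigr => -[l1 l2] _ /=.
  by rewrite bl mulrA e2 mul1r.
Qed.

(** By Parseval the Fourier transform maps the system to the system of the transform
    of g for the lattice rotated by a quarter turn, up to phases; the closed span
    and orthonormality are preserved. *)
Lemma both_coordinates a b q p g u eta alpha beta : a != 0 -> b != 0 -> p != 0 -> a * b * q%:R = p%:~R ->
  sqint mu g -> cintegrable mu g -> cintegrable mu (F g) ->
  mu.-integrable setT (fun x => ((x - alpha) ^+ 2 * nsq (g x))%:E) ->
  mu.-integrable setT (fun w => ((w - beta) ^+ 2 * nsq (F g w))%:E) ->
  (forall l l' : int * int, cip mu (tfshift (a * l.1%:~R) (b * l.2%:~R) g)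
     (tfshift (a * l'.1%:~R) (b * l'.2%:~R) g) = (l == l')%:R) ->
  (forall eps : R, 0 < eps -> exists (s : seq (int * int)) (c : int * int -> R[i]),
    \int[mu]_x nsq (tfshift u eta g x - \sum_(l <- s) c l * tfshift (a * l.1%:~R) (b * l.2%:~R) g x) <= eps) ->
  (exists m : int, u = a * m%:~R) /\ (exists n : int, eta = b * n%:~R).
Proof.
move=> a0 b0 p0 hq lg Ig IG mg mG ong spang; split.
  exact: (lattice_coordinate b0 p0 hq lg mg (shift_close Ig IG mG) ong spang).
have lG := sqint_osc Ig IG.
pose ph (l : int * int) : R[i] := expi (2 * pi * (a * l.1%:~R) * (b * l.2%:~R)).
pose sw (l : int * int) := (l.2, l.1).
have If l := cintegrable_tfshift (a * l.1%:~R) (b * l.2%:~R) Ig : cintegrable mu (tfshift (a * l.1%:~R) (b * l.2%:~R) g).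
have FE l w : F (tfshift (a * l.1%:~R) (b * l.2%:~R) g) w =
    ph l * tfshift (b * l.2%:~R) (- a * l.1%:~R) (F g) w.
  by rewrite osc_tfshift// mulNr.
have IF l : cintegrable mu (F (tfshift (a * l.1%:~R) (b * l.2%:~R) g)).
  by rewrite (funext (FE l)); apply: cintegrableZ; exact: cintegrable_tfshift.
have phK l : ph l * conjc (ph l) = 1 by exact: expi_conj.
have FE' l w : tfshift (b * l.2%:~R) (- a * l.1%:~R) (F g) w =
    conjc (ph l) * F (tfshift (a * l.1%:~R) (b * l.2%:~R) g) w.
  by rewrite FE mulrA [conjc _ * _]mulrC phK mul1r.
apply: (@lattice_coordinate b (- a) q (- p) (F g) eta (- u) beta
  ((2 * pi) ^+ 2 * \int[mu]_x ((x - alpha) ^+ 2 * nsq (g x)))) => //.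
- by rewrite oppr_eq0.
- by rewrite oppr_eq0.
- by rewrite mulrN mulNr [b * a]mulrC hq rmorphN.
- exact: shift_close_osc.
- move=> l l'; rewrite (funext (FE' (sw l))) (funext (FE' (sw l'))).
  rewrite /cip; transitivity (conjc (ph (sw l)) * ph (sw l') * cip mu (F (tfshift (a * l.2%:~R) (b * l.1%:~R) g))
     (F (tfshift (a * l'.2%:~R) (b * l'.1%:~R) g))).
    rewrite /cip -cintZ; last first.
      by apply: sqintJM; exact: (sqint_osc (If (sw _)) (IF (sw _))).
    by apply: eq_cint => w; rewrite conjM conjcK; ring.
  rewrite -parseval; [|exact: (If (sw l))|exact: (If (sw l'))|exact: (IF (sw l'))].
  rewrite (ong (sw l) (sw l')) /sw xpair_eqE andbC -xpair_eqE -!surjective_pairing.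
  have [->|ne] := eqVneq l l'; last by rewrite mulr0.
  by rewrite mulr1 mulrC phK.
- move=> eps /spang[s [c hs]].
  pose hp := expi (2 * pi * u * eta) : R[i].
  exists (map sw s), (fun l => conjc hp * c (sw l) * ph (sw l)).
  pose d x := tfshift u eta g x + \sum_(l <- s) (- c l) * tfshift (a * l.1%:~R) (b * l.2%:~R) g x.
  have It l : cintegrable mu (fun x => (- c l) * tfshift (a * l.1%:~R) (b * l.2%:~R) g x).
    exact: cintegrableZ.
  have Ih := cintegrable_tfshift u eta Ig.
  have Id : cintegrable mu d by apply: cintegrableD => //; exact: (cint_sum s It).1.
  have Fd w : F d w = hp * tfshift eta (- u) (F g) w + \sum_(l <- s) (- c l) * (ph l * tfshift (b * l.2%:~R) (- a * l.1%:~R) (F g) w).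
    rewrite oscD//; last exact: (cint_sum s It).1.
    rewrite osc_tfshift// osc_sum//; congr (_ + _); apply: eq_bigr => l _.
    by rewrite oscZ// FE.
  have IFd : cintegrable mu (F d).
    rewrite (funext Fd); apply: cintegrableD; first by apply: cintegrableZ; exact: cintegrable_tfshift.
    apply: (cint_sum s _).1 => l; apply: cintegrableZ; apply: cintegrableZ; exact: cintegrable_tfshift.
  apply: le_trans hs; rewrite le_eqVlt; apply/orP; left; apply/eqP.
  transitivity (\int[mu]_w nsq (F d w)).
    apply: eq_Rintegral => w _; transitivity (nsq (conjc hp * F d w)); last by rewrite nsqM nsqJ nsq_expi mul1r.
    have hk : conjc hp * hp = 1 by rewrite mulrC; exact: expi_conj.
    rewrite Fd (mulrDr (conjc hp)) (mulrA (conjc hp) hp) hk mul1r; congr (nsq (_ + _)).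
    rewrite big_map mulr_sumr -sumrN; apply: eq_bigr => -[l1 l2] _; rewrite /sw /=; ring.
  rewrite -parseval_nsq//; apply: eq_Rintegral => x _; rewrite /d; congr (nsq (_ + _)).
  by rewrite -sumrN; apply: eq_bigr => l _; rewrite mulNr.
Qed.

End lattice_coordinates.

Section second_moments.
Context {R : realType}.
Local Notation mu := (@lebesgue_measure R).
Local Notation TR := (measurableTypeR R).
Local Notation "'F'" := (osc (- (2 * pi))).
Implicit Types (f g h gh : R -> R[i]) (alpha : R).

(** Let k(w) = e^(-|w|) and let F k be its transform, a positive multiple of a
    Poisson kernel.  Pairing gh = 0 with the translates of k shows that the
    integrable function g F k has a vanishing transform, hence g = 0. *)
Lemma fourier_transform_eq0 g gh : sqint mu g -> is_fourier_transform g gh ->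
  {ae mu, forall w, gh w = 0} -> {ae mu, forall x, g x = 0}.
Proof.
move=> lg ft gh0; have lgh : sqint mu gh by have [/inL2P] := ft.
pose k w : R[i] := (abel 1 w)%:C * expi (0 * w).
have lk : sqint mu k := sqint_abel_expi 0.
have Ik : cintegrable mu k := cintegrableM_expi 0 cintegrable_abel.
have lFk : sqint mu (F k) by rewrite (funext (osc_abel 0)); exact: sqint_poisson.
have IG : cintegrable mu (fun x => g x * F k x) by exact: sqintM.
have FG s : F (fun x => g x * F k x) s = 0.
  have Fks x : F (tfshift s 0 k) x = F k x * expi (- (2 * pi) * s * x).
    rewrite osc_tfshift// mulr0 expi0 mul1r /tfshift subr0 mulrC; congr (_ * expi _); ring.
  have lFks : sqint mu (F (tfshift s 0 k)).
    rewrite (funext Fks); under eq_fun do rewrite mulrC.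
    by apply: sqintM_bounded => //; [exact: cmeas_expi_lin|move=> x; rewrite nsq_expi].
  have := fourier_pairing lg ft (cintegrable_tfshift s 0 Ik) (sqint_tfshift s 0 lk) lFks.
  have -> : cint mu (fun w => gh w * tfshift s 0 k w) = 0.
    rewrite -[RHS](mul0r (cint mu (fun=> 0 : R[i]))) -cintZ; last by split; exact: integrable0.
    apply: ae_eq_cint; [|exact: cmeas_cst|].
      by apply: cmeasM; [exact: lgh.1|exact: (sqint_tfshift s 0 lk).1].
    by apply: ae_mono gh0 => w ->; rewrite !mul0r.
  by move=> ->; apply: eq_cint => x; rewrite Fks mulrA.
apply: ae_mono (fourier_unique IG FG) => x /eqP; rewrite mulf_eq0 => /orP[/eqP//|].
rewrite (osc_abel 0) eq_complex /= gt_eqF//.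
by rewrite divr_gt0// ltr_pwDl// sqr_ge0.
Qed.

Let moment f alpha := (\int[mu]_x ((x - alpha) ^+ 2 * nsq (f x))%:E)%E.

Let measurable_moment f alpha : sqint mu f ->
  measurable_fun [set: TR] (fun x => (x - alpha) ^+ 2 * nsq (f x)).
Proof.
move=> [mf _]; apply: measurable_funM; last exact: measurable_nsq.
by apply: measurable_funX; exact: measurable_funB.
Qed.

Lemma ae_integrable (v w : R -> R) : measurable_fun [set: TR] w -> {ae mu, forall x, v x = w x} ->
  mu.-integrable setT (EFin \o v) -> mu.-integrable setT (EFin \o w).
Proof.
move=> mw vw iv; apply/integrableP; split; first exact/measurable_EFinP.
have /integrableP[mv fv] := iv; apply: le_lt_trans fv; rewrite le_eqVlt; apply/orP; left; apply/eqP.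
apply: ae_eq_integral => //.
- by apply: measurableT_comp => //; exact/measurable_EFinP.
- exact: measurableT_comp.
- by apply: ae_mono vw => x /= ->.
Qed.

Lemma moment_integrable f alpha : sqint mu f -> (moment f alpha < +oo)%E ->
  mu.-integrable setT (fun x => ((x - alpha) ^+ 2 * nsq (f x))%:E).
Proof.
move=> lf fi; apply/integrableP; split; first by apply/measurable_EFinP; exact: measurable_moment.
rewrite (eq_integral (fun x : TR => ((x - alpha) ^+ 2 * nsq (f x))%:E))// => x _.
by rewrite gee0_abs// lee_fin mulr_ge0 ?sqr_ge0 ?nsq_ge0.
Qed.

Lemma moment_eq0 f alpha : sqint mu f -> moment f alpha = 0%E -> {ae mu, forall x, f x = 0}.
Proof.
move=> lf f0.
have mE : measurable_fun [set: TR] (fun x => ((x - alpha) ^+ 2 * nsq (f x))%:E).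
  apply/measurable_EFinP; exact: measurable_moment.
have h : ae_eq mu setT (fun x : TR => ((x - alpha) ^+ 2 * nsq (f x))%:E) (cst 0%E).
  apply/(ae_eq_integral_abs mu measurableT mE); rewrite -f0; apply: eq_integral => x _.
  by rewrite gee0_abs// lee_fin mulr_ge0 ?sqr_ge0 ?nsq_ge0.
apply: ae_mono (ae_and h (ae_neq alpha)) => x [/(_ I) /= [] /eqP].
rewrite mulf_eq0 sqrf_eq0 subr_eq0 => /orP[->//|/eqP/nsq_eq0->//].
Qed.

End second_moments.

Theorem theorem1p2 (R : realType) (a b : R) (g gh : R -> R[i])
    (hab1 : 1 <= a * b)
    (habQ : exists q : rat, a * b = ratr q)
    (hg : inL 2 g)
    (hgh : is_fourier_transform g gh)
    (hON : orthonormal_system (gabor_system a b g))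
    (hspan : exists u eta : R,
      ~ (exists m n : int, u = a * m%:~R /\ eta = b * n%:~R) /\
      closed_linear_span (gabor_system a b g) (tfshift u eta g))
    (alpha beta : R) :
  ((\int[@lebesgue_measure R]_x (`|x - alpha| ^+ 2 * Normc.normc (g x) ^+ 2)%:E) *
   (\int[@lebesgue_measure R]_w (`|w - beta| ^+ 2 * Normc.normc (gh w) ^+ 2)%:E)
   = +oo)%E.
Proof.
pose mu := @lebesgue_measure R.
have lg : sqint mu g by exact/inL2P.
have lgh : sqint mu gh by have [/inL2P] := hgh.
have E f (c : R) : (\int[mu]_x (`|x - c| ^+ 2 * Normc.normc (f x) ^+ 2)%:E =
    \int[mu]_x ((x - c) ^+ 2 * nsq (f x))%:E)%E.
  by apply: eq_integral => x _; rewrite real_normK ?num_real// normc_sqr.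
rewrite !E; set I1 := (\int[_]_x _)%E; set I2 := (\int[_]_w _)%E.
have ge0 f (c : R) : (0 <= \int[mu]_x ((x - c) ^+ 2 * nsq (f x))%:E)%E.
  by apply: integral_ge0 => x _; rewrite lee_fin mulr_ge0 ?sqr_ge0 ?nsq_ge0.
have ong (l l' : int * int) : cip mu (tfshift (a * l.1%:~R) (b * l.2%:~R) g)
     (tfshift (a * l'.1%:~R) (b * l'.2%:~R) g) = (l == l')%:R by exact: hON.2.
have gn0 : ~ {ae mu, forall x, g x = 0}.
  move=> g0; have := ong (0, 0) (0, 0); rewrite eqxx /= !mulr0 => /eqP; apply/negP.
  have -> : tfshift 0 0 g = g by apply/funext => x; rewrite /tfshift mulr0 mul0r expi0 mul1r subr0.
  have -> : cip mu g g = 0.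
    rewrite -[RHS](mul0r (cint mu (fun=> 0 : R[i]))) -cintZ; last by split; exact: integrable0.
    apply: ae_eq_cint; [|exact: cmeas_cst|].
      by apply: cmeasM; [exact: lg.1|apply: cmeasJ; exact: lg.1].
    by apply: ae_mono g0 => x ->; rewrite !mul0r.
  by rewrite eq_sym oner_eq0.
have I1n : I1 != 0%E by apply/eqP => /(moment_eq0 lg).
have I2n : I2 != 0%E by apply/eqP => /(moment_eq0 lgh) /(fourier_transform_eq0 lg hgh).
have I1p : (0 < I1)%E by rewrite lt_neqAle eq_sym I1n ge0.
have I2p : (0 < I2)%E by rewrite lt_neqAle eq_sym I2n ge0.
have [f1|] := ltP I1 +oo%E; last by rewrite leye_eq => /eqP->; rewrite gt0_mulye.
have [f2|] := ltP I2 +oo%E; last by rewrite leye_eq => /eqP->; rewrite gt0_muley.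
exfalso.
have mg := moment_integrable lg f1; have mgh := moment_integrable lgh f2.
have Ig := moment_cintegrable lg mg; have Igh := moment_cintegrable lgh mgh.
have eF := fourier_transform_integrable Ig lg hgh.
pose G := osc (- (2 * pi)) g.
have mG : cmeas G := cmeas_osc (- (2 * pi)) Ig.
have IG : cintegrable mu G.
  have [m1 m2] := mG; split.
    by apply: ae_integrable Igh.1 => //; apply: ae_mono eF => w ->.
  by apply: ae_integrable Igh.2 => //; apply: ae_mono eF => w ->.
have mmG : mu.-integrable setT (fun w => ((w - beta) ^+ 2 * nsq (G w))%:E).
  apply: ae_integrable mgh; last by apply: ae_mono eF => w ->.
  apply: measurable_funM; last exact: measurable_nsq.
  by apply: measurable_funX; exact: measurable_funB.
have [u [eta [nl [_ span]]]] := hspan.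
have [r hr] := habQ.
have ab0 : a * b != 0 by rewrite gt_eqF// (lt_le_trans _ hab1).
have [a0 b0] : a != 0 /\ b != 0 by apply/andP; rewrite -negb_or -mulf_eq0.
have p0 : numq r != 0.
  by apply/eqP => p0; move: ab0; rewrite hr /ratr p0 mul0r eqxx.
have hq : a * b * `|denq r|%N%:R = (numq r)%:~R.
  rewrite hr /ratr natr_absz (gtr0_norm (denq_gt0 r)) divfK//.
  by rewrite intr_eq0 denq_neq0.
have spang (eps : R) : 0 < eps -> exists (s : seq (int * int)) (c : int * int -> R[i]),
    \int[mu]_x nsq (tfshift u eta g x - \sum_(l <- s) c l * tfshift (a * l.1%:~R) (b * l.2%:~R) g x) <= eps.
  move=> e0; have s0 : 0 < Num.sqrt eps by rewrite sqrtr_gt0.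
  have [f [s [c fE]] /cLnorm_lt] := span _ s0.
  rewrite sqr_sqrtr ?ltW// fE => h; exists s, c.
  have ls : sqint mu (fun x => \sum_(l <- s) c l * tfshift (a * l.1%:~R) (b * l.2%:~R) g x).
    elim: (s) => [|l t IH]; first by under eq_fun do rewrite big_nil; exact: sqint0.
    by under eq_fun do rewrite big_cons; apply: sqintZD => //; exact: sqint_tfshift.
  have ld := sqintB 1 (sqint_tfshift u eta lg) ls.
  rewrite -lee_fin -L2_nrm2 L2_nrm2E; last by move: ld; congr sqint; apply/funext => x; rewrite mul1r.
  exact: ltW h.
have [[m hm] [n hn]] := both_coordinates a0 b0 p0 hq lg Ig IG mg mmG ong spang.
by apply: nl; exists m, n.
Qed.
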